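(* Let $(\mathcal{F}_n)_{n\ge0}$ be a decreasing filtration on a probability space $(\Omega,\mathcal{F},\mathbb{P})$, and let $(Y_n,\mathcal{F}_n)_{n\ge0}$ be $\mathbb{R}^2$-valued reverse martingale differences, that is, for every $n\ge 0$, $Y_n$ is $\mathcal{F}_n$-measurable and $\mathbb{E}(Y_n\mid\mathcal{F}_{n+1})=0$. Assume that $|Y_n|\le c_n$ almost surely for deterministic constants $c_n\ge0$, and put $$M_N=\sum_{n=0}^{N-1}Y_n,\qquad Q_N=\sum_{n=0}^{N-1}\mathbb{E}(Y_nY_n^{T}\mid\mathcal{F}_{n+1}),\qquad c_N^*=\max_{0\le n<N}c_n .$$ Let $v_N>0$ be deterministic and nondecreasing in $N$, with $v_N\to\infty$, and assume that, as $N\to\infty$, $$\frac{Q_N}{v_N^2}\longrightarrow\frac12 I_2\quad\text{almost surely},\qquad \frac{c_N^*\sqrt{L(L(v_N^2))}}{v_N}\longrightarrow0 .$$ Then, almost surely, $$\mathrm{Cl}\left\{\frac{M_N}{v_N\sqrt{L(L(v_N^2))}}:N\ge1\right\}=\{x\in\mathbb{R}^2:|x|\le1\}.$$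
   Context: A decreasing filtration is a sequence of sub-$\sigma$-algebras $\mathcal{F}_0\supseteq\mathcal{F}_1\supseteq\cdots$ of $\mathcal{F}$. $|\cdot|$ is the Euclidean norm on $\mathbb{R}^2$, vectors are columns, $Y^T$ is the transpose, and $I_2$ is the $2\times2$ identity matrix. $L(x):=\log(\max\{e,x\})$. For a sequence $(x_N)$ in $\mathbb{R}^2$, $\mathrm{Cl}\{x_N:N\ge1\}$ is the set of all its subsequential limits. *)

(* Defs.v *)
From HB Require Import structures.
From mathcomp Require Export all_boot all_order all_algebra.
From mathcomp Require Export all_classical all_reals all_analysis.
Export Order.TTheory GRing.Theory Num.Theory numFieldNormedType.Exports.

Set Implicit Arguments.
Unset Strict Implicit.
Unset Printing Implicit Defensive.

Local Open Scope classical_set_scope.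
Local Open Scope ring_scope.

Definition L (R : realType) (x : R) : R := ln (Num.max (expR 1) x).

(* The library norm on matrices is the sup norm, so the Euclidean norm is
   defined separately; convergence is the same for both. *)
Definition enorm (R : realType) (m : nat) (x : 'cV[R]_m) : R :=
  Num.sqrt (\sum_(i < m) x i 0 ^+ 2).

(* The set of subsequential limits of (u N) for N >= 1. *)
Definition Cl (U : topologicalType) (u : nat -> U) : set U :=
  [set x | exists phi : nat -> nat,
    [/\ {homo phi : i j / (i < j)%N}, forall k, (0 < phi k)%N
      & u (phi k) @[k --> \oo] --> x]].

Definition decreasing_filtration (d : measure_display) (T : measurableType d)
    (F : nat -> set (set T)) : Prop :=
  [/\ forall n, sigma_algebra [set: T] (F n),
      forall n, F n `<=` measurable
    & forall n, F n.+1 `<=` F n].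

(* Measurability for G and the Borel sets of U. *)
Definition measurable_wrt (d : measure_display) (T : measurableType d)
    (G : set (set T)) (U : ptopologicalType) (f : T -> U) : Prop :=
  @measurable_fun _ _ (g_sigma_algebraType G) (g_sigma_algebraType (@open U))
    [set: T] f.

(* Conditional expectations are determined only up to null sets:
   [is_cond_exp P G X Z] says that Z is a version of E(X | G). *)
Definition is_cond_exp (d : measure_display) (T : measurableType d)
    (R : realType) (P : probability T R) (G : set (set T)) (X Z : T -> R)
    : Prop :=
  [/\ P.-integrable [set: T] (EFin \o X),
      P.-integrable [set: T] (EFin \o Z),
      measurable_wrt G Z
    & forall A, G A ->
        (\int[P]_(w in A) (Z w)%:E = \int[P]_(w in A) (X w)%:E)%E].

Definition is_cond_exp_mx (d : measure_display) (T : measurableType d)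
    (R : realType) (P : probability T R) (G : set (set T)) (m n : nat)
    (X Z : T -> 'M[R]_(m, n)) : Prop :=
  forall i j, is_cond_exp P G (fun w => X w i j) (fun w => Z w i j).

Definition reverse_martingale_difference (d : measure_display)
    (T : measurableType d) (R : realType) (P : probability T R)
    (F : nat -> set (set T)) (m : nat) (Y : nat -> T -> 'cV[R]_m) : Prop :=
  forall n, measurable_wrt (F n) (Y n) /\
            is_cond_exp_mx P (F n.+1) (Y n) (fun _ => 0).

(* Main.v *)
Require Import Defs.
From mathcomp Require Import measurable_realfun ring lra zify.

(** Fix a top index [N] and let [m] run down from [N] to [0]. The tail sums
    of [Y n] over [m <= n < N] then form an ordinary martingale, because the
    sigma-algebras grow as [n] decreases, and the conditional covariances are
    predictable in that direction. All the estimates rest on this.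

    For a small step [y] with conditional variance [s] one has
    [1 + y + (1 - k) / 2 * y ^+ 2 <= expR y <= 1 + y + (1 + k) / 2 * y ^+ 2]
    when [`|y| <= k], so the weighted expectation of
    [expR (y - (1 + k) / 2 * s)] is at most, and that of
    [expR (y - (1 - 2 * k) / 2 * s)] at least, the expectation of the weight
    ([exp_step_le], [exp_step_ge]). Chaining the steps downwards gives the same
    bounds for tail sums ([chain_le], [chain_ge]). No conditional expectation
    is ever formed: conditioning means testing against bounded measurable
    weights. The hypothesis on the bounds [c n] makes [k] tend to zero for
    tilts of the order of [sqrtLL v N / v N].

    Upper half. In a fixed direction the exponential maximal inequality
    ([tail_maximal]) and the Borel-Cantelli lemma along a geometric grid with
    ratio close to one bound the sums at the grid points with the sharp
    constant, and inside a block the sum differs from its value at the grid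
    point by a difference of two tails with small variance
    ([scalar_upper_lil]). Directions with rational coordinates cut out the
    unit disc, whence every limit point has norm at most one.

    Lower half. Take a grid of large ratio and a target [x] inside the disc.
    Tilting the block sum by [2 * sqrtLL v N / v N] times [x] moves it close
    to [x] at the scale [v N * sqrtLL v N]; Chernoff bounds in five further
    tilts show this, using exponential moments alone. The density of the tilt
    is at most [expR (L (L (v N ^+ 2)))] on the event reached, so the block
    hits its target with conditional probability at least half the inverse of
    that number ([hit_prob]), which is of the order of [1 / k] for the [k]-th
    block. The conditioning is on the sigma-algebra above the block, in which
    all later blocks are measurable, so the probability that none of a range
    of blocks hits is at most the product of the factors [1 - p k], and this
    product tends to zero ([missed_prob]). The sum before the block is
    negligible by the upper half ([near_target_infinitely_often]).

    Since the conditional covariance of a block is controlled only in the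
    limit, the block is stopped when its variance in the direction [x] gets
    too large, and a block with a wrong covariance counts as a hit; almost
    surely neither happens from some block on. *)

Set Implicit Arguments.
Unset Strict Implicit.
Unset Printing Implicit Defensive.

Local Open Scope classical_set_scope.
Local Open Scope ring_scope.

(** * Bounded measurable functions *)

Section BoundedMeasurable.
Context (d : measure_display) (T : measurableType d) (R : realType).
Implicit Types (G : set (set T)) (f g : T -> R) (b : T -> bool).

(** Measurability for a sub-sigma-algebra, with values in the standard Borel
    structure, so that sums, products and comparisons of measurable functions
    are available. *)
Definition mfun_wrt G f : Prop :=
  @measurable_fun _ _ (g_sigma_algebraType G) R [set: T] f.

Definition bounded_mfun G f : Prop := mfun_wrt G f /\ exists K, forall w, `|f w| <= K.

Definition mbool_wrt G b : Prop :=
  @measurable_fun _ _ (g_sigma_algebraType G) bool [set: T] b.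

Lemma measurable_wrtE G f : measurable_wrt G f -> mfun_wrt G f.
Proof.
move=> mf _; apply: (measurability _ (measurable_realfun.RGenOpens.measurableE R)) => //.
move=> _ [_ [a [b ->] <-]]; apply: mf => //.
by apply: sub_sigma_algebra; exact: interval_open.
Qed.

Lemma measurable_wrt_comp G (U : ptopologicalType) (f : T -> U) (g : U -> R) :
  measurable_wrt G f -> continuous g -> mfun_wrt G (g \o f).
Proof.
move=> mf cg; apply: measurable_wrtE => _ B mB.
rewrite setTI comp_preimage -[X in measurable X]setTI.
apply: mf => //; move: B mB; apply: smallest_sub.
  split=> [|A|A]; rewrite /= ?preimage_set0 ?preimage_setD ?preimage_setT.
  - exact: sigma_algebra0.
  - by move=> mA; exact: sigma_algebraCD.
  - by move=> mA; rewrite preimage_bigcup; exact: sigma_algebra_bigcup.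
by move=> B oB; apply: sub_sigma_algebra; move/continuousP: cg; apply.
Qed.

Lemma mfun_sub G G' f : G `<=` G' -> mfun_wrt G f -> mfun_wrt G' f.
Proof.
move=> sub mf _ B mB; have := mf measurableT B mB; move: (_ `&` _).
apply: smallest_sub; first exact: smallest_sigma_algebra.
by move=> A /sub GA; exact: sub_sigma_algebra.
Qed.

Lemma bm_sub G G' f : G `<=` G' -> bounded_mfun G f -> bounded_mfun G' f.
Proof. by move=> s [mf bf]; split=> //; exact: mfun_sub mf. Qed.

Lemma bm_cst G r : bounded_mfun G (fun=> r).
Proof. by split; [exact: measurable_cst | exists `|r|]. Qed.

Lemma bmD G f g : bounded_mfun G f -> bounded_mfun G g -> bounded_mfun G (fun w => f w + g w).
Proof.
move=> [mf [K fK]] [mg [K' gK]]; split; first exact: measurable_funD.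
exists (K + K') => w; rewrite (le_trans (ler_normD _ _))//.
by apply: lerD.
Qed.

Lemma bmM G f g : bounded_mfun G f -> bounded_mfun G g -> bounded_mfun G (fun w => f w * g w).
Proof.
move=> [mf [K fK]] [mg [K' gK]]; split; first exact: measurable_funM.
exists (K * K') => w; rewrite normrM.
by apply: ler_pM.
Qed.

Lemma bmZ G r f : bounded_mfun G f -> bounded_mfun G (fun w => r * f w).
Proof. by apply: bmM; exact: bm_cst. Qed.

Lemma bmN G f : bounded_mfun G f -> bounded_mfun G (fun w => - f w).
Proof.
by move=> /(bmZ (-1)); congr bounded_mfun; apply/funext => w; rewrite mulN1r.
Qed.

Lemma bmB G f g : bounded_mfun G f -> bounded_mfun G g -> bounded_mfun G (fun w => f w - g w).
Proof. by move=> ? ?; apply: bmD => //; exact: bmN. Qed.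

Lemma bmX2 G f : bounded_mfun G f -> bounded_mfun G (fun w => f w ^+ 2).
Proof. by move=> bf; apply: bmM. Qed.

Lemma bm_sum G (I : Type) (r : seq I) (f : I -> T -> R) :
  (forall i, bounded_mfun G (f i)) -> bounded_mfun G (fun w => \sum_(i <- r) f i w).
Proof.
move=> bf; elim: r => [|i r IH].
  by under eq_fun do rewrite big_nil; exact: bm_cst.
by under eq_fun do rewrite big_cons; exact: bmD.
Qed.

Lemma bm_expR G f : bounded_mfun G f -> bounded_mfun G (fun w => expR (f w)).
Proof.
move=> [mf [K fK]]; split.
  exact: (@measurableT_comp _ _ _ (g_sigma_algebraType G) R R expR setT f).
exists (expR K) => w; rewrite ger0_norm ?expR_ge0// ler_expR.
by rewrite (le_trans (ler_norm _)).
Qed.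

Lemma mbool_le G f g : mfun_wrt G f -> mfun_wrt G g -> mbool_wrt G (fun w => f w <= g w).
Proof. by move=> mf mg; exact: measurable_fun_ler. Qed.

Lemma mbool_lt G f g : mfun_wrt G f -> mfun_wrt G g -> mbool_wrt G (fun w => f w < g w).
Proof. by move=> mf mg; exact: measurable_fun_ltr. Qed.

Lemma mbool_and G b b' : mbool_wrt G b -> mbool_wrt G b' ->
  mbool_wrt G (fun w => b w && b' w).
Proof. by move=> mb mb'; exact: measurable_and. Qed.

Lemma mbool_neg G b : mbool_wrt G b -> mbool_wrt G (fun w => ~~ b w).
Proof. by move=> mb; exact: measurable_neg. Qed.

Lemma mbool_sub G G' b : G `<=` G' -> mbool_wrt G b -> mbool_wrt G' b.
Proof.
move=> sub mf _ B mB; have := mf measurableT B mB; move: (_ `&` _).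
apply: smallest_sub; first exact: smallest_sigma_algebra.
by move=> A /sub GA; exact: sub_sigma_algebra.
Qed.

Lemma bm_bool G b : mbool_wrt G b -> bounded_mfun G (fun w => (b w)%:R).
Proof.
move=> mb; split; last first.
  by exists 1 => w; case: (b w); rewrite ?normr1 ?normr0.
rewrite /mfun_wrt (_ : (fun w => _) = fun w => if b w then 1 else 0).
  by apply: measurable_fun_ifT => //; exact: measurable_cst.
by apply/funext => w; case: (b w).
Qed.

Lemma mbool_set G b : sigma_algebra setT G -> mbool_wrt G b -> G [set w | b w].
Proof.
move=> sG mb; rewrite -(measurable_g_measurableTypeE sG).
by have := mb measurableT [set true] I; rewrite setTI.
Qed.

Lemma sigma_algebra_meas : sigma_algebra setT (@measurable _ T).
Proof.
by split=> // [A mA|A mA]; [exact: measurableD | exact: bigcupT_measurable].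
Qed.

End BoundedMeasurable.

(** * Expectation of bounded measurable functions *)

Section Expectation.
Context (d : measure_display) (T : measurableType d) (R : realType).
Variable P : probability T R.
Notation bmT := (bounded_mfun (@measurable _ T)).

Definition Expect (f : T -> R) : R := \int[P]_w f w.

Lemma bm_measurable (f : T -> R) : bmT f -> measurable_fun setT f.
Proof.
move=> [mf _] _ B mB; have := mf measurableT B mB.
by rewrite /= measurable_g_measurableTypeE //; exact: sigma_algebra_meas.
Qed.

Lemma bm_integrable f : bmT f -> P.-integrable setT (EFin \o f).
Proof.
move=> bf; apply: measurable_bounded_integrable => //.
- by rewrite (le_lt_trans (probability_le1 _ _)) ?ltry.
- exact: bm_measurable.
- have [_ [K fK]] := bf; exists K; split; first exact: num_real.
  by move=> x Kx w _ /=; rewrite (le_trans (fK w)) // ltW.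
Qed.

Lemma ExpectD f g : bmT f -> bmT g -> Expect (fun w => f w + g w) = Expect f + Expect g.
Proof. by move=> bf bg; apply: RintegralD => //; exact: bm_integrable. Qed.

Lemma ExpectZ r f : bmT f -> Expect (fun w => r * f w) = r * Expect f.
Proof. by move=> bf; apply: RintegralZl => //; exact: bm_integrable. Qed.

Lemma ExpectB f g : bmT f -> bmT g -> Expect (fun w => f w - g w) = Expect f - Expect g.
Proof. by move=> bf bg; apply: RintegralB => //; exact: bm_integrable. Qed.

Lemma Expect_cst r : Expect (fun=> r) = r.
Proof. rewrite /Expect Rintegral_cst //.
by have -> : fine (P setT) = 1; [rewrite probability_setT|rewrite mulr1]. Qed.

Lemma Expect_ge0 f : (forall w, 0 <= f w) -> 0 <= Expect f.
Proof. by move=> f0; apply: Rintegral_ge0. Qed.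

Lemma Expect_le f g : bmT f -> bmT g -> (forall w, f w <= g w) -> Expect f <= Expect g.
Proof. by move=> bf bg fg; apply: le_Rintegral => //; exact: bm_integrable. Qed.

Lemma Expect_sum (I : Type) (r : seq I) (f : I -> T -> R) :
  (forall i, bmT (f i)) ->
  Expect (fun w => \sum_(i <- r) f i w) = \sum_(i <- r) Expect (f i).
Proof.
move=> bf; elim: r => [|i r IH].
  by under [in LHS]eq_fun do rewrite big_nil; rewrite big_nil Expect_cst.
under [in LHS]eq_fun do rewrite big_cons.
by rewrite big_cons ExpectD ?IH //; exact: bm_sum.
Qed.

Lemma Expect_ae_eq f g : bmT f -> bmT g -> {ae P, forall w, f w = g w} ->
  Expect f = Expect g.
Proof.
move=> bf bg fg; congr fine; apply: ae_eq_integral => //.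
- exact/measurable_EFinP/bm_measurable.
- exact/measurable_EFinP/bm_measurable.
- by apply: filterS fg => w -> _.
Qed.

Lemma bm_min (f g : T -> R) : bmT f -> bmT g ->
  bmT (fun w => if f w <= g w then f w else g w).
Proof.
move=> bf bg; rewrite (_ : (fun w => _) =
  fun w => (f w <= g w)%R%:R * f w + (~~ (f w <= g w)%R)%:R * g w).
  have mb := mbool_le bf.1 bg.1.
  by apply: bmD; apply: bmM => //; apply: bm_bool => //; exact: mbool_neg.
by apply/funext => w; case: ifP => /=; rewrite ?(mul0r, mul1r, addr0, add0r).
Qed.

Lemma Expect_le_ae f g : bmT f -> bmT g -> {ae P, forall w, f w <= g w} ->
  Expect f <= Expect g.
Proof.
move=> bf bg fg; have bfg := bm_min bf bg.
rewrite (Expect_ae_eq bf bfg); last by apply: filterS fg => w ->.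
by apply: Expect_le => // w; case: ifP.
Qed.

Lemma Expect_bool (b : T -> bool) : mbool_wrt measurable b ->
  (Expect (fun w => (b w)%:R))%:E = P [set w | b w].
Proof.
move=> mb; have mB := mbool_set (@sigma_algebra_meas _ T) mb.
rewrite /Expect /Rintegral fineK; last first.
  by have := integrable_fin_num measurableT (bm_integrable (bm_bool R mb)).
under eq_integral => w _.
  rewrite (_ : (b w)%:R = \1_[set w | b w] w); last first.
    by rewrite indicE; case: (boolP (b w)) => bw; [rewrite mem_set|rewrite memNset //; exact/negP].
  over.
by rewrite integral_indic// setIT.
Qed.

Lemma Expect_bool0 (b : T -> bool) : mbool_wrt measurable b ->
  Expect (fun w => (b w)%:R) <= 0 -> {ae P, forall w, ~~ b w}.
Proof.
move=> mb b0; have P0 : P [set w | b w] = 0%E.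
  by apply/eqP; rewrite eq_le measure_ge0 andbT -Expect_bool // lee_fin.
have E : ~` [set x | ~~ b x] = [set w | b w].
  by apply/seteqP; split => w /=; [move/negP; rewrite negbK | move=> -> ].
apply/negligibleP; rewrite E //.
exact: mbool_set (@sigma_algebra_meas _ T) mb.
Qed.

End Expectation.

(** * Pulling out known factors *)

Section PullOut.
Context (d : measure_display) (T : measurableType d) (R : realType).
Variables (P : probability T R) (G : set (set T)).
Hypothesis Gm : G `<=` @measurable _ T.
Notation bmT := (bounded_mfun (@measurable _ T)).

Lemma count_le_approx (n : nat) (x : R) : 0 <= x <= n%:R ->
  0 <= x - \sum_(0 <= j < n) (j.+1%:R <= x)%R%:R <= 1.
Proof.
elim: n => [|n IH] /andP[x0 xn].
  by rewrite big_nil; apply/andP; split; lra.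
rewrite big_nat_recr //=; have [xn'|nx] := leP x n%:R.
  have [/andP[h1 h2]] : 0 <= x - \sum_(0 <= j < n) (j.+1%:R <= x)%R%:R <= 1 /\ True.
    by split=> //; apply: IH; rewrite x0.
  have -> : (n.+1%:R <= x)%R = false by apply/negbTE; rewrite -ltNge -natr1; lra.
  by move=> _; rewrite addr0 h1 h2.
have -> : \sum_(0 <= j < n) (j.+1%:R <= x)%R%:R = n%:R :> R.
  rewrite (eq_big_nat _ _ (F2 := fun=> 1)); last first.
    move=> j /andP[_ jn]; rewrite (_ : (_ <= _)%R = true) //.
    by rewrite (le_trans _ (ltW nx)) // ler_nat.
  by rewrite sumr_const_nat subn0.
move: xn; rewrite -natr1 => xn; case: (leP (n%:R + 1) x) => h /=; apply/andP; split; lra.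
Qed.

(** Discretisation: a function with values in [[0, 1]] is within [1 / n] of an
    average of [n] indicators of its upper level sets, for every [n]. *)
Lemma Expect_orth_unit (D U : T -> R) : bmT D ->
  (forall b, mbool_wrt G b -> Expect P (fun w => (b w)%:R * D w) = 0) ->
  bounded_mfun G U -> (forall w, 0 <= U w <= 1) -> Expect P (fun w => U w * D w) = 0.
Proof.
move=> bD orth bU U01; have [mD [K DK]] := bD.
have bUT : bmT U by exact: bm_sub Gm bU.
suff H n : `|Expect P (fun w => U w * D w)| <= n.+1%:R^-1 * K.
  apply/eqP; rewrite -normr_le0; apply/ler_addgt0Pl => e e0; rewrite addr0.
  have [n nK] : exists n, K / e < n.+1%:R.
    exists (Num.truncn (K / e)); exact: truncnS_gt.
  rewrite (le_trans (H n)) // ler_pdivrMl ?ltr0n // mulrC.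
  by rewrite -ler_pdivrMl // ltW // mulrC.
pose b j w : bool := (j.+1%:R <= n.+1%:R * U w)%R.
have mb j : mbool_wrt G (b j).
  by apply: mbool_le; [exact: (bm_cst G _).1|exact: (bmZ _ bU).1].
have bb j : bmT (fun w => (b j w)%:R) by apply: bm_sub Gm _; exact: bm_bool.
pose S w : R := \sum_(0 <= j < n.+1) (b j w)%:R.
have bS : bmT S by exact: bm_sum.
have S0 : Expect P (fun w => S w * D w) = 0.
  under [X in Expect P X]eq_fun do rewrite /S big_distrl /=.
  rewrite Expect_sum; last by move=> j; exact: bmM.
  by rewrite big1 // => j _; exact: orth.
have -> : Expect P (fun w => U w * D w) =
    n.+1%:R^-1 * Expect P (fun w => (n.+1%:R * U w - S w) * D w).
  have -> : (fun w => (n.+1%:R * U w - S w) * D w) =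
      (fun w => n.+1%:R * (U w * D w) - S w * D w).
    by apply/funext => w; ring.
  rewrite ExpectB; [|by apply: bmZ; exact: bmM|exact: bmM].
  rewrite S0 subr0 ExpectZ ?mulrA ?mulVf ?mul1r //.
  exact: bmM.
rewrite normrM ger0_norm ?invr_ge0 // ler_wpM2l ?invr_ge0 //.
have bE : bmT (fun w => (n.+1%:R * U w - S w) * D w).
  by apply: bmM => //; apply: bmB => //; exact: bmZ.
have HE w : `|(n.+1%:R * U w - S w) * D w| <= K.
  have /andP[h1 h2] : 0 <= n.+1%:R * U w - S w <= 1.
    apply: count_le_approx; have /andP[u0 u1] := U01 w.
    by rewrite mulr_ge0 //= ler_piMr.
  rewrite normrM (ger0_norm h1) (le_trans _ (DK w)) //.
  by rewrite ler_piMl.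
rewrite ler_norml -{1}(Expect_cst P (- K)) -{2}(Expect_cst P K).
by apply/andP; split; apply: Expect_le => //; try exact: bm_cst; move=> w;
  have := HE w; rewrite ler_norml => /andP[].
Qed.

(** Pulling out a known factor: [D] is the difference of a variable and its
    conditional expectation, and an affine change of [U] reduces to the
    previous lemma. *)
Lemma Expect_orth (D U : T -> R) : bmT D ->
  (forall b, mbool_wrt G b -> Expect P (fun w => (b w)%:R * D w) = 0) ->
  bounded_mfun G U -> Expect P (fun w => U w * D w) = 0.
Proof.
move=> bD orth bU; have [mU [K0 UK0]] := bU.
pose K := `|K0| + 1; have K_gt0 : 0 < K by rewrite ltr_wpDl.
have UK w : `|U w| <= K.
  by rewrite (le_trans (UK0 w)) // (le_trans (ler_norm _)) // lerDl.
pose U1 w := (2 * K)^-1 * (U w + K).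
have bU1 : bounded_mfun G U1 by apply: bmZ; apply: bmD => //; exact: bm_cst.
have U101 w : 0 <= U1 w <= 1.
  have := UK w; rewrite ler_norml => /andP[h1 h2].
  rewrite mulr_ge0 ?invr_ge0 //=; [|by lra..].
  by rewrite ler_pdivrMl ?mulr1; lra.
have E1 := Expect_orth_unit bD orth bU1 U101.
have E0 : Expect P D = 0.
  have := orth (fun=> true) (@measurable_cst _ _ (g_sigma_algebraType G) _ _ _).
  by under [X in Expect P X]eq_fun do rewrite mul1r.
have -> : (fun w => U w * D w) = (fun w => (2 * K) * (U1 w * D w) - K * D w).
  apply/funext => w; rewrite /U1; field; exact: lt0r_neq0.
have bUD : bmT (fun w => U1 w * D w) by apply: bmM => //; exact: bm_sub Gm _.
rewrite ExpectB; [|exact: bmZ|exact: bmZ].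
by rewrite !ExpectZ // E1 E0 !mulr0 subr0.
Qed.

End PullOut.

(** * Bounded versions of conditional expectations *)

Section BoundedCondExp.
Context (d : measure_display) (T : measurableType d) (R : realType).
Variables (P : probability T R) (G : set (set T)).
Hypotheses (sG : sigma_algebra [set: T] G) (Gm : G `<=` @measurable _ T).
Notation bmT := (bounded_mfun (@measurable _ T)).

(** Truncation turns variables that are bounded almost surely into variables
    that are bounded everywhere, with the same measurability. *)
Definition clip (K x : R) : R := Num.max (- K) (Num.min x K).

Lemma clip_bound K x : 0 <= K -> `|clip K x| <= K.
Proof.
move=> K0; rewrite /clip ler_norml le_max lexx /= ge_max ge_min lexx orbT andbT.
by rewrite (le_trans _ K0) // oppr_le0.
Qed.

Lemma clip_id K x : `|x| <= K -> clip K x = x.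
Proof.
rewrite ler_norml => /andP[h1 h2].
by rewrite /clip (min_idPl h2) (max_idPr h1).
Qed.

Lemma mfun_clip G' K (f : T -> R) : mfun_wrt G' f -> mfun_wrt G' (fun w => clip K (f w)).
Proof.
move=> mf; apply: measurable_maxr; first exact: measurable_cst.
by apply: measurable_minr => //; exact: measurable_cst.
Qed.

Lemma bm_clip G' K (f : T -> R) : 0 <= K -> mfun_wrt G' f ->
  bounded_mfun G' (fun w => clip K (f w)).
Proof.
by move=> K0 mf; split; [exact: mfun_clip | exists K => w; exact: clip_bound].
Qed.

(** Unlike [is_cond_exp], this refers to the standard Borel structure. *)
Definition cond_exp (X Z : T -> R) : Prop :=
  [/\ P.-integrable setT (EFin \o X), P.-integrable setT (EFin \o Z), mfun_wrt G Z
    & forall A, G A ->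
        (\int[P]_(w in A) (Z w)%:E = \int[P]_(w in A) (X w)%:E)%E].

Lemma is_cond_expW X Z : is_cond_exp P G X Z -> cond_exp X Z.
Proof. by move=> [iX iZ mZ E]; split=> //; exact: measurable_wrtE. Qed.

Lemma cond_exp_ae_eq X X' Z : bmT X' -> {ae P, forall w, X w = X' w} ->
  cond_exp X Z -> cond_exp X' Z.
Proof.
move=> bX' XX' [iX iZ mZ E]; split=> // [|A GA].
  exact: bm_integrable.
rewrite E //; apply: ae_eq_integral => //.
- exact: Gm.
- by apply: measurable_funTS; exact: measurable_int iX.
- by apply: measurable_funTS; apply/measurable_EFinP; exact: bm_measurable.
- by apply: filterS XX' => w -> _.
Qed.

Lemma cond_expN X Z : cond_exp X Z ->
  cond_exp (fun w => - X w) (fun w => - Z w).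
Proof.
move=> [iX iZ mZ E]; split=> //.
- exact: integrableN iX.
- exact: integrableN iZ.
- exact: measurable_funN.
- move=> A GA; have mA := Gm GA.
  have iXA : P.-integrable A (EFin \o X) by exact: integrableS iX.
  have iZA : P.-integrable A (EFin \o Z) by exact: integrableS iZ.
  under eq_integral do rewrite -mulN1r EFinM.
  under [RHS]eq_integral do rewrite -mulN1r EFinM.
  by rewrite !integralZl // E.
Qed.

Lemma integrableB_cst (K : R) (X : T -> R) A : measurable A ->
  P.-integrable setT (EFin \o X) ->
  P.-integrable A (EFin \o (fun w => X w - K)).
Proof.
move=> mA iX; apply: (@integrableS _ _ _ P setT) => //.
rewrite (_ : _ \o _ = (EFin \o X) \- (EFin \o (fun=> K)))%E //.
by apply: integrableB => //; exact/bm_integrable/bm_cst.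
Qed.

(** On the event where the version [Z] exceeds the bound, its integral would
    exceed that of [X]. *)
Lemma cond_exp_le_ae (K : R) X Z : cond_exp X Z -> (forall w, X w <= K) ->
  {ae P, forall w, Z w <= K}.
Proof.
move=> [iX iZ mZ E] XK.
pose b w : bool := (K < Z w)%R.
have mb : mbool_wrt G b by apply: mbool_lt => //; exact: (bm_cst G K).1.
pose A := [set w | b w]; have GA : G A by exact: mbool_set sG mb.
have mA : measurable A by exact: Gm.
have mZT : measurable_fun setT Z by apply/measurable_EFinP; exact: measurable_int iZ.
have iZK : P.-integrable A (EFin \o (fun w => Z w - K)).
  exact: integrableB_cst.
have le0 : (\int[P]_(w in A) (Z w - K)%:E <= 0)%E.
  under eq_integral do rewrite EFinB.
  rewrite integralB_EFin //; last 2 first.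
  - exact: (@integrableS _ _ _ P setT).
  - by apply: (@integrableS _ _ _ P setT) => //; exact/bm_integrable/bm_cst.
  rewrite E // -integralB_EFin //; last 2 first.
  - exact: (@integrableS _ _ _ P setT).
  - by apply: (@integrableS _ _ _ P setT) => //; exact/bm_integrable/bm_cst.
  apply: le_trans (_ : (\int[P]_(w in A) 0 <= 0)%E); last by rewrite integral0.
  apply: le_integral => //.
  - exact: integrableB_cst.
  - by apply: integrable0.
  - by move=> w _; rewrite /= lee_fin subr_le0.
have abs0 : (\int[P]_(w in A) abse (Z w - K)%:E = 0)%E.
  apply/eqP; rewrite eq_le integral_ge0 // andbT; apply: le_trans le0.
  rewrite le_eqVlt; apply/orP; left; apply/eqP; apply: eq_integral => w.
  by rewrite inE => Aw; rewrite gee0_abs // lee_fin subr_ge0 ltW.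
have := (ae_eq_integral_abs P mA (measurable_int _ iZK)).1 abs0.
apply: filterS => w Aw; rewrite leNgt; apply/negP => bw.
by have /eqP := Aw bw; rewrite /= eqe subr_eq0 gt_eqF.
Qed.

(** A version of the conditional expectation of a bounded variable is itself
    bounded almost surely, so it may be truncated; and the averaging property
    over sets extends to bounded weights. *)
Lemma cond_exp_bounded_version (K : R) X X' Z :
  cond_exp X Z -> bmT X' -> {ae P, forall w, X w = X' w} ->
  (forall w, `|X' w| <= K) ->
  {ae P, forall w, Z w = clip K (Z w)} /\
  forall U, bounded_mfun G U -> Expect P (fun w => U w * X' w) =
                      Expect P (fun w => U w * clip K (Z w)).
Proof.
move=> ce bX' XX' X'K.
have K0 : 0 <= K by rewrite (le_trans _ (X'K point)).
have ce' := cond_exp_ae_eq bX' XX' ce.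
have ZK : {ae P, forall w, Z w = clip K (Z w)}.
  have h1 : {ae P, forall w, Z w <= K}.
    apply: (cond_exp_le_ae ce') => w; exact: le_trans (ler_norm _) (X'K w).
  have h2 : {ae P, forall w, - Z w <= K}.
    apply: (cond_exp_le_ae (cond_expN ce')) => w.
    by rewrite (le_trans _ (X'K w)) // -normrN ler_norm.
  apply: filterS2 h1 h2 => w h1 h2; rewrite clip_id // ler_norml h1 andbT.
  by rewrite lerNl.
split=> // U bU.
have [_ iZ mZ E] := ce'.
have bZ : bounded_mfun G (fun w => clip K (Z w)) by exact: bm_clip.
have bZT := bm_sub Gm bZ; have bUT := bm_sub Gm bU.
have bD : bmT (fun w => X' w - clip K (Z w)) by exact: bmB.
suff /(_ U bU) : forall U, bounded_mfun G U -> Expect P (fun w => U w * (X' w - clip K (Z w))) = 0.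
  under [X in Expect P X]eq_fun do rewrite mulrBr.
  by rewrite ExpectB; [move/subr0_eq|exact: bmM|exact: bmM].
move=> {U bU bUT} U bU; apply: (Expect_orth Gm) => // b mb.
have bb : bmT (fun w => (b w)%:R : R) by apply: (bm_sub Gm); exact: bm_bool.
under [X in Expect P X]eq_fun do rewrite mulrBr.
rewrite ExpectB; [|exact: bmM|exact: bmM].
have GA := mbool_set sG mb; have mA := Gm GA.
have indE (f : T -> R) : Expect P (fun w => (b w)%:R * f w) =
    fine (\int[P]_(w in [set w | b w]) (f w)%:E).
  rewrite /Expect /Rintegral; congr fine; rewrite [RHS]integral_mkcond.
  apply: eq_integral => w _; rewrite restrict_EFin /= /patch.
  case: ifPn; first by rewrite inE /= => ->; rewrite mul1r.
  by rewrite notin_setE /= => /negP/negbTE ->; rewrite mul0r.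
rewrite !indE; apply/eqP; rewrite subr_eq0; apply/eqP; congr fine.
rewrite -E //; apply: ae_eq_integral => //.
- by apply: measurable_funTS; exact: measurable_int iZ.
- by apply: measurable_funTS; apply/measurable_EFinP; exact: bm_measurable.
- by apply: filterS ZK => w /= ZK _; congr EFin.
Qed.

End BoundedCondExp.

(** * Quadratic bounds on the exponential *)

Section ExpBounds.
Context (R : realType).
Implicit Types (x y k : R).

Lemma is_derive_expB (p dp : R -> R) x : is_derive x 1 p (dp x) ->
  is_derive x 1 (fun t => expR t - p t) (expR x - dp x).
Proof. by move=> dpx; apply: is_deriveB. Qed.

Lemma derive_ge0_incr (f df : R -> R) a b : a <= b ->
  (forall x, is_derive x 1 f (df x)) -> (forall x, a <= x <= b -> 0 <= df x) ->
  f a <= f b.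
Proof.
move=> ab fdf df0; have [c cI E] : exists2 c, c \in `[a, b]%R &
    f b - f a = df c * (b - a).
  apply: MVT_segment => // c; apply: derivable_within_continuous => x _.
  by case: (fdf x).
rewrite in_itv /= in cI; rewrite -subr_ge0 E mulr_ge0 ?df0 ?subr_ge0 //.
Qed.

(** The factor [y] records that the remainder has the sign of [y]: it vanishes
    at zero and its derivative [expR t - (1 + t)] is nonnegative. *)
Lemma expR_taylor2 y : 0 <= y * (expR y - (1 + y + y ^+ 2 / 2)).
Proof.
pose f t : R := expR t - (1 + t + t ^+ 2 / 2).
have df (t : R) : is_derive t 1 f (expR t - (1 + t)).
  apply: is_derive_expB; apply: is_derive_eq.
  by rewrite /GRing.scale /=; field.
have f0 : f 0 = 0 by rewrite /f expR0; field.
have [y0|/ltW y0] := leP 0 y.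
- rewrite mulr_ge0 // -/(f y) -f0; apply: derive_ge0_incr y0 df _ => t _.
  by rewrite subr_ge0 expR_ge1Dx.
- rewrite mulr_le0 // -/(f y) -f0; apply: derive_ge0_incr y0 df _ => t _.
  by rewrite subr_ge0 expR_ge1Dx.
Qed.

Lemma expR_taylor3 y : 1 + y + y ^+ 2 / 2 + y ^+ 3 / 6 <= expR y.
Proof.
pose f t : R := expR t - (1 + t + t ^+ 2 / 2 + t ^+ 3 / 6).
have df (t : R) : is_derive t 1 f (expR t - (1 + t + t ^+ 2 / 2)).
  apply: (@is_derive_expB _ (fun t => 1 + t + t ^+ 2 / 2)).
  apply: is_derive_eq.
  by rewrite /GRing.scale /=; field.
have f0 : f 0 = 0 by rewrite /f expR0; field.
rewrite -subr_ge0 -/(f y) -f0.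
have [y0|/ltW y0] := leP 0 y.
- apply: derive_ge0_incr y0 df _ => t /andP[t0 _].
  have := expR_taylor2 t; move: t0; rewrite le_eqVlt => /predU1P[<-|t0].
    by rewrite expR0 => _; lra.
  by rewrite pmulr_rge0.
- rewrite -lerN2.
  have dNf (t : R) : is_derive t 1 (- f) (- (expR t - (1 + t + t ^+ 2 / 2))).
    exact: is_deriveN.
  apply: (derive_ge0_incr y0 dNf).
  move=> t /andP[_ t0]; rewrite oppr_ge0.
  have := expR_taylor2 t; move: t0; rewrite le_eqVlt => /predU1P[->|t0].
    by rewrite expR0 => _; lra.
  by rewrite nmulr_rge0.
Qed.

(** The cubic term of the series is absorbed by the change of the quadratic
    coefficient from [1 / 2] to [(1 - k) / 2]. *)
Lemma expR_ge_quad k y : `|y| <= k -> 1 + y + (1 - k) / 2 * y ^+ 2 <= expR y.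
Proof.
rewrite ler_norml => /andP[h1 h2]; apply: le_trans (expR_taylor3 y).
have -> : y ^+ 3 = y * y ^+ 2 by rewrite exprS.
have : 0 <= y ^+ 2 by exact: sqr_ge0.
by move: (y ^+ 2) => z z0; nra.
Qed.

(** For positive [y] the upper bound is the inverse of a lower bound at [- y];
    the product of the two polynomials exceeds one by the factored form used
    in the proof. *)
Lemma expR_le_quad k y : `|y| <= k -> k <= 1 ->
  expR y <= 1 + y + (1 + k) / 2 * y ^+ 2.
Proof.
rewrite ler_norml => /andP[h1 h2] k1.
have [y0|y0] := leP 0 y; last first.
  have := expR_taylor2 y; rewrite nmulr_rge0 // subr_le0 => /le_trans; apply.
  have : 0 <= y ^+ 2 by exact: sqr_ge0.
  by move: (y ^+ 2) => z z0; nra.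
apply: (@le_trans _ _ (1 + y + (1 + y) / 2 * y ^+ 2)); last first.
  by rewrite lerD2l ler_wpM2r ?sqr_ge0 //; lra.
have := expR_taylor3 (- y); rewrite expRN => ey.
have e0 := expR_gt0 y.
have E : (1 - y + y ^+ 2 / 2 - y ^+ 3 / 6) * expR y <= 1.
  rewrite -ler_pdivlMr // div1r; apply: le_trans ey.
  by rewrite le_eqVlt; apply/orP; left; apply/eqP; field.
have p0 : 0 < 1 - y + y ^+ 2 / 2 - y ^+ 3 / 6.
  have : y <= 1 by exact: le_trans k1.
  rewrite le_eqVlt => /predU1P[->|y1]; first by rewrite !expr1n; lra.
  have : 0 <= y ^+ 2 by exact: sqr_ge0.
  by rewrite [y ^+ 3]exprS; move: (y ^+ 2) => z z0; nra.
rewrite mulrC -ler_pdivlMr // div1r in E; apply: le_trans E _.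
rewrite -div1r ler_pdivrMr //.
have : 0 <= y ^+ 3 * (1 - y) * (4 - y + y ^+ 2).
  by rewrite !mulr_ge0 ?exprn_ge0 //; nra.
rewrite -subr_ge0 => h; rewrite -subr_ge0.
have -> : (1 + y + (1 + y) / 2 * y ^+ 2) * (1 - y + y ^+ 2 / 2 - y ^+ 3 / 6) - 1
  = y ^+ 3 * (1 - y) * (4 - y + y ^+ 2) / 12 by field.
by rewrite divr_ge0 // -subr_ge0.
Qed.

(** A converse to [1 + u <= expR u]: the gap is of second order in [t], and
    [t <= k ^+ 2] makes it smaller than the gain [k / 2 * t] in the
    coefficient. *)
Lemma expR_lin_ge k t : 0 <= k <= 1 / 2 -> 0 <= t <= k ^+ 2 ->
  expR ((1 - 2 * k) / 2 * t) <= 1 + (1 - k) / 2 * t.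
Proof.
move=> /andP[k0 k2] /andP[t0 tk].
have tk1 : t <= k / 2 by apply: le_trans tk _; rewrite expr2; nra.
set u := _ * t; have u1 : 0 < 1 - u.
  rewrite /u; nra.
have := expR_ge1Dx (- u); rewrite expRN => h.
have e0 := expR_gt0 u.
have E : expR u <= (1 - u)^-1.
  by rewrite -[expR u]invrK lef_pV2 ?posrE ?invr_gt0.
apply: le_trans E _; rewrite -div1r ler_pdivrMr // /u.
have : 0 <= t * (k / 2 - (1 - k) * (1 - 2 * k) / 4 * t).
  rewrite mulr_ge0 //; nra.
nra.
Qed.

End ExpBounds.

(** * One step of the exponential martingale *)

Ltac bm_tac := repeat (first [ assumption | apply: bm_cst | apply: bm_expR
  | apply: bmX2 | apply: bmM | apply: bmB | apply: bmD | apply: bmN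
  | apply: bm_bool ]).

Section OneStep.
Context (d : measure_display) (T : measurableType d) (R : realType).
Variables (P : probability T R) (G : set (set T)).
Hypothesis Gm : G `<=` @measurable _ T.
Notation bmT := (bounded_mfun (@measurable _ T)).

Lemma Expect_le0_ae (f : T -> R) : bmT f -> (forall w, 0 <= f w) -> Expect P f <= 0 ->
  {ae P, forall w, f w = 0}.
Proof.
move=> bf f0 Ef; have H n : {ae P, forall w, ~~ (n.+1%:R^-1 <= f w)%R}.
  have mb : mbool_wrt measurable (fun w => n.+1%:R^-1 <= f w)%R.
    by apply: mbool_le; [exact: (bm_cst _ _).1 | exact: bf.1].
  apply: Expect_bool0 => //.
  apply: (@le_trans _ _ (Expect P (fun w => n.+1%:R * f w))); last first.
    by rewrite ExpectZ // pmulr_rle0.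
  apply: Expect_le => //; [exact: bm_bool | exact: bmZ |].
  move=> w; case: (leP n.+1%:R^-1 (f w)) => h /=; last by rewrite mulr_ge0.
  by rewrite -ler_pdivrMl // mulr1.
have := ae_foralln H; apply: filterS => w Hw.
apply/eqP; rewrite eq_le f0 andbT leNgt; apply/negP => fw.
have [n nf] : exists n, (f w)^-1 < n.+1%:R.
  by exists (Num.truncn (f w)^-1); exact: truncnS_gt.
have /negP := Hw n; apply.
by rewrite -[f w]invrK lef_pV2 ?posrE ?invr_gt0 // ltW.
Qed.

Variables (y s : T -> R).
Hypotheses (ybm : bmT y) (bs : bounded_mfun G s)
  (mean0 : forall U, bounded_mfun G U -> Expect P (fun w => U w * y w) = 0)
  (var : forall U, bounded_mfun G U ->
    Expect P (fun w => U w * y w ^+ 2) = Expect P (fun w => U w * s w)).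

Let bsT : bmT s := bm_sub Gm bs.

(** Both bounds on the conditional variance come from testing the variance
    identity on the event where the bound fails. *)
Lemma cond_var_ge0 : {ae P, forall w, 0 <= s w}.
Proof.
have mb : mbool_wrt G (fun w => s w < 0)%R.
  by apply: mbool_lt; [exact: bs.1|exact: (bm_cst _ _).1].
have bb := bm_bool R mb; have bbT := bm_sub Gm bb.
have E : Expect P (fun w => (s w < 0)%R%:R * - s w) <= 0.
  have -> : (fun w => (s w < 0)%R%:R * - s w) =
            (fun w => -1 * ((s w < 0)%R%:R * s w)).
    by apply/funext => w; ring.
  rewrite ExpectZ; last by bm_tac.
  rewrite -var // mulN1r oppr_le0.
  by apply: Expect_ge0 => w; rewrite mulr_ge0 ?ler0n ?sqr_ge0.
have := Expect_le0_ae _ _ E; have bT : bmT (fun w => (s w < 0)%R%:R * - s w) by bm_tac.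
move=> /(_ bT) H; apply: filterS (H _) => [w|w].
  by have [//|s0] := leP 0 (s w); rewrite mul1r => /eqP; rewrite oppr_eq0 lt_eqF.
by case: (ltP (s w) 0) => h /=; rewrite ?mul0r // mul1r oppr_ge0 ltW.
Qed.

Lemma cond_var_le (xi : T -> R) (k : R) : bounded_mfun G xi -> (forall w, `|xi w * y w| <= k) ->
  {ae P, forall w, xi w ^+ 2 * s w <= k ^+ 2}.
Proof.
move=> bxi xyk; have bxiT := bm_sub Gm bxi.
have bq : bounded_mfun G (fun w => xi w ^+ 2 * s w) by bm_tac.
have mb : mbool_wrt G (fun w => k ^+ 2 < xi w ^+ 2 * s w)%R.
  by apply: mbool_lt; [exact: (bm_cst _ _).1|exact: bq.1].
have bb := bm_bool R mb; have bbT := bm_sub Gm bb.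
pose f w : R := (k ^+ 2 < xi w ^+ 2 * s w)%R%:R * (xi w ^+ 2 * s w - k ^+ 2).
have bf : bmT f by rewrite /f; bm_tac.
have E : Expect P f <= 0.
  have -> : f = (fun w => ((k ^+ 2 < xi w ^+ 2 * s w)%R%:R * xi w ^+ 2) * s w -
      (k ^+ 2 < xi w ^+ 2 * s w)%R%:R * k ^+ 2).
    by apply/funext => w; rewrite /f; ring.
  rewrite ExpectB; [|by bm_tac..]; rewrite -var; last by bm_tac.
  rewrite -ExpectB; [|by bm_tac..]; rewrite -(Expect_cst P 0).
  apply: Expect_le => //; [by bm_tac..|] => w.
  rewrite -mulrA -mulrBr -exprMn mulr_ge0_le0 ?ler0n // subr_le0.
  rewrite -(real_normK (num_real (xi w * y w))).
  by rewrite lerXn2r ?nnegrE // (le_trans _ (xyk w)).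
have f0 w : 0 <= f w.
  rewrite /f; case: (ltP (k ^+ 2)) => h /=; rewrite ?mul0r // mul1r subr_ge0 ltW //.
apply: filterS (Expect_le0_ae bf f0 E) => w; rewrite /f.
by case: (ltP (k ^+ 2)) => // h /=; rewrite mul1r => /eqP; rewrite subr_eq0 gt_eqF.
Qed.

(** The coefficient [xi] is known before the step: a tilt, or zero once the
    process is stopped. *)
Variables (xi U : T -> R) (k : R).
Hypotheses (bxi : bounded_mfun G xi) (bU : bounded_mfun G U) (U0 : forall w, 0 <= U w)
  (xyk : forall w, `|xi w * y w| <= k).

Let bxiT : bmT xi := bm_sub Gm bxi.
Let bUT : bmT U := bm_sub Gm bU.

Lemma Expect_quadratic (a : R) (U' : T -> R) : bounded_mfun G U' ->
  Expect P (fun w => U' w * (1 + xi w * y w + a * (xi w * y w) ^+ 2)) =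
  Expect P (fun w => U' w * (1 + a * (xi w ^+ 2 * s w))).
Proof.
move=> bU'; have bU'T := bm_sub Gm bU'.
have -> : (fun w => U' w * (1 + xi w * y w + a * (xi w * y w) ^+ 2)) =
    (fun w => U' w + ((U' w * xi w) * y w + (U' w * (a * xi w ^+ 2)) * y w ^+ 2)).
  by apply/funext => w; ring.
have -> : (fun w => U' w * (1 + a * (xi w ^+ 2 * s w))) =
    (fun w => U' w + (U' w * (a * xi w ^+ 2)) * s w).
  by apply/funext => w; ring.
rewrite !ExpectD; [|by bm_tac..].
by rewrite mean0 ?add0r ?var //; bm_tac.
Qed.

(** Quadratic upper bound for the exponential, then [1 + z <= expR z]. *)
Lemma exp_step_le : k <= 1 ->
  Expect P (fun w => U w * expR (xi w * y w - (1 + k) / 2 * (xi w ^+ 2 * s w)))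
  <= Expect P U.
Proof.
move=> k1; pose U' w := U w * expR (- ((1 + k) / 2 * (xi w ^+ 2 * s w))).
have bU' : bounded_mfun G U' by rewrite /U'; bm_tac.
have bU'T := bm_sub Gm bU'.
have U'0 w : 0 <= U' w by rewrite mulr_ge0 ?expR_ge0.
apply: (@le_trans _ _
  (Expect P (fun w => U' w * (1 + xi w * y w + (1 + k) / 2 * (xi w * y w) ^+ 2)))).
  apply: Expect_le; [by bm_tac..|] => w.
  rewrite expRD mulrCA [leLHS]mulrC ler_wpM2l ?U'0 //.
  exact: expR_le_quad.
rewrite Expect_quadratic //; apply: Expect_le; [by bm_tac..|] => w.
rewrite -[leRHS]mulr1 -[X in _ <= _ * X](expRxMexpNx_1 ((1 + k) / 2 * (xi w ^+ 2 * s w))).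
rewrite /U' [X in _ <= _ * X]mulrC [leRHS]mulrA ler_wpM2l ?expR_ge1Dx //.
exact: U'0.
Qed.

(** Quadratic lower bound for the exponential. Now [1 + z] has to dominate an
    exponential, which costs a second [k] in the coefficient and uses the
    almost sure bound on the conditional variance. *)
Lemma exp_step_ge : k <= 1 / 2 ->
  Expect P U <=
  Expect P (fun w => U w * expR (xi w * y w - (1 - 2 * k) / 2 * (xi w ^+ 2 * s w))).
Proof.
move=> k1; have k0 : 0 <= k by rewrite (le_trans _ (xyk point)).
pose U' w := U w * expR (- ((1 - 2 * k) / 2 * (xi w ^+ 2 * s w))).
have bU' : bounded_mfun G U' by rewrite /U'; bm_tac.
have bU'T := bm_sub Gm bU'.
have U'0 w : 0 <= U' w by rewrite mulr_ge0 ?expR_ge0.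
apply: (@le_trans _ _
  (Expect P (fun w => U' w * (1 + xi w * y w + (1 - k) / 2 * (xi w * y w) ^+ 2))));
    last first.
  apply: Expect_le; [by bm_tac..|] => w.
  rewrite expRD [leRHS]mulrCA [leRHS]mulrC ler_wpM2l ?U'0 //.
  exact: expR_ge_quad.
rewrite Expect_quadratic //; apply: Expect_le_ae; [by bm_tac..|].
apply: filterS2 cond_var_ge0 (cond_var_le bxi xyk) => w s0 sk.
rewrite -[leLHS]mulr1 -[X in _ * X <= _](expRxMexpNx_1 ((1 - 2 * k) / 2 * (xi w ^+ 2 * s w))).
rewrite /U' [X in _ * X <= _]mulrC [leLHS]mulrA ler_wpM2l //; first exact: U'0.
by apply: expR_lin_ge; rewrite ?k0 // sk mulr_ge0 // sqr_ge0.
Qed.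

End OneStep.

(** * Tail sums of a reverse martingale *)

Section Chain.
Context (d : measure_display) (T : measurableType d) (R : realType).
Variables (P : probability T R) (F : nat -> set (set T)).
Hypothesis hF : decreasing_filtration F.
Notation bmT := (bounded_mfun (@measurable _ T)).

Lemma filtration_sigma n : sigma_algebra [set: T] (F n).
Proof. by case: hF. Qed.

Lemma filtration_meas n : F n `<=` @measurable _ T.
Proof. by case: hF. Qed.

Lemma filtration_le m n : (m <= n)%N -> F n `<=` F m.
Proof.
have [_ _ dec] := hF; move=> /subnK <-; elim: (n - m)%N => // k IH.
by rewrite addSn; apply: subset_trans IH; exact: dec.
Qed.

Lemma bm_filt m n (f : T -> R) : (m <= n)%N -> bounded_mfun (F n) f -> bounded_mfun (F m) f.
Proof. by move=> mn; apply: bm_sub; exact: filtration_le. Qed.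

Lemma bm_filtT n (f : T -> R) : bounded_mfun (F n) f -> bmT f.
Proof. by apply: bm_sub; exact: filtration_meas. Qed.

(** Scalar reverse martingale differences [y] with conditional variances [s].
    The conditional mean and variance are expressed by testing against bounded
    weights, which is the form in which they are used. *)
Definition scalar_rmd (y s : nat -> T -> R) : Prop := forall n,
  [/\ bounded_mfun (F n) (y n), bounded_mfun (F n.+1) (s n),
      forall U, bounded_mfun (F n.+1) U -> Expect P (fun w => U w * y n w) = 0
    & forall U, bounded_mfun (F n.+1) U ->
        Expect P (fun w => U w * y n w ^+ 2) = Expect P (fun w => U w * s n w)].

Section Scalar.
Variables (y s : nat -> T -> R).
Hypothesis ys : scalar_rmd y s.
Variables (xi : nat -> T -> R) (N : nat) (k : R).
Hypothesis bxi : forall n, (n < N)%N -> bounded_mfun (F n.+1) (xi n).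
Hypothesis xyk : forall n w, (n < N)%N -> `|xi n w * y n w| <= k.

Definition tilt_term (a : R) n w : R := xi n w * y n w - a * (xi n w ^+ 2 * s n w).

Lemma bm_tilt_term a n : (n < N)%N -> bounded_mfun (F n) (tilt_term a n).
Proof.
move=> nN; have [ybm bs _ _] := ys n.
have bs' := bm_filt (leqnSn n) bs; have bxi' := bm_filt (leqnSn n) (bxi nN).
by rewrite /tilt_term; bm_tac.
Qed.

Lemma bm_sum_nat m (f : nat -> T -> R) G m' :
  (forall n, (m <= n < m')%N -> bounded_mfun G (f n)) ->
  bounded_mfun G (fun w => \sum_(m <= n < m') f n w).
Proof.
move=> bf; have : forall n, n \in index_iota m m' -> bounded_mfun G (f n).
  by move=> n; rewrite mem_index_iota; exact: bf.
elim: (index_iota m m') => [|n r IH] H.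
  by under eq_fun do rewrite big_nil; exact: bm_cst.
under eq_fun do rewrite big_cons; apply: bmD; first by apply: H; rewrite mem_head.
by apply: IH => i ir; apply: H; rewrite inE ir orbT.
Qed.

Lemma bm_sum_tilt_term a m : bounded_mfun (F m) (fun w => \sum_(m <= n < N) tilt_term a n w).
Proof.
apply: bm_sum_nat => n /andP[mn nN]; apply: (bm_filt mn); exact: bm_tilt_term.
Qed.

Variables (U : T -> R).
Hypotheses (bU : bounded_mfun (F N) U) (U0 : forall w, 0 <= U w).

(** Downward induction: the tail above [n] is measurable for [F n.+1], so it
    can be merged into the weight of the step [n]. *)
Lemma chain_le m : (m <= N)%N -> k <= 1 ->
  Expect P (fun w => U w * expR (\sum_(m <= n < N) tilt_term ((1 + k) / 2) n w)) <= Expect P U.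
Proof.
move=> mN k1; rewrite -(subKn mN); have := leq_subr m N; move: (N - m)%N => j.
elim: j => [_|j IH jN].
  rewrite subn0; under [X in Expect P X]eq_fun do rewrite big_geq // expR0 mulr1.
  exact: lexx.
apply: le_trans (IH (ltnW jN)); set n := (N - j.+1)%N.
have nN : (n < N)%N by rewrite /n; lia.
have -> : (N - j = n.+1)%N by rewrite /n; lia.
have [ybm bs m0 var] := ys n.
pose U' w := U w * expR (\sum_(n.+1 <= i < N) tilt_term ((1 + k) / 2) i w).
have bU' : bounded_mfun (F n.+1) U'.
  by apply: bmM; [exact: bm_filt bU | apply: bm_expR; exact: bm_sum_tilt_term].
have U'0 w : 0 <= U' w by rewrite mulr_ge0 // expR_ge0.
have := exp_step_le (@filtration_meas n.+1) (bm_filtT ybm) bs m0 var (bxi nN)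
  bU' U'0 (fun w => xyk w nN) k1.
apply: le_trans; rewrite le_eqVlt; apply/orP; left; apply/eqP; congr (Expect P _).
by apply/funext => w; rewrite big_ltn // expRD mulrCA mulrC.
Qed.

Lemma chain_ge m : (m <= N)%N -> k <= 1 / 2 ->
  Expect P U <= Expect P (fun w => U w * expR (\sum_(m <= n < N) tilt_term ((1 - 2 * k) / 2) n w)).
Proof.
move=> mN k1; rewrite -(subKn mN); have := leq_subr m N; move: (N - m)%N => j.
elim: j => [_|j IH jN].
  rewrite subn0; under [X in _ <= Expect P X]eq_fun do rewrite big_geq // expR0 mulr1.
  exact: lexx.
apply: le_trans (IH (ltnW jN)) _; set n := (N - j.+1)%N.
have nN : (n < N)%N by rewrite /n; lia.
have -> : (N - j = n.+1)%N by rewrite /n; lia.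
have [ybm bs m0 var] := ys n.
pose U' w := U w * expR (\sum_(n.+1 <= i < N) tilt_term ((1 - 2 * k) / 2) i w).
have bU' : bounded_mfun (F n.+1) U'.
  by apply: bmM; [exact: bm_filt bU | apply: bm_expR; exact: bm_sum_tilt_term].
have U'0 w : 0 <= U' w by rewrite mulr_ge0 // expR_ge0.
have := exp_step_ge (@filtration_meas n.+1) (bm_filtT ybm) bs m0 var (bxi nN)
  bU' U'0 (fun w => xyk w nN) k1.
move=> /le_trans; apply; rewrite le_eqVlt; apply/orP; left; apply/eqP; congr (Expect P _).
by apply/funext => w; rewrite [in RHS]big_ltn // expRD [in RHS]mulrCA [in RHS]mulrC.
Qed.

End Scalar.

(** Stopping rules for sums read downwards from [N]. *)
Section Stop.
Variables (N : nat) (u : R) (x : nat -> T -> R).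
Definition tail_sum m w : R := \sum_(m <= n < N) x n w.
Definition tails_below m w : bool := all (fun j => tail_sum j w <= u) (index_iota m N.+1).

Lemma tails_belowS m w : (m <= N)%N -> tails_below m w = (tail_sum m w <= u) && tails_below m.+1 w.
Proof. by move=> mN; rewrite /tails_below /index_iota subSn //= subSS. Qed.

Lemma mbool_tails_below G m : (forall n, (m <= n < N)%N -> bounded_mfun G (x n)) ->
  mbool_wrt G (tails_below m).
Proof.
move=> bx; rewrite /tails_below.
have : forall j, j \in index_iota m N.+1 -> mbool_wrt G (fun w => tail_sum j w <= u).
  move=> j; rewrite mem_index_iota => /andP[mj jN]; apply: mbool_le.
    apply: (proj1 (_ : bounded_mfun G _)); apply: bm_sum_nat => n /andP[jn nN]; apply: bx.
    by rewrite (leq_trans mj).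
  exact: (bm_cst G _).1.
elim: (index_iota m N.+1) => [|j r IH] H /=.
  exact: (@measurable_cst _ _ (g_sigma_algebraType G)).
apply: mbool_and; first by apply: H; rewrite mem_head.
by apply: IH => i ir; apply: H; rewrite inE ir orbT.
Qed.

(** Including the term at which the level is first crossed freezes the sum
    above the level. *)
Lemma stopped_after m w : (m <= N)%N -> 0 <= u ->
  let A := \sum_(m <= n < N) (tails_below n.+1 w)%:R * x n w in
  if tails_below m w then A = tail_sum m w else u < A.
Proof.
move=> mN u0; rewrite -(subKn mN); have := leq_subr m N; move: (N - m)%N => j.
elim: j => [_|j IH jN].
  by rewrite subn0 /= tails_belowS // /tail_sum !big_geq // u0 /tails_below /index_iota subnn.
set n := (N - j.+1)%N.
have nN : (n < N)%N by rewrite /n; lia.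
move: (IH (ltnW jN)); have -> : (N - j = n.+1)%N by rewrite /n; lia.
rewrite /= (@tails_belowS n w (ltnW nN)) /tail_sum !(@big_ltn _ _ _ n N) //.
case: (tails_below n.+1 w) => [->|]; last by rewrite andbF mul0r add0r.
by rewrite mul1r andbT; case: leP.
Qed.

(** When [x n] is known before the step [n], as conditional variances are, the
    crossing term can be left out as well. *)
Lemma stopped_before m w : (m <= N)%N -> 0 <= u ->
  let A := \sum_(m <= n < N) (tails_below n w)%:R * x n w in
  A <= u /\ (tails_below m w -> A = tail_sum m w).
Proof.
move=> mN u0; rewrite -(subKn mN); have := leq_subr m N; move: (N - m)%N => j.
elim: j => [_|j IH jN].
  by rewrite subn0 /= /tail_sum !big_geq.
set n := (N - j.+1)%N.
have nN : (n < N)%N by rewrite /n; lia.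
move: (IH (ltnW jN)); have -> : (N - j = n.+1)%N by rewrite /n; lia.
rewrite /= /tail_sum !(@big_ltn _ _ _ n N) //.
rewrite (@tails_belowS n w (ltnW nN)) /tail_sum !(@big_ltn _ _ _ n N) //.
case: (boolP (tails_below n.+1 w)) => _ [h1 h2]; last by rewrite andbF /= mul0r add0r.
rewrite andbT h2 //; case: (leP (x n w + _) u) => h /=; first by rewrite mul1r.
by rewrite mul0r add0r -h2.
Qed.

End Stop.

(** Stop the exponent as soon as it exceeds [u]: the stopped exponent at index
    [0] exceeds [u] whenever some tail does, and Markov's inequality applies
    to it. *)
Lemma tail_maximal (y s : nat -> T -> R) N (k l u : R) :
  scalar_rmd y s -> (forall n w, (n < N)%N -> `|l * y n w| <= k) -> k <= 1 -> 0 <= u ->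
  Expect P (fun w => (~~ tails_below N u
      (fun n w => l * y n w - (1 + k) / 2 * (l ^+ 2 * s n w)) 0 w)%:R)
  <= expR (- u).
Proof.
move=> ys lyk k1 u0; set x := (fun (n : nat) w => _ - _).
have bx n m : (m <= n)%N -> bounded_mfun (F m) (x n).
  move=> mn; apply: (bm_filt mn); have [ybm bs _ _] := ys n.
  by have bs' := bm_filt (leqnSn n) bs; rewrite /x; bm_tac.
have mb m : mbool_wrt (F m) (tails_below N u x m).
  by apply: mbool_tails_below => n /andP[mn nN]; exact: bx.
pose xi n w : R := (tails_below N u x n.+1 w)%:R * l.
have bxi n : (n < N)%N -> bounded_mfun (F n.+1) (xi n).
  by move=> nN; rewrite /xi; bm_tac.
have xyk n w : (n < N)%N -> `|xi n w * y n w| <= k.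
  move=> nN; have := lyk n w nN; rewrite /xi; case: tails_below; rewrite ?mul1r //.
  by rewrite !mul0r normr0; apply: le_trans; exact: normr_ge0.
have := chain_le ys bxi xyk (bm_cst _ 1) (fun=> ler01) (leq0n N) k1.
rewrite Expect_cst => H.
have E w : \sum_(0 <= n < N) tilt_term y s xi ((1 + k) / 2) n w =
    \sum_(0 <= n < N) (tails_below N u x n.+1 w)%:R * x n w.
  apply: eq_bigr => n _; rewrite /tilt_term /xi /x.
  by case: tails_below => /=; rewrite ?mul0r ?mul1r ?expr0n /= ?mul0r ?mulr0 ?subrr.
have bsum : bmT (fun w => \sum_(0 <= n < N) tilt_term y s xi ((1 + k) / 2) n w).
  apply: (@bm_filtT 0); apply: (@bm_sum_tilt_term y s ys xi N); exact: bxi.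
apply: (@le_trans _ _ (Expect P (fun w => expR (- u) *
    (1 * expR (\sum_(0 <= n < N) tilt_term y s xi ((1 + k) / 2) n w))))).
  apply: Expect_le; [|by bm_tac|].
    by apply: bm_bool; apply: mbool_neg; exact: mbool_sub (@filtration_meas 0) _.
  move=> w; rewrite mul1r -expRD E.
  have := stopped_after x w (leq0n N) u0; case: tails_below => /=.
    by move=> _; exact: expR_ge0.
  move=> uA; rewrite -[leLHS]expR0 ler_expR; lra.
by rewrite ExpectZ; [rewrite ler_piMr // expR_ge0|bm_tac].
Qed.

End Chain.

(** * The normalising sequence and its geometric grids *)

Section IteratedLog.
Context (R : realType).
Implicit Types x y : R.

Lemma maxe_gt0 x : 0 < Num.max (expR 1) x.
Proof. by rewrite lt_max expR_gt0. Qed.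

Lemma L_ge1 x : 1 <= L x.
Proof.
rewrite /L -{1}(expRK (1 : R)) ler_ln ?posrE ?expR_gt0 ?maxe_gt0 //.
by rewrite le_max lexx.
Qed.

Lemma L_mono x y : x <= y -> L x <= L y.
Proof.
move=> xy; rewrite /L ler_ln ?posrE ?maxe_gt0 // ge_max !le_max lexx /=.
by rewrite xy orbT.
Qed.

Lemma ln_le_L x : 0 < x -> ln x <= L x.
Proof. by move=> x0; rewrite /L ler_ln ?posrE ?maxe_gt0 // le_max lexx orbT. Qed.

Lemma L_mul x y : 1 <= y -> L (y * x) <= ln y + L x.
Proof.
move=> y1; have y0 : 0 < y by rewrite (lt_le_trans _ y1).
rewrite /L -lnM ?posrE ?maxe_gt0 // ler_ln ?posrE ?mulr_gt0 ?maxe_gt0 //.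
rewrite ge_max; apply/andP; split; last first.
  by rewrite ler_wpM2l ?(ltW y0) // le_max lexx orbT.
rewrite (@le_trans _ _ (Num.max (expR 1) x)) //; first by rewrite le_max lexx.
by rewrite ler_peMl // ltW // maxe_gt0.
Qed.

(** Slow variation, used to compare the scales at both ends of a block. *)
Lemma LL_double x y : 1 <= y -> y <= expR 1 -> L (L (y * x)) <= 2 * L (L x).
Proof.
move=> y1 ye; have y0 : 0 < y by rewrite (lt_le_trans _ y1).
have ly : ln y <= 1.
  by rewrite -(expRK (1 : R)) ler_ln ?posrE ?expR_gt0.
have h : L (y * x) <= 2 * L x.
  by rewrite (le_trans (L_mul x y1)) //; have := L_ge1 x; lra.
rewrite (le_trans (L_mono h)) // (le_trans (L_mul _ _)) ?ler1n //.
have : ln (2 : R) <= 1.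
  rewrite -[leRHS]expRK ler_ln ?posrE ?expR_gt0 //.
  by have := expR_ge1Dx (1 : R); lra.
by have := L_ge1 (L x); lra.
Qed.

End IteratedLog.

Section Grid.
Context (R : realType).
Variable v : nat -> R.
Hypotheses (hv0 : forall N, (1 <= N)%N -> 0 < v N)
    (hvmono : forall M N, (1 <= M)%N -> (M <= N)%N -> v M <= v N)
    (hvoo : v N @[N --> \oo] --> +oo).

Definition sqrtLL N : R := Num.sqrt (L (L (v N ^+ 2))).

Lemma sqrtLL2 N : sqrtLL N ^+ 2 = L (L (v N ^+ 2)).
Proof. by rewrite sqr_sqrtr // (le_trans _ (L_ge1 _)). Qed.

Lemma sqrtLL_ge1 N : 1 <= sqrtLL N.
Proof. by rewrite -{1}(sqrtr1 R) ler_wsqrtr // L_ge1. Qed.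

Lemma sqrtLL_gt0 N : 0 < sqrtLL N.
Proof. exact: lt_le_trans (sqrtLL_ge1 N). Qed.

Lemma sqrtLL_mono M N : (1 <= M)%N -> (M <= N)%N -> sqrtLL M <= sqrtLL N.
Proof.
move=> M1 MN; rewrite ler_wsqrtr //; do 2 apply: L_mono.
by rewrite lerXn2r ?nnegrE ?hvmono ?ltW ?hv0 // (leq_trans M1).
Qed.

Lemma v_large (x : R) : exists N0, forall N, (N0 <= N)%N -> x < v N.
Proof.
have /cvgryPgt/(_ x)[N0 _ H] := hvoo.
by exists N0 => N; exact: H.
Qed.

Section WithRatio.
Variable rho : R.
Hypothesis rho1 : 1 < rho.

Lemma grid_ex k : exists N, (0 < N)%N && (rho ^+ k <= v N).
Proof.
have [N0 H] := v_large (rho ^+ k); exists (maxn 1 N0).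
by rewrite leq_max /= ltW // H // leq_maxr.
Qed.

Definition grid k : nat := ex_minn (grid_ex k).

Lemma grid_gt0 k : (0 < grid k)%N.
Proof. by rewrite /grid; case: ex_minnP => m /andP[]. Qed.

Lemma grid_ge k : rho ^+ k <= v (grid k).
Proof. by rewrite /grid; case: ex_minnP => m /andP[]. Qed.

Lemma grid_lt k N : (0 < N)%N -> (N < grid k)%N -> v N < rho ^+ k.
Proof.
rewrite /grid; case: ex_minnP => m _ H N0 Nm; rewrite ltNge; apply/negP => h.
by have := H N; rewrite N0 h /= => /(_ isT); rewrite leqNgt Nm.
Qed.

Lemma grid_le_of k N : (0 < N)%N -> rho ^+ k <= v N -> (grid k <= N)%N.
Proof. by move=> N0 h; rewrite leqNgt; apply/negP => /(grid_lt N0); rewrite ltNge h. Qed.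

Lemma grid_mono j k : (j <= k)%N -> (grid j <= grid k)%N.
Proof.
move=> jk; apply: grid_le_of; first exact: grid_gt0.
by rewrite (le_trans _ (grid_ge k)) // ler_weXn2l // ltW.
Qed.

Lemma expr_large (x : R) : exists k0, forall k, (k0 <= k)%N -> x < rho ^+ k.
Proof.
have rho0 : 0 < rho by rewrite (lt_trans _ rho1).
have l0 : 0 < ln rho by rewrite ln_gt0.
exists (Num.truncn (x / ln rho)).+1 => k kx.
rewrite -(lnK rho0) -expRM_natl.
apply: lt_le_trans (expR_ge1Dx _).
have : x / ln rho < k%:R by rewrite (lt_le_trans (truncnS_gt _)) // ler_nat.
by rewrite ltr_pdivrMr // mulr_natl => h; rewrite (lt_le_trans h) // lerDr.
Qed.

Lemma ge_grid_large (t : nat -> nat) N0 : (forall k, (0 < t k)%N) ->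
  (forall k, rho ^+ k <= v (t k)) ->
  exists k0, forall k, (k0 <= k)%N -> (N0 <= t k)%N.
Proof.
move=> t0 tv; have [k0 H] := expr_large (v N0); exists k0 => k /H vk.
rewrite leqNgt; apply/negP => tN.
have := hvmono (t0 k) (ltnW tN); rewrite leNgt => /negP; apply.
exact: lt_le_trans vk (tv k).
Qed.

Lemma grid_cover k0 N : (grid k0 <= N)%N ->
  exists k, [/\ (k0 <= k)%N, (grid k <= N)%N & (N < grid k.+1)%N].
Proof.
move=> kN; have N0 : (0 < N)%N by rewrite (leq_trans (grid_gt0 k0)).
have ex : exists j, (N < grid j)%N.
  have [j H] := expr_large (v N); exists j; rewrite ltnNge; apply/negP => jN.
  have := le_trans (grid_ge j) (hvmono (grid_gt0 j) jN).
  by rewrite leNgt H.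
have [[|j] jN jmin] := ex_minnP ex.
  by move: jN; rewrite ltnNge (leq_trans (grid_mono (leq0n k0))).
exists j; split=> //.
- rewrite leqNgt; apply/negP => jk.
  by move: jN; rewrite ltnNge (leq_trans (grid_mono jk)).
- by rewrite leqNgt; apply/negP => /jmin; rewrite ltnn.
Qed.

End WithRatio.
End Grid.

(** * A Borel-Cantelli lemma for grids *)

Section LogSeries.
Context (R : realType).

(** Telescoping against the power [1 - q], from
    [k.+1%:R^-1 <= ln k.+1%:R - ln k%:R]. *)
Lemma log_series_step (q : R) (k : nat) : 1 < q -> (0 < k)%N ->
  (q - 1) * expR (- q * ln k.+1%:R) <=
  expR (- (q - 1) * ln k%:R) - expR (- (q - 1) * ln k.+1%:R).
Proof.
move=> q1 k0; have k0' : (0 : R) < k%:R by rewrite ltr0n.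
have k1 : (0 : R) < k.+1%:R by rewrite ltr0n.
have lnk : k.+1%:R^-1 <= ln k.+1%:R - ln k%:R :> R.
  have := expR_ge1Dx (ln (k%:R / k.+1%:R) : R).
  rewrite lnK ?posrE ?divr_gt0 // ln_div ?posrE // => h.
  have : (k%:R / k.+1%:R : R) = 1 - k.+1%:R^-1.
    by rewrite -natr1; field; rewrite natr1 gt_eqF.
  move=> E; rewrite E in h; move: h; move: (ln _) (ln _) (_^-1) => a b c; lra.
have -> : expR (- (q - 1) * ln k%:R) = expR (- (q - 1) * ln k.+1%:R) *
    expR ((q - 1) * (ln k.+1%:R - ln k%:R)).
  by rewrite -expRD; congr expR; ring.
have -> : expR (- q * ln k.+1%:R) = expR (- (q - 1) * ln k.+1%:R) * k.+1%:R^-1 :> R.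
  rewrite -[X in _ * X^-1](lnK (_ : _ \is Num.pos)) ?posrE // -expRN -expRD.
  by congr expR; ring.
have := expR_ge1Dx ((q - 1) * (ln k.+1%:R - ln k%:R)).
have : (q - 1) * k.+1%:R^-1 <= (q - 1) * (ln k.+1%:R - ln k%:R).
  by rewrite ler_wpM2l //; lra.
have := expR_gt0 (- (q - 1) * ln k.+1%:R : R).
move: ((q - 1) * (ln _ - _)) (expR ((q - 1) * _)) (expR (- (q - 1) * _)) (_^-1).
by move=> g f e i e0 h1 h2; nra.
Qed.

Lemma log_series_bound (q : R) (n : nat) : 1 < q ->
  \sum_(0 <= k < n) expR (- q * ln k.+2%:R) <= (q - 1)^-1.
Proof.
move=> q1; rewrite -[leRHS]mulr1 ler_pdivlMl ?subr_gt0 //.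
apply: (@le_trans _ _ (expR (- (q - 1) * ln 1%:R) - expR (- (q - 1) * ln n.+1%:R))).
  elim: n => [|n IH]; first by rewrite big_nil mulr0 subrr.
  rewrite big_nat_recr //= mulrDr; have := log_series_step q1 (ltn0Sn n).
  by move: IH; lra.
by rewrite ln1 mulr0 expR0 lerBlDr lerDl expR_ge0.
Qed.

End LogSeries.

Section BorelCantelli.
Context (d : measure_display) (T : measurableType d) (R : realType).
Variable P : probability T R.

Lemma borel_cantelli_log (b : nat -> T -> bool) (q C : R) (k0 : nat) :
  (forall k, mbool_wrt measurable (b k)) -> 1 < q -> 0 <= C ->
  (forall k, (k0 <= k)%N -> (0 < k)%N ->
    Expect P (fun w => (b k w)%:R) <= C * expR (- q * ln k%:R)) ->
  {ae P, forall w, exists K, forall k, (K <= k)%N -> ~~ b k w}.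
Proof.
move=> mb q1 C0 Eb; pose A k := [set w | b (k + k0).+2 w].
have mA k : measurable (A k) by exact: (mbool_set (@sigma_algebra_meas _ T)).
have PA k : (P (A k) <= (C * expR (- q * ln k.+2%:R))%:E)%E.
  rewrite /A -Expect_bool // lee_fin (le_trans (Eb _ _ _)) //; first by lia.
  rewrite ler_wpM2l // ler_expR !mulNr lerN2 ler_wpM2l ?(ltW (lt_trans _ q1)) //.
  by rewrite ler_ln ?posrE ?ltr0n // ler_nat; lia.
have S : (\sum_(k <oo) P (A k) < +oo)%E.
  apply: (@le_lt_trans _ _ (C * (q - 1)^-1)%:E); last exact: ltry.
  apply: lime_le; first exact: is_cvg_nneseries.
  apply: nearW => n; apply: (@le_trans _ _
    (\sum_(0 <= k < n) (C * expR (- q * ln k.+2%:R))%:E)%E).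
    by apply: lee_sum => k _.
  rewrite sumEFin lee_fin -mulr_sumr ler_wpM2l //; exact: log_series_bound.
have := lim_sup_set_cvg0 mA S => P0.
exists (lim_sup_set A); split=> //.
  by apply: bigcap_measurable => // k _; exact: bigcup_measurable.
move=> w /= nex; rewrite /lim_sup_set => n _ /=.
apply: contrapT => H; apply: nex; exists (n + k0).+2 => k nk.
apply/negP => bk; apply: H; exists (k - k0 - 2)%N => /=; first by lia.
by rewrite /A /= (_ : ((k - k0 - 2 + k0).+2 = k)%N) //; lia.
Qed.

End BorelCantelli.

(** * The upper bound in one direction *)

Section Upper.
Context (d : measure_display) (T : measurableType d) (R : realType).
Variables (P : probability T R) (F : nat -> set (set T)).
Hypothesis hF : decreasing_filtration F.
Variables (c v : nat -> R).
Hypotheses (hv0 : forall N, (1 <= N)%N -> 0 < v N)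
    (hvmono : forall M N, (1 <= M)%N -> (M <= N)%N -> v M <= v N)
    (hvoo : v N @[N --> \oo] --> +oo).
Notation r := (sqrtLL v).
Hypothesis hcs : forall e : R, 0 < e -> exists N0, forall N, (N0 <= N)%N ->
  forall n, (n < N)%N -> c n * r N <= e * v N.

(** When [v] grows at least geometrically, [L (v ^+ 2)] grows at least linearly,
    so [expR (- q * L (L (v ^+ 2)))] is at most of the order of the [- q]-th
    power of the index. *)
Lemma expR_LL_geometric (rho q : R) (t : nat -> nat) : 1 < rho -> 0 <= q ->
  (forall k, rho ^+ k <= v (t k)) ->
  exists C, 0 <= C /\ forall k, (0 < k)%N ->
    expR (- (q * r (t k) ^+ 2)) <= C * expR (- q * ln k%:R).
Proof.
move=> rho1 q0 tv; have rho0 : 0 < rho by rewrite (lt_trans _ rho1).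
have l0 : 0 < ln rho by rewrite ln_gt0.
exists (expR (- q * ln (2 * ln rho))); split=> [|k k0]; first exact: expR_ge0.
have k0' : (0 : R) < k%:R by rewrite ltr0n.
have rk0 : 0 < rho ^+ k by rewrite exprn_gt0.
rewrite -expRD ler_expR sqrtLL2 -mulrDr -lnM ?posrE ?mulr_gt0 // mulNr lerN2.
rewrite ler_wpM2l //.
apply: (@le_trans _ _ (ln (L (v (t k) ^+ 2)))); last first.
  by apply: ln_le_L; rewrite (lt_le_trans _ (L_ge1 _)).
rewrite ler_ln ?posrE ?mulr_gt0 // ?(lt_le_trans _ (L_ge1 _)) //.
have h : (rho ^+ k) ^+ 2 <= v (t k) ^+ 2.
  by rewrite lerXn2r ?nnegrE ?(ltW rk0) // (le_trans (ltW rk0) (tv k)).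
apply: le_trans (L_mono h); apply: le_trans (ln_le_L _); last by rewrite exprn_gt0.
rewrite !lnXn ?exprn_gt0 // le_eqVlt; apply/orP; left; apply/eqP.
by rewrite -[in RHS]mulr_natr -[in RHS]mulr_natr; ring.
Qed.

Section Tails.
Variables (y s : nat -> T -> R) (K : R).
Hypotheses (ys : scalar_rmd P F y s) (K0 : 0 < K)
  (yK : forall n w, `|y n w| <= K * c n).
Variables (rho : R) (t : nat -> nat).
Hypotheses (rho1 : 1 < rho) (t0 : forall k, (0 < t k)%N)
  (tv : forall k, rho ^+ k <= v (t k)).

(** The maximal inequality with tilt [b * r / v] and level [q * r ^+ 2]; the
    exceptional probabilities are summable because [1 < q]. All the tails
    below the top [t i] are controlled at once. *)
Lemma tails_ae (q b k : R) : 1 < q -> 0 < b -> 0 < k -> k <= 1 ->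
  {ae P, forall w, exists K1, forall i, (K1 <= i)%N ->
    forall j, (j <= t i)%N ->
    \sum_(j <= n < t i) y n w <=
     v (t i) * r (t i) * (q / b) +
     (1 + k) / 2 * b * (r (t i) / v (t i)) * \sum_(j <= n < t i) s n w}.
Proof.
move=> q1 b0 k0 k1.
pose l i := b * r (t i) / v (t i).
pose x i (n : nat) w := l i * y n w - (1 + k) / 2 * (l i ^+ 2 * s n w).
pose u i := q * r (t i) ^+ 2.
have q0 : 0 < q by rewrite (lt_trans _ q1).
have u0 i : 0 <= u i by rewrite /u mulr_ge0 ?sqr_ge0 // ltW.
have bx i n : bounded_mfun (F 0%N) (x i n).
  have [ybm bs _ _] := ys n.
  have bs' := bm_filt hF (leq0n n.+1) bs; have by' := bm_filt hF (leq0n n) ybm.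
  by rewrite /x; bm_tac.
have mb i : mbool_wrt measurable (fun w => ~~ tails_below (t i) (u i) (x i) 0 w).
  apply: mbool_neg; apply: (mbool_sub (filtration_meas hF (n:=0%N))).
  by apply: mbool_tails_below => n _; exact: bx.
have l0 i : 0 < l i by rewrite /l !mulr_gt0 ?sqrtLL_gt0 ?invr_gt0 ?hv0.
have [C [C0 HC]] := expR_LL_geometric rho1 (ltW q0) tv.
have [N0 HN0] := hcs (divr_gt0 k0 (mulr_gt0 b0 K0)).
have [k2 Hk2] := ge_grid_large hvmono rho1 N0 t0 tv.
have small i n w : (k2 <= i)%N -> (n < t i)%N -> `|l i * y n w| <= k.
  move=> ki nt; have h := HN0 (t i) (Hk2 i ki) n nt.
  rewrite normrM gtr0_norm // (le_trans (ler_wpM2l (ltW (l0 i)) (yK n w))) //.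
  have vt := hv0 (t0 i).
  have -> : l i * (K * c n) = (b * K / v (t i)) * (c n * r (t i)).
    by rewrite /l; field; exact: lt0r_neq0.
  have bKv : 0 <= b * K / v (t i) by rewrite !mulr_ge0 ?invr_ge0 ?ltW.
  apply: le_trans (ler_wpM2l bKv h) _; rewrite le_eqVlt; apply/orP; left; apply/eqP.
  by field; rewrite !lt0r_neq0.
have /(borel_cantelli_log mb q1 C0) H : forall i, (k2 <= i)%N -> (0 < i)%N ->
    Expect P (fun w => (~~ tails_below (t i) (u i) (x i) 0 w)%:R) <= C * expR (- q * ln i%:R).
  move=> i ki i0; apply: le_trans (HC i i0).
  by apply: (tail_maximal hF ys) => // n w nt; exact: small.
apply: filterS H => w [K1 HK1]; exists K1 => i Ki j jt.
have := HK1 i Ki; rewrite negbK => /allP/(_ j).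
rewrite mem_index_iota /= ltnS jt => /(_ isT).
rewrite /tail_sum /x sumrB -!mulr_sumr /u => h.
have vt := hv0 (t0 i); have rt := sqrtLL_gt0 v (t i).
rewrite -(ler_pM2l (l0 i)).
have -> : l i * (v (t i) * r (t i) * (q / b) +
    (1 + k) / 2 * b * (r (t i) / v (t i)) * \sum_(j <= n < t i) s n w)
  = q * r (t i) ^+ 2 + (1 + k) / 2 * (l i ^+ 2 * \sum_(j <= n < t i) s n w).
  by rewrite /l; field; rewrite !lt0r_neq0.
by move: h; rewrite lerBlDr.
Qed.

End Tails.
End Upper.

Lemma sum_tail (R : realType) (f : nat -> R) (i t : nat) : (i <= t)%N ->
  \sum_(i <= n < t) f n = \sum_(0 <= n < t) f n - \sum_(0 <= n < i) f n.
Proof. by move=> it; rewrite (@big_cat_nat _ _ _ i 0 t) //= addrAC subrr add0r. Qed.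

Section UpperBound.
Context (d : measure_display) (T : measurableType d) (R : realType).
Variables (P : probability T R) (F : nat -> set (set T)).
Hypothesis hF : decreasing_filtration F.
Variables (c v : nat -> R).
Hypotheses (hv0 : forall N, (1 <= N)%N -> 0 < v N)
    (hvmono : forall M N, (1 <= M)%N -> (M <= N)%N -> v M <= v N)
    (hvoo : v N @[N --> \oo] --> +oo).
Notation r := (sqrtLL v).
Hypothesis hcs : forall e : R, 0 < e -> exists N0, forall N, (N0 <= N)%N ->
  forall n, (n < N)%N -> c n * r N <= e * v N.

Lemma scalar_rmdN (y s : nat -> T -> R) : scalar_rmd P F y s ->
  scalar_rmd P F (fun n w => - y n w) s.
Proof.
move=> ys n; have [ybm bs m0 var] := ys n; split=> //.
- exact: bmN.
- move=> U bU; under [X in Expect P X]eq_fun do rewrite mulrN -mulN1r.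
  rewrite ExpectZ ?m0 ?mulr0 //; apply: bmM; last exact: bm_filtT hF _ _ ybm.
  exact: bm_filtT hF _ _ bU.
- by move=> U bU; under [X in Expect P X]eq_fun do rewrite sqrrN; exact: var.
Qed.

Lemma scalar_rmd_var_ge0 (y s : nat -> T -> R) : scalar_rmd P F y s ->
  {ae P, forall w, forall n, 0 <= s n w}.
Proof.
move=> ys; apply: ae_foralln => n; have [ybm bs m0 var] := ys n.
by apply: (cond_var_ge0 (filtration_meas hF (n:=n.+1)) bs var).
Qed.

(** Rewrites the bound of [tails_ae] at the top [t] of a block of ratio at most
    the square root of two in terms of the scale at its bottom [m]. The tilt
    [b2] can be taken large as long as the variance [tau] is small. *)
Lemma block_scale (m t : nat) (rho b2 tau S D : R) : (0 < m)%N -> (m <= t)%N ->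
  v t <= rho * v m -> 1 <= rho -> rho ^+ 2 <= 2 -> 0 < b2 -> 0 <= tau ->
  D <= tau * v m ^+ 2 ->
  S <= v t * r t * (2 / b2) + (1 + 1) / 2 * b2 * (r t / v t) * D ->
  S <= v m * r m * (8 / b2 + 2 * b2 * tau).
Proof.
move=> m0 mt vt rho1 rho2 b20 tau0 Dle /le_trans; apply.
have vm := hv0 m0; have vt0 := hv0 (leq_trans m0 mt).
have rm := sqrtLL_gt0 v m; have rt := sqrtLL_gt0 v t; have vmt := hvmono m0 mt.
have rt2 : r t <= 2 * r m.
  rewrite -(@ler_pXn2r R 2%N) ?nnegrE ?mulr_ge0 ?(ltW rt) ?(ltW rm) //.
  rewrite exprMn !sqrtLL2.
  have h1 : L (L (v t ^+ 2)) <= 2 * L (L (v m ^+ 2)).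
    apply: (@le_trans _ _ (L (L (rho ^+ 2 * v m ^+ 2)))).
      do 2 apply: L_mono; rewrite -exprMn lerXn2r ?nnegrE ?(ltW vt0) //.
      by rewrite ltW // (lt_le_trans vt0 vt).
    apply: LL_double; first by rewrite expr_ge1 // (le_trans _ rho1).
    by rewrite (le_trans rho2) //; have := expR_ge1Dx (1 : R); lra.
  by have := L_ge1 (L (v m ^+ 2)); nra.
have h1 : v t * r t <= 4 * (v m * r m).
  have hrho : rho <= 2 by nra.
  have : v t <= 2 * v m by rewrite (le_trans vt) // ler_wpM2r // ltW.
  by move: rt2 rt vt0; nra.
have h2 : r t / v t * D <= 2 * tau * (v m * r m).
  apply: (@le_trans _ _ (r t / v t * (tau * v m ^+ 2))).
    by rewrite ler_wpM2l // divr_ge0 // ltW.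
  rewrite mulrAC ler_pdivrMr //.
  have -> : 2 * tau * (v m * r m) * v t = tau * v m * (2 * r m * v t) by ring.
  have -> : r t * (tau * v m ^+ 2) = tau * v m * (r t * v m) by ring.
  rewrite ler_wpM2l ?mulr_ge0 ?(ltW vm) //.
  by apply: ler_pM => //; exact: ltW.
have -> : (1 + 1) / 2 * b2 * (r t / v t) * D = b2 * (r t / v t * D).
  by field; exact: lt0r_neq0.
apply: (@le_trans _ _ (4 * (v m * r m) * (2 / b2) + b2 * (2 * tau * (v m * r m)))).
  by apply: lerD; [rewrite ler_wpM2r // divr_ge0 // ltW|rewrite ler_wpM2l // ltW].
by rewrite le_eqVlt; apply/orP; left; apply/eqP; field; exact: lt0r_neq0.
Qed.

Variables (y s : nat -> T -> R) (K sigma b : R).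
Hypotheses (ys : scalar_rmd P F y s) (K0 : 0 < K)
  (yK : forall n w, `|y n w| <= K * c n).
Hypothesis (sigma0 : 0 <= sigma).
Hypothesis hq : {ae P, forall w, forall e : R, 0 < e -> exists N0, forall N, (N0 <= N)%N ->
  `|\sum_(0 <= n < N) s n w - sigma * v N ^+ 2| <= e * v N ^+ 2}.
Hypotheses (b0 : 0 < b) (sb : 2 * sigma < b ^+ 2).

(** With tilt [2 / b] the limiting coefficient of the bound at the grid points
    is [b / 2 + sigma / b], which is smaller than [b] exactly when
    [2 * sigma < b ^+ 2]. Of the gap [2 * g], one half pays for the perturbation
    [e] of all the constants and the other for the oscillation in a block. *)
Lemma upper_constants : exists g e : R,
  [/\ 0 < g, 0 < e, e <= 1 / 4,
     (1 + e) * (b / 2) + (1 + e) * (sigma + e) / b <= b - g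
   & 3 * e * (sigma + 1) <= (g / 32) ^+ 2].
Proof.
pose g := (b / 2 - sigma / b) / 2.
have g0 : 0 < g.
  rewrite /g divr_gt0 // subr_gt0 ltr_pdivrMr //; move: sb; rewrite expr2; lra.
pose A := b / 2 + sigma / b + 2 / b.
have A0 : 0 < A.
  by rewrite /A addr_gt0 ?divr_gt0 // ltr_wpDr ?divr_gt0 // divr_ge0 // ltW.
pose e := Num.min (1 / 4) (Num.min (g / A) ((g / 32) ^+ 2 / (3 * (sigma + 1)))).
have s1 : 0 < 3 * (sigma + 1) by rewrite mulr_gt0 // ltr_wpDl.
have e0 : 0 < e.
  rewrite /e !lt_min; apply/andP; split; first by rewrite divr_gt0.
  by apply/andP; split; apply: divr_gt0 => //; rewrite exprn_gt0 // divr_gt0.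
have e4 : e <= 1 / 4 by rewrite /e ge_min lexx.
have eA : e * A <= g by rewrite -ler_pdivlMr // /e !ge_min lexx orbT.
exists g, e; split=> //.
- have -> : (1 + e) * (b / 2) + (1 + e) * (sigma + e) / b =
     b / 2 + sigma / b + e * (b / 2 + sigma / b + (1 + e) / b).
    by field; exact: lt0r_neq0.
  have : e * (b / 2 + sigma / b + (1 + e) / b) <= e * A.
    by rewrite ler_pM2l // lerD2l ler_wpM2r ?invr_ge0 ?ltW //; lra.
  have -> : b / 2 + sigma / b = b - 2 * g by rewrite /g; field; exact: lt0r_neq0.
  move: eA; lra.
- have : e <= (g / 32) ^+ 2 / (3 * (sigma + 1)) by rewrite /e !ge_min lexx !orbT.
  by rewrite ler_pdivlMr //; apply: le_trans; rewrite le_eqVlt; apply/orP; left; apply/eqP; ring.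
Qed.

(** At a grid point the tail starting at [0] is the sum itself. Inside a block
    the increment since the grid point is the difference of two tails with the
    same top, so [tails_ae] is applied to [y] and to [- y]. *)
Lemma scalar_upper_lil : {ae P, forall w, exists N0, forall N, (N0 <= N)%N ->
  \sum_(0 <= n < N) y n w <= b * (v N * r N)}.
Proof.
have [g [e [g0 e0 e4 main tauE]]] := upper_constants.
pose rho := 1 + e; have rho1 : 1 < rho by rewrite /rho ltrDl.
have rho2 : rho ^+ 2 <= 2.
  have : 0 <= e * (1 / 4 - e) by rewrite mulr_ge0 ?subr_ge0 // ltW.
  have -> : rho ^+ 2 = 1 + 2 * e + e / 4 - e * (1 / 4 - e) by rewrite /rho; field.
  move: e4; lra.
pose G := grid hvoo rho.
(* The last index of the block [k], or its first index if the block is empty. *)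
pose t2 k := maxn (G k) (G k.+1).-1.
have G0 k : (0 < G k)%N by exact: grid_gt0.
have Gv k : rho ^+ k <= v (G k) by exact: grid_ge.
have t20 k : (0 < t2 k)%N by rewrite leq_max G0.
have t2v k : rho ^+ k <= v (t2 k).
  by rewrite (le_trans (Gv k)) // hvmono // leq_maxl.
have b20 : 0 < 64 / g by rewrite divr_gt0.
have b1 : 0 < 2 / b by rewrite divr_gt0.
have e1 : e <= 1 by lra.
have yKN n w : `|- y n w| <= K * c n by rewrite normrN.
have q2 : (1 : R) < 2 by lra.
have T1 := tails_ae hF hv0 hvmono hcs ys K0 yK rho1 G0 Gv rho1 b1 e0 e1.
have T2 := tails_ae hF hv0 hvmono hcs ys K0 yK rho1 t20 t2v q2 b20 ltr01 (lexx 1).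
have T3 := tails_ae hF hv0 hvmono hcs (scalar_rmdN ys) K0 yKN rho1 t20 t2v q2 b20 ltr01 (lexx 1).
apply: filterS2 (filterI T1 T2) (filterI T3 (filterI (scalar_rmd_var_ge0 ys) hq)).
move=> w [[K1 H1] [K2 H2]] [[K3 H3] [s0 /(_ e e0) [N0 HN0]]].
have [K4 H4] := ge_grid_large hvmono rho1 N0 G0 Gv.
pose k0 := (K1 + K2 + K3 + K4)%N.
exists (G k0) => N GN.
have [k [kk0 kN Nk]] := grid_cover hvmono rho1 GN.
rewrite -/G in kN Nk.
have [k1 k2 k3 k4] : [/\ (K1 <= k)%N, (K2 <= k)%N, (K3 <= k)%N & (K4 <= k)%N].
  by move: kk0; rewrite /k0; clear; split; lia.
set m := G k in kN; set t := t2 k.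
have mt : (m <= t)%N by rewrite leq_max leqnn.
have Nt : (N <= t)%N.
  by rewrite leq_max orbC -ltnS prednK ?G0 // Nk.
have vm := hv0 (G0 k); rewrite -/m in vm.
have vt : v t <= rho * v m.
  rewrite /t /t2; have [h|h] := leqP (G k) (G k.+1).-1.
    apply: (@le_trans _ _ (rho ^+ k.+1)).
      apply: ltW; apply: grid_lt.
        by rewrite (leq_trans (G0 k)).
      by rewrite -/G prednK ?G0.
    by rewrite exprS ler_wpM2l ?Gv // ltW // (lt_trans _ rho1).
  by rewrite -/m ler_peMl // ltW.
have N0m : (N0 <= m)%N := H4 k k4.
have qm := HN0 m N0m; have qt := HN0 t (leq_trans N0m mt).
pose q n := \sum_(0 <= i < n) s i w; rewrite -!/(q _) in qm qt.
pose M n := \sum_(0 <= i < n) y i w.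
have splitM i : (i <= t)%N -> \sum_(i <= n < t) y n w = M t - M i by exact: sum_tail.
have splitq i : (i <= t)%N -> \sum_(i <= n < t) s n w = q t - q i by exact: sum_tail.
have qmono : q m <= q N.
  by rewrite -subr_ge0 /q -sum_tail // sumr_ge0.
pose tau := 3 * e * (sigma + 1).
have tau0 : 0 <= tau by rewrite mulr_ge0 ?mulr_ge0 ?addr_ge0 // ltW.
have Dle : q t - q m <= tau * v m ^+ 2.
  move: qm qt; rewrite !ler_norml => /andP[qm _] /andP[_ qt].
  have : v t ^+ 2 <= (1 + 3 * e) * v m ^+ 2.
    apply: (@le_trans _ _ ((rho * v m) ^+ 2)).
      by rewrite lerXn2r ?nnegrE ?mulr_ge0 ?(ltW vm) ?(ltW (lt_trans _ rho1)) //
         (le_trans (ltW vm)) // hvmono // G0.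
    rewrite exprMn ler_wpM2r ?sqr_ge0 // /rho; nra.
  have v2 : 0 <= v m ^+ 2 by exact: sqr_ge0.
  move: (v m ^+ 2) (v t ^+ 2) v2 qm qt => a a' a0 qm qt aa.
  have : (sigma + e) * a' <= (sigma + e) * ((1 + 3 * e) * a).
    by rewrite ler_wpM2l // addr_ge0 // ltW.
  have : e * (e * a) <= 1 / 4 * (e * a) by rewrite ler_wpM2r // mulr_ge0 // ltW.
  have : 0 <= e * a by rewrite mulr_ge0 // ltW.
  rewrite /tau; move: (q t) (q m) qm qt => Qt Qm; lra.
have S2 : M t - M m <= v m * r m * (8 / (64 / g) + 2 * (64 / g) * tau).
  apply: (block_scale (D := q t - q m) (G0 k) mt vt) => //; first exact: ltW.
  by rewrite -splitM // -splitq //; apply: H2.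
have S3 : M N - M t <= v m * r m * (8 / (64 / g) + 2 * (64 / g) * tau).
  apply: (block_scale (D := q t - q N) (G0 k) mt vt) => //; first exact: ltW.
    by rewrite (le_trans _ Dle) // lerD2l lerN2.
  have := H3 k _ N Nt; rewrite sumrN splitM // opprB splitq //; exact.
have S1 : M m <= v m * r m * (b - g).
  have /(_ _ 0%N (leq0n _)) := H1 k.
  rewrite -/G -/m -/(M m) -/(q m) => /(_ k1)/le_trans; apply.
  have qms : q m <= (sigma + e) * v m ^+ 2.
    by move: qm; rewrite ler_norml => /andP[_]; rewrite lerBlDr mulrDl addrC.
  have rm := sqrtLL_gt0 v m.
  apply: (@le_trans _ _ (v m * r m * ((1 + e) * (b / 2) + (1 + e) * (sigma + e) / b))).
    have c0 : 0 <= (1 + e) / 2 * (2 / b) * (r m / v m).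
      by rewrite !mulr_ge0 ?invr_ge0 ?addr_ge0 ?ltW.
    apply: le_trans (lerD (lexx _) (ler_wpM2l c0 qms)) _.
    rewrite le_eqVlt; apply/orP; left; apply/eqP; rewrite /rho.
    by field; rewrite !lt0r_neq0.
  by rewrite ler_wpM2l // mulr_ge0 // ltW.
have rm := sqrtLL_gt0 v m.
apply: (@le_trans _ _ (b * (v m * r m))); last first.
  rewrite ler_wpM2l ?(ltW b0) //; apply: ler_pM; rewrite ?(ltW vm) ?(ltW rm) //.
    by apply: hvmono => //; exact: G0.
  by apply: sqrtLL_mono => //; exact: G0.
rewrite -/(M N).
have a0 : 0 < v m * r m by rewrite mulr_gt0.
have E : 8 / (64 / g) + 2 * (64 / g) * tau <= g / 2.
  have -> : 8 / (64 / g) = g / 8 by field; rewrite lt0r_neq0.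
  have : 2 * (64 / g) * tau <= 2 * (64 / g) * ((g / 32) ^+ 2).
    by rewrite ler_wpM2l // mulr_ge0 // ltW.
  have -> : 2 * (64 / g) * ((g / 32) ^+ 2) = g / 8 by field; rewrite lt0r_neq0.
  lra.
have := ler_wpM2l (ltW a0) E.
move: S1 S2 S3; move: (v m * r m) (8 / _ + _) => a z; lra.
Qed.

End UpperBound.

(** * Exponents of tilted block sums *)

Section Tilting.
Context (R : realType).
(* The position [s] and the covariance [q] of a block are measured in the unit
   of the tilt: the target position is [2 * La * x], and the expected
   covariance is [2 * La] times the identity. *)
Variables (s0 s1 q0 q01 q1 : R).

Definition quad_form (a0 a1 : R) : R := a0 ^+ 2 * q0 + a0 * a1 * q01 + a1 ^+ 2 * q1.
Definition tilt_exponent (a0 a1 k : R) : R := a0 * s0 + a1 * s1 - k * quad_form a0 a1.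

(** The mixed term is dominated by the two squares. *)
Lemma quad_form_near (La k a0 a1 : R) : 0 <= La * k ->
  `|q0 - 2 * La| <= 2 * La * k -> `|q1 - 2 * La| <= 2 * La * k ->
  `|q01| <= 2 * La * k ->
  `|quad_form a0 a1 - 2 * La * (a0 ^+ 2 + a1 ^+ 2)| <= 4 * La * k * (a0 ^+ 2 + a1 ^+ 2).
Proof.
move=> Lk0 hq0 hq1 hq01.
have -> : quad_form a0 a1 - 2 * La * (a0 ^+ 2 + a1 ^+ 2) =
    a0 ^+ 2 * (q0 - 2 * La) + a0 * a1 * q01 + a1 ^+ 2 * (q1 - 2 * La).
  by rewrite /quad_form; ring.
have e0 : `|a0 ^+ 2 * (q0 - 2 * La)| <= a0 ^+ 2 * (2 * La * k).
  by rewrite normrM ger0_norm ?sqr_ge0 // ler_wpM2l // sqr_ge0.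
have e1 : `|a1 ^+ 2 * (q1 - 2 * La)| <= a1 ^+ 2 * (2 * La * k).
  by rewrite normrM ger0_norm ?sqr_ge0 // ler_wpM2l // sqr_ge0.
have Lk : 0 <= 2 * La * k by rewrite -mulrA mulr_ge0.
have e01 : `|a0 * a1 * q01| <= (a0 ^+ 2 + a1 ^+ 2) * (2 * La * k).
  rewrite normrM; apply: ler_pM => //.
  have : 0 <= (`|a0| - `|a1|) ^+ 2 by exact: sqr_ge0.
  rewrite sqrrB !real_normK ?num_real // normrM -mulr_natr.
  have : 0 <= `|a0| * `|a1| by rewrite mulr_ge0.
  lra.
apply: le_trans (ler_normD _ _) _.
apply: le_trans (lerD (ler_normD _ _) (lexx _)) _.
by move: e0 e1 e01; lra.
Qed.

Variables (x0 x1 La eta delta : R).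
Let k := delta ^+ 2.
Hypotheses (La0 : 0 < La) (eta0 : 0 < eta) (eta1 : eta <= 1)
  (deltaE : eta = 32 * delta)
  (xeta : x0 ^+ 2 + x1 ^+ 2 + 2 * eta <= 1).
Hypothesis qx : quad_form x0 x1 <= 2 * (1 + k) * (x0 ^+ 2 + x1 ^+ 2) * La.

Let delta0 : 0 < delta. Proof. by move: eta0; rewrite deltaE; lra. Qed.
Let delta1 : delta <= 1 / 32. Proof. by move: eta1; rewrite deltaE; lra. Qed.
Let k0 : 0 < k. Proof. by rewrite exprn_gt0. Qed.
Let kd : k <= delta / 32.
Proof.
rewrite /k expr2 ler_wpM2l //; [exact: ltW|by move: delta1; lra].
Qed.

Let X := x0 ^+ 2 + x1 ^+ 2.
Let X0 : 0 <= X. Proof. by rewrite addr_ge0 ?sqr_ge0. Qed.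
Let X1 : X <= 1. Proof. by move: xeta eta0; rewrite -/X; lra. Qed.

(** The logarithm of the density of the tilt is about
    [La * (x0 ^+ 2 + x1 ^+ 2)]; the room left by [xeta] absorbs the errors. *)
Lemma tilt_le_La : x0 * s0 + x1 * s1 - quad_form x0 x1 <= eta * La ->
  tilt_exponent x0 x1 ((1 - 2 * k) / 2) <= La.
Proof.
move=> h; rewrite /tilt_exponent; move: qx h; rewrite -/X; move: (quad_form x0 x1) => q qX h.
have k1 : k <= 1 / 1024 by move: kd delta1; lra.
have h1 : (1 + 2 * k) / 2 * q <= (1 + 2 * k) / 2 * (2 * (1 + k) * X * La).
  by rewrite ler_wpM2l //; move: k0; lra.
have h2 : (1 + 2 * k) * (1 + k) * X <= X + 4 * k.
  have -> : (1 + 2 * k) * (1 + k) * X = X + (3 * k + 2 * k * k) * X by ring.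
  have : (3 * k + 2 * k * k) * X <= 3 * k + 2 * k * k.
    by rewrite ler_piMr // addr_ge0 // ?mulr_ge0 // ltW.
  have : k * k <= k * (1 / 1024) by rewrite ler_wpM2l // ltW.
  move: k0; lra.
have h3 : (X + 4 * k) * La + eta * La <= La.
  rewrite -mulrDl ler_piMl // ?(ltW La0) //.
  by move: xeta kd delta0; rewrite -/X deltaE; lra.
have h4 : (1 + 2 * k) * (1 + k) * X * La <= (X + 4 * k) * La.
  by rewrite ler_wpM2r // ltW.
have h5 : (1 + 2 * k) / 2 * (2 * (1 + k) * X * La) = (1 + 2 * k) * (1 + k) * X * La.
  by field.
move: h h1 h3 h4; rewrite h5; lra.
Qed.

(** Chernoff bound in the direction [x]: multiply the tilt by [1 + delta]. The
    second-order loss is at most [16 * k * La], half of the gain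
    [delta * eta * La] as [eta = 32 * delta]. *)
Lemma tilt_escape_radial : eta * La < x0 * s0 + x1 * s1 - quad_form x0 x1 ->
  tilt_exponent x0 x1 ((1 - 2 * k) / 2) <=
  tilt_exponent ((1 + delta) * x0) ((1 + delta) * x1) ((1 + k) / 2) - delta * eta * La / 2.
Proof.
move=> h.
have E : tilt_exponent ((1 + delta) * x0) ((1 + delta) * x1) ((1 + k) / 2) =
    (1 + delta) * (x0 * s0 + x1 * s1) - (1 + k) / 2 * (1 + delta) ^+ 2 * quad_form x0 x1.
  by rewrite /tilt_exponent /quad_form; ring.
rewrite E /tilt_exponent; move: (quad_form x0 x1) (x0 * s0 + x1 * s1) qx h => q s qX h.
pose c1 := (3 * k + 2 * k * delta + (1 + k) * k) / 2.
have c1d : 0 <= c1 <= 4 * k.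
  have k1 : k <= 1 by move: kd delta1; lra.
  have : 0 <= k * delta by rewrite mulr_ge0 // ltW.
  have : k * delta <= k * (1 / 32) by rewrite ler_wpM2l // ltW.
  have : 0 <= k * k by rewrite mulr_ge0 // ltW.
  have : k * k <= k * 1 by rewrite ler_wpM2l // ltW.
  by rewrite /c1; move: k0; lra.
have /andP[c10 c1k] := c1d.
have q4 : q <= 4 * La.
  apply: (le_trans qX); rewrite ler_wpM2r ?(ltW La0) //.
  have : (1 + k) * X <= (1 + k) * 1 by rewrite ler_wpM2l // addr_ge0 // ltW.
  by rewrite -mulrA -/X; move: kd delta1; lra.
have h1 : c1 * q <= 4 * k * (4 * La).
  apply: (@le_trans _ _ (c1 * (4 * La))); first by rewrite ler_wpM2l.
  by rewrite ler_wpM2r // mulr_ge0 // ltW.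
have h2 : 4 * k * (4 * La) <= delta * eta * La / 2.
  have -> : 4 * k * (4 * La) = delta * (32 * delta) * La / 2 by rewrite /k; field.
  by rewrite -deltaE.
have h3 : delta * (eta * La) <= delta * (s - q) by rewrite ler_wpM2l // ltW.
have E2 : (1 + delta) * s - (1 + k) / 2 * (1 + delta) ^+ 2 * q =
   (s - (1 - 2 * k) / 2 * q) + delta * (s - q) - c1 * q.
  by rewrite /c1 /k; field.
rewrite E2; move: h1 h2 h3; lra.
Qed.

Hypotheses (hq0 : `|q0 - 2 * La| <= 2 * La * k)
  (hq1 : `|q1 - 2 * La| <= 2 * La * k) (hq01 : `|q01| <= 2 * La * k).

(** Chernoff bound beyond the target in the direction [e]: add [delta * e] to the
    tilt. The linear terms gain [2 * delta * eta * La], and all the second-order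
    terms together lose at most [25 * k * La], where [k = delta * eta / 32]. *)
Lemma tilt_escape (e0 e1 : R) : e0 ^+ 2 + e1 ^+ 2 = 1 ->
  2 * La * (e0 * x0 + e1 * x1 + eta) < e0 * s0 + e1 * s1 ->
  tilt_exponent x0 x1 ((1 - 2 * k) / 2) <=
  tilt_exponent (x0 + delta * e0) (x1 + delta * e1) ((1 + k) / 2) - delta * eta * La / 2.
Proof.
move=> e2 h; pose a0 := x0 + delta * e0; pose a1 := x1 + delta * e1.
pose A := a0 ^+ 2 + a1 ^+ 2; pose p := e0 * x0 + e1 * x1.
have AE : A = X + 2 * delta * p + k.
  have -> : k = k * (e0 ^+ 2 + e1 ^+ 2) by rewrite e2 mulr1.
  by rewrite /A /a0 /a1 /p /X /k; ring.
have A0 : 0 <= A by rewrite addr_ge0 ?sqr_ge0.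
have A4 : A <= 4.
  have : 0 <= (x0 - delta * e0) ^+ 2 + (x1 - delta * e1) ^+ 2.
    by rewrite addr_ge0 ?sqr_ge0.
  have -> : (x0 - delta * e0) ^+ 2 + (x1 - delta * e1) ^+ 2 =
     2 * X + 2 * k * (e0 ^+ 2 + e1 ^+ 2) - A.
    by rewrite /A /a0 /a1 /X /k; ring.
  by rewrite e2; move: X1 kd delta1; lra.
have Lk0 : 0 <= La * k by rewrite mulr_ge0 // ltW.
have qa := quad_form_near a0 a1 Lk0 hq0 hq1 hq01; rewrite -/A in qa.
have qX := quad_form_near x0 x1 Lk0 hq0 hq1 hq01; rewrite -/X in qX.
move: qa qX; rewrite !ler_norml => /andP[_ qa] /andP[qX _].
have h' : delta * (2 * La * (p + eta)) <= delta * (e0 * s0 + e1 * s1).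
  by rewrite ler_wpM2l // ltW.
have E : tilt_exponent a0 a1 ((1 + k) / 2) - tilt_exponent x0 x1 ((1 - 2 * k) / 2) =
   delta * (e0 * s0 + e1 * s1) - (1 + k) / 2 * quad_form a0 a1 + (1 - 2 * k) / 2 * quad_form x0 x1.
  by rewrite /tilt_exponent /a0 /a1; ring.
have k1 : k <= 1 / 1024 by move: kd delta1; lra.
have g1 : (1 + k) / 2 * quad_form a0 a1 <= (1 + k) / 2 * (2 * La * (A + 2 * k * A)).
  by rewrite ler_wpM2l //; move: k0 qa; lra.
have g2 : (1 - 2 * k) / 2 * (2 * La * (X - 2 * k * X)) <= (1 - 2 * k) / 2 * quad_form x0 x1.
  by rewrite ler_wpM2l //; move: k1 qX; lra.
rewrite -/a0 -/a1 lerBrDr -lerBrDl E.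
have g3 : (1 + k) / 2 * (2 * La * (A + 2 * k * A)) <= La * (A + 20 * k).
  have -> : (1 + k) / 2 * (2 * La * (A + 2 * k * A)) = La * (A + (3 * k + 2 * k * k) * A).
    by field.
  rewrite ler_wpM2l ?(ltW La0) // lerD2l.
  apply: (@le_trans _ _ ((3 * k + 2 * k * k) * 4)).
    by rewrite ler_wpM2l // addr_ge0 ?mulr_ge0 // ltW.
  have : k * k <= k * (1 / 1024) by rewrite ler_wpM2l // ltW.
  by move: k0; lra.
have g4 : La * (X - 4 * k) <= (1 - 2 * k) / 2 * (2 * La * (X - 2 * k * X)).
  have -> : (1 - 2 * k) / 2 * (2 * La * (X - 2 * k * X)) = La * (X - 4 * k * X + 4 * k * k * X).
    by field.
  rewrite ler_wpM2l ?(ltW La0) //.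
  have : k * X <= k * 1 by rewrite ler_wpM2l // ltW.
  have : 0 <= 4 * k * k * X by rewrite !mulr_ge0 // ltW.
  by move: X0; lra.
have g5 : delta * eta * La / 2 <= La * (2 * delta * eta - 25 * k).
  have -> : k = delta * eta / 32 by rewrite /k deltaE; field.
  have -> : delta * eta * La / 2 = La * (delta * eta / 2) by ring.
  have : 0 < delta * eta by rewrite mulr_gt0.
  by move=> de; rewrite ler_wpM2l ?(ltW La0) //; lra.
apply: le_trans g5 _; move: h' g1 g2 g3 g4; rewrite AE; lra.
Qed.

End Tilting.

(** * Hitting a target within a block *)

Section Block.
Context (d : measure_display) (T : measurableType d) (R : realType).
Variables (P : probability T R) (F : nat -> set (set T)).
Hypothesis hF : decreasing_filtration F.
Variables (Y0 Y1 V00 V01 V11 : nat -> T -> R) (c : nat -> R).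

Definition dir_incr (a0 a1 : R) n w : R := a0 * Y0 n w + a1 * Y1 n w.
Definition dir_var (a0 a1 : R) n w : R :=
  a0 ^+ 2 * V00 n w + a0 * a1 * V01 n w + a1 ^+ 2 * V11 n w.

Hypothesis hdir : forall a0 a1, scalar_rmd P F (dir_incr a0 a1) (dir_var a0 a1).
Hypotheses (Y0c : forall n w, `|Y0 n w| <= c n)
  (Y1c : forall n w, `|Y1 n w| <= c n).

Lemma bmY0 n : bounded_mfun (F n) (Y0 n).
Proof.
have [+ _ _ _] := hdir 1 0 n; rewrite /dir_incr.
by under eq_fun do rewrite mul1r mul0r addr0.
Qed.

Lemma bmY1 n : bounded_mfun (F n) (Y1 n).
Proof.
have [+ _ _ _] := hdir 0 1 n; rewrite /dir_incr.
by under eq_fun do rewrite mul1r mul0r add0r.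
Qed.

Lemma bmV00 n : bounded_mfun (F n.+1) (V00 n).
Proof.
have [_ + _ _] := hdir 1 0 n; rewrite /dir_var.
by under eq_fun do rewrite expr1n expr0n mulr0 !mul0r !addr0 mul1r.
Qed.

Lemma bmV11 n : bounded_mfun (F n.+1) (V11 n).
Proof.
have [_ + _ _] := hdir 0 1 n; rewrite /dir_var.
by under eq_fun do rewrite expr1n expr0n !mul0r !add0r mul1r.
Qed.

Lemma bmV01 n : bounded_mfun (F n.+1) (V01 n).
Proof.
have [_ h _ _] := hdir 1 1 n.
have -> : V01 n = fun w => dir_var 1 1 n w - V00 n w - V11 n w.
  by apply/funext => w; rewrite /dir_var; ring.
by apply: bmB; [apply: bmB => //; exact: bmV00|exact: bmV11].
Qed.

Section FixedBlock.
Variables (m N : nat) (l La x0 x1 eta delta : R).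
Let k := delta ^+ 2.
Let X := x0 ^+ 2 + x1 ^+ 2.

Definition target_var n w : R := dir_var (l * x0) (l * x1) n w.
(** The stopping rule bounds the variance in the direction of the target, hence
    the density of the tilt, on the whole probability space. *)
Definition running n w : bool := tails_below N (2 * (1 + k) * X * La) target_var n w.
Definition stopped_sum (a : R) (f : nat -> T -> R) w : R :=
  \sum_(m <= n < N) (running n w)%:R * (a * f n w).

Definition on_target w : bool :=
  (`|stopped_sum l Y0 w - 2 * La * x0| <= 2 * La * eta) &&
  (`|stopped_sum l Y1 w - 2 * La * x1| <= 2 * La * eta).
Definition cov_regular w : bool :=
  [&& `|stopped_sum (l ^+ 2) V00 w - 2 * La| <= 2 * La * k,
      `|stopped_sum (l ^+ 2) V11 w - 2 * La| <= 2 * La * k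
    & `|stopped_sum (l ^+ 2) V01 w| <= 2 * La * k].
(** Counting blocks with a wrong covariance as hits makes the lower bound on the
    conditional probability uniform; almost surely there are only finitely many
    of them. *)
Definition hit w : bool := on_target w || ~~ cov_regular w.

Hypotheses (mN : (m <= N)%N) (l0 : 0 < l) (La0 : 0 < La)
  (eta0 : 0 < eta) (eta1 : eta <= 1)
  (deltaE : eta = 32 * delta)
  (xeta : x0 ^+ 2 + x1 ^+ 2 + 2 * eta <= 1)
  (small : forall n, (n < N)%N -> l * (4 * c n) <= k)
  (large : 18 <= delta * eta * La).

Lemma bm_target_var n : bounded_mfun (F n.+1) (target_var n).
Proof. by have [] := hdir (l * x0) (l * x1) n. Qed.

Lemma mbool_running n : mbool_wrt (F n.+1) (running n).
Proof.
apply: mbool_tails_below => j /andP[nj _]; apply: (bm_filt hF (_ : (n.+1 <= j.+1)%N)) => //.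
exact: bm_target_var.
Qed.

Lemma bm_running n : bounded_mfun (F n.+1) (fun w => (running n w)%:R : R).
Proof. exact: (bm_bool R (@mbool_running n)). Qed.

Lemma bm_stopped_sum (a : R) f : (forall n, bounded_mfun (F n) (f n)) ->
  bounded_mfun (F m) (stopped_sum a f).
Proof.
move=> bf; apply: bm_sum_nat => n /andP[mn _]; apply: (bm_filt hF mn).
have := bm_filt hF (leqnSn n) (bm_running n); have := bf n => ? ?; bm_tac.
Qed.

Lemma mbool_hit : mbool_wrt (F m) hit.
Proof.
have b0 := bm_stopped_sum l bmY0; have b1 := bm_stopped_sum l bmY1.
have bV (f : nat -> T -> R) : (forall n, bounded_mfun (F n.+1) (f n)) ->
    forall a, bounded_mfun (F m) (stopped_sum a f).
  by move=> h a; apply: bm_stopped_sum => n; apply: (bm_filt hF (leqnSn n)); exact: h.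
have mle (f : T -> R) (t e : R) : bounded_mfun (F m) f ->
    mbool_wrt (F m) (fun w => `|f w - t| <= e)%R.
  move=> bf; have -> : (fun w => `|f w - t| <= e)%R =
      (fun w => (t - e <= f w)%R && (f w <= t + e)%R).
    by apply/funext => w; rewrite ler_distl.
  by apply: mbool_and; apply: mbool_le; try exact: bf.1; exact: (bm_cst _ _).1.
have hn : mbool_wrt (F m) on_target by apply: mbool_and; exact: mle.
have hr : mbool_wrt (F m) cov_regular.
  apply: mbool_and; first by apply: mle; apply: bV; exact: bmV00.
  apply: mbool_and; first by apply: mle; apply: bV; exact: bmV11.
  have := mle _ 0 (2 * La * k) (bV _ bmV01 (l ^+ 2)).
  by under eq_fun do rewrite subr0.
have -> : hit = fun w => ~~ (~~ on_target w && ~~ ~~ cov_regular w).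
  by apply/funext => w; rewrite /hit negb_and !negbK.
exact: (mbool_neg (mbool_and (mbool_neg hn) (mbool_neg (mbool_neg hr)))).
Qed.

Lemma bm_hit : bounded_mfun (F m) (fun w => (hit w)%:R : R).
Proof. exact: (bm_bool R (@mbool_hit)). Qed.

Definition block_tilt (a0 a1 e : R) w : R :=
  tilt_exponent (stopped_sum l Y0 w) (stopped_sum l Y1 w) (stopped_sum (l ^+ 2) V00 w)
    (stopped_sum (l ^+ 2) V01 w) (stopped_sum (l ^+ 2) V11 w) a0 a1 e.

Lemma block_tiltE (a0 a1 e : R) w :
  \sum_(m <= n < N) tilt_term (dir_incr (l * a0) (l * a1)) (dir_var (l * a0) (l * a1))
     (fun n w => (running n w)%:R) e n w = block_tilt a0 a1 e w.
Proof.
rewrite /block_tilt /tilt_exponent /quad_form /stopped_sum.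
rewrite !mulr_sumr -!big_split /= mulr_sumr -sumrB; apply: eq_bigr => n _.
by rewrite /tilt_term /dir_incr /dir_var; case: (running n w) => /=; ring.
Qed.

Lemma bm_block_tilt (a0 a1 e : R) : bounded_mfun (F m) (block_tilt a0 a1 e).
Proof.
have b0 := bm_stopped_sum l bmY0; have b1 := bm_stopped_sum l bmY1.
have bV (f : nat -> T -> R) : (forall n, bounded_mfun (F n.+1) (f n)) ->
    bounded_mfun (F m) (stopped_sum (l ^+ 2) f).
  by move=> h; apply: bm_stopped_sum => n; apply: (bm_filt hF (leqnSn n)); exact: h.
have := bV _ bmV00; have := bV _ bmV01; have := bV _ bmV11.
by rewrite /block_tilt /tilt_exponent /quad_form => ? ? ?; bm_tac.
Qed.

Lemma quad_form_stopped_sum w : quad_form (stopped_sum (l ^+ 2) V00 w) (stopped_sum (l ^+ 2) V01 w)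
  (stopped_sum (l ^+ 2) V11 w) x0 x1 <= 2 * (1 + k) * X * La.
Proof.
have u0 : 0 <= 2 * (1 + k) * X * La.
  by rewrite !mulr_ge0 ?addr_ge0 ?sqr_ge0 // ltW.
have [+ _] := stopped_before target_var w mN u0; apply: le_trans.
rewrite le_eqVlt; apply/orP; left; apply/eqP.
rewrite /quad_form /stopped_sum !mulr_sumr -!big_split /=; apply: eq_bigr => n _.
by rewrite /target_var /dir_var /running; ring.
Qed.

Lemma dir_incr_small (a0 a1 : R) n w : `|a0| <= 2 -> `|a1| <= 2 -> (n < N)%N ->
  `|(running n w)%:R * dir_incr (l * a0) (l * a1) n w| <= k.
Proof.
move=> h0 h1 nN; apply: le_trans (small nN).
have cn : 0 <= c n by rewrite (le_trans _ (Y0c n w)).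
apply: (@le_trans _ _ `|dir_incr (l * a0) (l * a1) n w|).
  by case: running => /=; rewrite ?mul1r // mul0r normr0.
have -> : dir_incr (l * a0) (l * a1) n w = l * (a0 * Y0 n w + a1 * Y1 n w).
  by rewrite /dir_incr; ring.
rewrite normrM gtr0_norm // ler_wpM2l ?(ltW l0) //.
apply: le_trans (ler_normD _ _) _; rewrite !normrM.
have := ler_pM (normr_ge0 _) (normr_ge0 _) h0 (Y0c n w).
have := ler_pM (normr_ge0 _) (normr_ge0 _) h1 (Y1c n w).
lra.
Qed.

Let delta0 : 0 < delta. Proof. by move: eta0; rewrite deltaE; lra. Qed.
Let delta1 : delta <= 1 / 32. Proof. by move: eta1; rewrite deltaE; lra. Qed.
Let k0 : 0 < k. Proof. by rewrite exprn_gt0. Qed.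
Let kd : k <= delta / 32.
Proof.
rewrite /k expr2 ler_wpM2l //; [exact: ltW|by move: delta1; lra].
Qed.
Let bx : `|x0| <= 1 /\ `|x1| <= 1.
Proof.
have h : x0 ^+ 2 + x1 ^+ 2 <= 1 by move: xeta eta0; lra.
have s0 : 0 <= x0 ^+ 2 by exact: sqr_ge0.
have s1 : 0 <= x1 ^+ 2 by exact: sqr_ge0.
by split; rewrite -(@expr_le1 _ 2) // real_normK ?num_real //; move: h s0 s1; lra.
Qed.

(** Change of measure without a measure: the density of the tilt is at most
    [expR La] on a hit, and elsewhere it is dominated by a small multiple of the
    density of one of five other tilts. *)
Lemma hit_pointwise w :
  expR (block_tilt x0 x1 ((1 - 2 * k) / 2) w) <=
  expR La * (hit w)%:R + expR (- (delta * eta * La / 2)) *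
   (expR (block_tilt ((1 + delta) * x0) ((1 + delta) * x1) ((1 + k) / 2) w) +
    (expR (block_tilt (x0 + delta * 1) (x1 + delta * 0) ((1 + k) / 2) w) +
    (expR (block_tilt (x0 + delta * -1) (x1 + delta * 0) ((1 + k) / 2) w) +
    (expR (block_tilt (x0 + delta * 0) (x1 + delta * 1) ((1 + k) / 2) w) +
     expR (block_tilt (x0 + delta * 0) (x1 + delta * -1) ((1 + k) / 2) w))))).
Proof.
have esc e0 e1 : e0 ^+ 2 + e1 ^+ 2 = 1 -> cov_regular w ->
    2 * La * (e0 * x0 + e1 * x1 + eta) < e0 * stopped_sum l Y0 w + e1 * stopped_sum l Y1 w ->
    expR (block_tilt x0 x1 ((1 - 2 * k) / 2) w) <= expR (- (delta * eta * La / 2)) *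
    expR (block_tilt (x0 + delta * e0) (x1 + delta * e1) ((1 + k) / 2) w).
  move=> e2 /and3P[h1 h2 h3] h; rewrite -expRD ler_expR [leRHS]addrC.
  exact: tilt_escape.
have cc := expR_ge0 (- (delta * eta * La / 2)).
have z1 := expR_ge0 (block_tilt ((1 + delta) * x0) ((1 + delta) * x1) ((1 + k) / 2) w).
have z2 := expR_ge0 (block_tilt (x0 + delta * 1) (x1 + delta * 0) ((1 + k) / 2) w).
have z3 := expR_ge0 (block_tilt (x0 + delta * -1) (x1 + delta * 0) ((1 + k) / 2) w).
have z4 := expR_ge0 (block_tilt (x0 + delta * 0) (x1 + delta * 1) ((1 + k) / 2) w).
have z5 := expR_ge0 (block_tilt (x0 + delta * 0) (x1 + delta * -1) ((1 + k) / 2) w).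
have [rad|rad] := leP (x0 * stopped_sum l Y0 w + x1 * stopped_sum l Y1 w -
   quad_form (stopped_sum (l ^+ 2) V00 w) (stopped_sum (l ^+ 2) V01 w)
     (stopped_sum (l ^+ 2) V11 w) x0 x1) (eta * La);
   last first.
  apply: (@le_trans _ _ (expR (- (delta * eta * La / 2)) *
      expR (block_tilt ((1 + delta) * x0) ((1 + delta) * x1) ((1 + k) / 2) w))).
    rewrite -expRD ler_expR [leRHS]addrC.
    by apply: (tilt_escape_radial (eta := eta)) => //; exact: quad_form_stopped_sum.
  apply: ler_wpDl; first by rewrite mulr_ge0 // expR_ge0.
  by rewrite ler_wpM2l // lerDl !addr_ge0.
have [hw|] := boolP (hit w).
  apply: ler_wpDr; first by rewrite mulr_ge0 // !addr_ge0.
  rewrite [leRHS]mulr1 ler_expR.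
  apply: (tilt_le_La (eta := eta)) => //; exact: quad_form_stopped_sum.
rewrite /hit negb_or negbK => /andP[nn reg].
rewrite [X in _ <= X + _]mulr0 add0r.
have dist (s t e : R) : e < `|s - t| -> (t + e < s) \/ (e - t < - s).
  by case: (ger0P (s - t)) => h h'; [left|right]; lra.

move: nn; rewrite negb_and -!ltNge => /orP[/dist[h|h]|/dist[h|h]].
- have e2 : (1 : R) ^+ 2 + (0) ^+ 2 = 1 by ring.
  apply: le_trans (esc _ _ e2 reg _) _; first by move: h; lra.
  by rewrite ler_wpM2l //; move: z2 z3 z4 z5 z1; lra.
- have e2 : (-1 : R) ^+ 2 + (0) ^+ 2 = 1 by ring.
  apply: le_trans (esc _ _ e2 reg _) _; first by move: h; lra.
  by rewrite ler_wpM2l //; move: z2 z3 z4 z5 z1; lra.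
- have e2 : (0 : R) ^+ 2 + (1) ^+ 2 = 1 by ring.
  apply: le_trans (esc _ _ e2 reg _) _; first by move: h; lra.
  by rewrite ler_wpM2l //; move: z2 z3 z4 z5 z1; lra.
- have e2 : (0 : R) ^+ 2 + (-1) ^+ 2 = 1 by ring.
  apply: le_trans (esc _ _ e2 reg _) _; first by move: h; lra.
  by rewrite ler_wpM2l //; move: z2 z3 z4 z5 z1; lra.
Qed.

(** Integrate [hit_pointwise]: the left-hand side has expectation at least that
    of the weight, and each of the five error terms at most one tenth of it. *)
Lemma hit_prob (H : T -> R) : bounded_mfun (F N) H -> (forall w, 0 <= H w) ->
  expR (- La) / 2 * Expect P H <= Expect P (fun w => H w * (hit w)%:R).
Proof.
move=> bH H0.
have bHm := bm_filt hF mN bH; have bHT := bm_filtT hF bH.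
have k1 : k <= 1 / 2 by move: kd delta1; lra.
have k1' : k <= 1 by move: k1; lra.
pose Z (a0 a1 : R) w := expR (block_tilt a0 a1 ((1 + k) / 2) w).
have bZ a0 a1 : bounded_mfun measurable (Z a0 a1).
  by apply: (bm_filtT hF); apply: bm_expR; exact: bm_block_tilt.
have bchi n : (n < N)%N -> bounded_mfun (F n.+1) (fun w => (running n w)%:R : R).
  by move=> _; exact: bm_running.
have up a0 a1 : `|a0| <= 2 -> `|a1| <= 2 -> Expect P (fun w => H w * Z a0 a1 w) <= Expect P H.
  move=> h0 h1.
  have := chain_le hF (hdir (l * a0) (l * a1)) bchi
    (fun n w => dir_incr_small w h0 h1) bH H0 mN k1'.
  by under [X in Expect P X]eq_fun do rewrite block_tiltE.
have [bx0 bx1] := bx.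
have low : Expect P H <= Expect P (fun w => H w * expR (block_tilt x0 x1 ((1 - 2 * k) / 2) w)).
  have h0 : `|x0| <= 2 by move: bx0; lra.
  have h1 : `|x1| <= 2 by move: bx1; lra.
  have := chain_ge hF (hdir (l * x0) (l * x1)) bchi
    (fun n w => dir_incr_small w h0 h1) bH H0 mN k1.
  by under [X in _ <= Expect P X]eq_fun do rewrite block_tiltE.
have small_shift (x e : R) : `|x| <= 1 -> `|e| <= 1 -> `|x + delta * e| <= 2.
  move=> hx he; apply: le_trans (ler_normD _ _) _; rewrite normrM gtr0_norm //.
  have : delta * `|e| <= delta * 1 by rewrite ler_wpM2l // ltW.
  by move: hx delta1; lra.
have small_scale (x : R) : `|x| <= 1 -> `|(1 + delta) * x| <= 2.
  by move=> hx; rewrite mulrDl mul1r -[X in _ + X]mulr1 -mulrA mulr1 small_shift.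
have n1 : `|1 : R| <= 1 by rewrite normr1.
have n0 : `|0 : R| <= 1 by rewrite normr0.
have nN : `|-1 : R| <= 1 by rewrite normrN normr1.
have u1 := up _ _ (small_scale _ bx0) (small_scale _ bx1).
have u2 := up _ _ (small_shift _ _ bx0 n1) (small_shift _ _ bx1 n0).
have u3 := up _ _ (small_shift _ _ bx0 nN) (small_shift _ _ bx1 n0).
have u4 := up _ _ (small_shift _ _ bx0 n0) (small_shift _ _ bx1 n1).
have u5 := up _ _ (small_shift _ _ bx0 n0) (small_shift _ _ bx1 nN).
set cc := expR (- (delta * eta * La / 2)).
have bhit : bounded_mfun measurable (fun w => (hit w)%:R : R).
  by apply: (bm_filtT hF); exact: bm_hit.
have bLow : bounded_mfun measurable (fun w => expR (block_tilt x0 x1 ((1 - 2 * k) / 2) w)).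
  by apply: (bm_filtT hF); apply: bm_expR; exact: bm_block_tilt.
have := @Expect_le _ _ _ P (fun w => H w * expR (block_tilt x0 x1 ((1 - 2 * k) / 2) w))
  (fun w => expR La * (H w * (hit w)%:R) + cc *
     (H w * Z ((1 + delta) * x0) ((1 + delta) * x1) w +
     (H w * Z (x0 + delta * 1) (x1 + delta * 0) w +
     (H w * Z (x0 + delta * -1) (x1 + delta * 0) w +
     (H w * Z (x0 + delta * 0) (x1 + delta * 1) w +
      H w * Z (x0 + delta * 0) (x1 + delta * -1) w))))).
move=> /(_ _ _ _)/(le_trans low) main.
have {main} : Expect P H <= expR La * Expect P (fun w => H w * (hit w)%:R) + cc * (5 * Expect P H).
  have HZ a0 a1 : bounded_mfun measurable (fun w => H w * Z a0 a1 w) by exact: bmM.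
  have HH : bounded_mfun measurable (fun w => H w * (hit w)%:R) by exact: bmM.
  apply: le_trans (main _ _ _) _.
  - exact: bmM.
  - by repeat first [exact: HZ | exact: HH | apply: bmD | apply: bmZ].
  - move=> w; apply: le_trans (ler_wpM2l (H0 w) (hit_pointwise w)) _.
    rewrite le_eqVlt; apply/orP; left; apply/eqP; rewrite /cc /Z; ring.
  rewrite ExpectD; [|by apply: bmZ|];
    last by repeat first [exact: HZ | apply: bmD | apply: bmZ].
  rewrite !ExpectZ //; last by repeat first [exact: HZ | apply: bmD | apply: bmZ].
  rewrite !ExpectD //; try by repeat first [exact: HZ | apply: bmD | apply: bmZ].
  rewrite lerD2l ler_wpM2l ?expR_ge0 //.
  have -> : 5 * Expect P H =
      Expect P H + (Expect P H + (Expect P H + (Expect P H + Expect P H))) by ring.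
  exact: (lerD u1 (lerD u2 (lerD u3 (lerD u4 u5)))).
clear u1 u2 u3 u4 u5 low n0 n1 nN; have EH0 : 0 <= Expect P H by exact: Expect_ge0.
have cc10 : cc <= 1 / 10.
  rewrite /cc expRN -[1 / 10]invrK lef_pV2 ?posrE ?expR_gt0 ?invr_gt0 //.
  apply: le_trans (expR_ge1Dx _); rewrite div1r invrK.
  by move: large; lra.
have : cc * (5 * Expect P H) <= 1 / 10 * (5 * Expect P H) by rewrite ler_wpM2r // mulr_ge0.
move=> h1 h2; rewrite expRN mulrAC ler_pdivrMr // mulrC ler_pdivrMr ?expR_gt0 //.
by move: h1 h2; lra.
Qed.

End FixedBlock.
End Block.

(** * Infinitely many hits *)

Lemma harmonic_tail (R : realType) (j : nat) (M : R) : exists J,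
  M <= \sum_(j <= k < J) k.+1%:R^-1.
Proof.
have step (k : nat) : ln k.+2%:R - ln k.+1%:R <= k.+1%:R^-1 :> R.
  have k1 : (0 : R) < k.+1%:R by rewrite ltr0n.
  rewrite -ln_div ?posrE ?ltr0n //.
  have := expR_ge1Dx (k.+1%:R^-1 : R).
  have -> : 1 + k.+1%:R^-1 = k.+2%:R / k.+1%:R :> R.
    by rewrite -[k.+2%:R]natr1 mulrDl mulfV ?gt_eqF // mul1r.
  by move=> h; rewrite -[leRHS]expRK ler_ln ?posrE ?divr_gt0 ?ltr0n ?expR_gt0.
have tele n : ln (j + n).+1%:R - ln j.+1%:R <= \sum_(j <= k < j + n) k.+1%:R^-1 :> R.
  elim: n => [|n IH]; first by rewrite addn0 subrr big_geq.
  rewrite addnS big_nat_recr ?leq_addr //=; have := step (j + n)%N.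
  by move: IH; move: (ln _) (ln _) (ln _) (\sum_(_ <= _ < _) _) (_^-1) => x1 x2 x3 x4 x5; lra.
pose n := (Num.truncn (expR (M + ln j.+1%:R : R))).+1.
exists (j + n)%N; apply: le_trans (tele n).
rewrite lerBrDr -[leLHS]expRK ler_ln ?posrE ?expR_gt0 ?ltr0n //.
by rewrite (le_trans (ltW (truncnS_gt _))) // ler_nat leqW // leq_addl.
Qed.

Section InfinitelyOften.
Context (d : measure_display) (T : measurableType d) (R : realType).
Variables (P : probability T R) (F : nat -> set (set T)).
Hypothesis hF : decreasing_filtration F.
Variables (n : nat -> nat) (hit : nat -> T -> bool) (p : nat -> R) (k0 : nat).
Hypotheses (n_mono : forall k, (n k <= n k.+1)%N)
  (mhit : forall k, mbool_wrt (F (n k)) (hit k))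
  (phit : forall k, (k0 <= k)%N -> forall H, bounded_mfun (F (n k.+1)) H ->
     (forall w, 0 <= H w) -> p k * Expect P H <= Expect P (fun w => H w * (hit k w)%:R))
  (pdiv : forall j (M : R), exists J, M <= \sum_(j <= k < J) p k).

Definition missed j J w : bool := all (fun k => ~~ hit k w) (index_iota j J).

Lemma n_le j k : (j <= k)%N -> (n j <= n k)%N.
Proof. by move=> /subnK <-; elim: (k - j)%N => // i /leq_trans; apply. Qed.

Lemma mbool_missed j J : mbool_wrt (F (n j)) (missed j J).
Proof.
rewrite /missed; have : forall k, k \in index_iota j J -> (j <= k)%N.
  by move=> k; rewrite mem_index_iota => /andP[].
elim: (index_iota j J) => [|k r IH] H /=.
  exact: (@measurable_cst _ _ (g_sigma_algebraType (F (n j)))).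
apply: mbool_and; last by apply: IH => i ir; apply: H; rewrite inE ir orbT.
apply: mbool_neg; apply: (mbool_sub (filtration_le hF (n_le (H k _)))) => //.
by rewrite mem_head.
Qed.

(** The later blocks are measurable for the sigma-algebra above the block [j], so
    the block [j] contributes a factor [1 - p j]. *)
Lemma missed_prob j J : (k0 <= j)%N ->
  Expect P (fun w => (missed j J w)%:R) <= expR (- \sum_(j <= k < J) p k).
Proof.
move=> kj; have [Jj|/ltnW jJ] := leqP J j.
  rewrite big_geq // oppr0 expR0 -[leRHS](Expect_cst P); apply: Expect_le.
  - apply: (bm_filtT hF); exact: (bm_bool R (@mbool_missed j J)).
  - exact: bm_cst.
  - by move=> w; case: missed.
rewrite -(subnKC jJ); move: (J - j)%N => i {jJ}.
elim: i j kj => [|i IH] j kj.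
  rewrite addn0 big_geq // oppr0 expR0.
  have -> : (fun w => (missed j j w)%:R) = (fun=> 1 : R).
    by apply/funext => w; rewrite /missed /index_iota subnn.
  by rewrite Expect_cst.
rewrite addnS -addSn.
have bG : bounded_mfun (F (n j.+1)) (fun w => (missed j.+1 (j.+1 + i) w)%:R : R).
  exact: (bm_bool R (@mbool_missed _ _)).
have bGT := bm_filtT hF bG.
have bh : bounded_mfun measurable (fun w => (hit j w)%:R : R).
  by apply: (bm_filtT hF); exact: (bm_bool R (@mhit j)).
have -> : (fun w => (missed j (j.+1 + i) w)%:R) = (fun w =>
    (missed j.+1 (j.+1 + i) w)%:R - (missed j.+1 (j.+1 + i) w)%:R * (hit j w)%:R : R).
  apply/funext => w; rewrite /missed /index_iota.
  rewrite (_ : j.+1 + i - j = (j.+1 + i - j.+1).+1)%N; last by lia.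
  by rewrite /=; case: hit; case: all => /=; ring.
rewrite ExpectB //; last exact: bmM.
have := phit kj bG (fun w => ler0n _ _).
set E := Expect P _ => h; rewrite big_ltn; last by lia.
rewrite opprD expRD; apply: (@le_trans _ _ ((1 - p j) * E)).
  by rewrite mulrBl mul1r lerD2l lerN2.
have E0 : 0 <= E by apply: Expect_ge0 => w; exact: ler0n.
apply: (@le_trans _ _ (expR (- p j) * E)).
  by rewrite ler_wpM2r // expR_ge1Dx.
by rewrite ler_wpM2l ?expR_ge0 // IH // leqW.
Qed.

Lemma infinitely_many_hits : {ae P, forall w, forall K, exists2 k, (K <= k)%N & hit k w}.
Proof.
apply: ae_foralln => K.
pose j := maxn K k0.
pose A := \bigcap_i [set w | ~~ hit (j + i)%N w].
have mA : measurable A.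
  apply: bigcapT_measurable => i.
  apply: (mbool_set (@sigma_algebra_meas _ T)); apply: mbool_neg.
  exact: mbool_sub (filtration_meas hF (n:=_)) (@mhit _).
exists A; split=> //; last first.
  move=> w /= nex i _ /=; apply/negP => h; apply: nex; exists (j + i)%N => //.
  by rewrite (leq_trans (leq_maxl K k0)) // leq_addr.
have PA M : (P A <= (expR (- M))%:E)%E.
  have [J MJ] := pdiv j M.
  have mm : mbool_wrt measurable (missed j J).
    exact: mbool_sub (filtration_meas hF (n:=_)) (@mbool_missed j J).
  apply: (@le_trans _ _ (P [set w | missed j J w])).
    apply: le_measure; rewrite ?inE //.
      exact: (mbool_set (@sigma_algebra_meas _ T)).
    move=> w Aw /=; apply/allP => k; rewrite mem_index_iota => /andP[jk _].
    by have := Aw (k - j)%N I; rewrite /= subnKC.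
  rewrite -Expect_bool // lee_fin (le_trans (missed_prob _ _)) ?leq_maxr //.
  by rewrite ler_expR lerN2.
have fA : P A \is a fin_num by rewrite fin_num_measure.
have /fineK PE := fA.
have a0 : 0 <= fine (P A) by rewrite fine_ge0 // measure_ge0.
move: PE a0 PA; move: (fine (P A)) => a PE a0 PA.
suff a00 : a = 0 by exact: etrans (esym PE) (congr1 EFin a00).
apply/eqP; rewrite eq_le a0 andbT leNgt; apply/negP => a1.
have := PA (1 - ln a); rewrite -PE lee_fin opprB.
rewrite expRD lnK ?posrE // expRN ler_pMr // leNgt invf_lt1 ?expR_gt0 //.
by rewrite expR_gt1 ltr01.
Qed.

End InfinitelyOften.

(** * The planar reverse martingale *)

Lemma block_to_sum (R : realType) (SN Sm t a b e : R) :
  `|SN - Sm - t * a| <= e * a -> Sm <= 2 * b -> - Sm <= 2 * b ->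
  2 * b <= e * a -> `|SN - t * a| <= 2 * e * a.
Proof. by rewrite !ler_norml => /andP[h1 h2] h3 h4 h5; apply/andP; split; lra. Qed.

Section Planar.
Context (d : measure_display) (T : measurableType d) (R : realType).
Variables (P : probability T R) (F : nat -> set (set T)).
Hypothesis hF : decreasing_filtration F.
Variables (Y0 Y1 V00 V01 V11 : nat -> T -> R) (c v : nat -> R).
Hypothesis hdir : forall a0 a1, scalar_rmd P F (dir_incr Y0 Y1 a0 a1) (dir_var V00 V01 V11 a0 a1).
Hypotheses (Y0c : forall n w, `|Y0 n w| <= c n)
  (Y1c : forall n w, `|Y1 n w| <= c n).
Hypotheses (hv0 : forall N, (1 <= N)%N -> 0 < v N)
    (hvmono : forall M N, (1 <= M)%N -> (M <= N)%N -> v M <= v N)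
    (hvoo : v N @[N --> \oo] --> +oo).
Notation r := (sqrtLL v).
Hypothesis hcs : forall e : R, 0 < e -> exists N0, forall N, (N0 <= N)%N ->
  forall n, (n < N)%N -> c n * r N <= e * v N.

Definition cov_near (e : R) N w : Prop :=
  [/\ `|\sum_(0 <= n < N) V00 n w - v N ^+ 2 / 2| <= e * v N ^+ 2,
      `|\sum_(0 <= n < N) V11 n w - v N ^+ 2 / 2| <= e * v N ^+ 2
    & `|\sum_(0 <= n < N) V01 n w| <= e * v N ^+ 2].

Hypothesis hq : {ae P, forall w, forall e : R, 0 < e ->
  exists N0, forall N, (N0 <= N)%N -> cov_near e N w}.

Lemma sum_dir_incr a0 a1 N w : \sum_(0 <= n < N) dir_incr Y0 Y1 a0 a1 n w =
  a0 * \sum_(0 <= n < N) Y0 n w + a1 * \sum_(0 <= n < N) Y1 n w.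
Proof. by rewrite !mulr_sumr -big_split. Qed.

Lemma sum_dir_var a0 a1 m N w : \sum_(m <= n < N) dir_var V00 V01 V11 a0 a1 n w =
  quad_form (\sum_(m <= n < N) V00 n w) (\sum_(m <= n < N) V01 n w)
     (\sum_(m <= n < N) V11 n w) a0 a1.
Proof. by rewrite /quad_form !mulr_sumr -!big_split. Qed.

(** The limit of the normalised conditional variances in the direction
    [(a0, a1)] is half the squared norm of that vector. *)
Lemma direction_upper_lil (a0 a1 b : R) : 0 < b -> a0 ^+ 2 + a1 ^+ 2 < b ^+ 2 ->
  {ae P, forall w, exists N0, forall N, (N0 <= N)%N ->
    a0 * \sum_(0 <= n < N) Y0 n w + a1 * \sum_(0 <= n < N) Y1 n w
      <= b * (v N * r N)}.
Proof.
move=> b0 ab; pose K : R := `|a0| + `|a1| + 1.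
have K0 : 0 < K by rewrite ltr_wpDl // addr_ge0.
have yK n w : `|dir_incr Y0 Y1 a0 a1 n w| <= K * c n.
  have c0 : 0 <= c n by rewrite (le_trans _ (Y0c n w)).
  apply: le_trans (ler_normD _ _) _; rewrite !normrM /K !mulrDl mul1r.
  by apply: ler_wpDr => //; apply: lerD; rewrite ler_wpM2l.
pose sigma := (a0 ^+ 2 + a1 ^+ 2) / 2.
have s0 : 0 <= sigma by rewrite divr_ge0 // addr_ge0 ?sqr_ge0.
have sb : 2 * sigma < b ^+ 2 by rewrite /sigma mulrC divfK.
have hs : {ae P, forall w, forall e : R, 0 < e -> exists N0, forall N, (N0 <= N)%N ->
  `|\sum_(0 <= n < N) dir_var V00 V01 V11 a0 a1 n w - sigma * v N ^+ 2| <= e * v N ^+ 2}.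
  apply: filterS hq => w hw e e0.
  pose A := 2 * (a0 ^+ 2 + a1 ^+ 2) + 1.
  have A0 : 0 < A by rewrite ltr_wpDl // mulr_ge0 // addr_ge0 ?sqr_ge0.
  have [N0 HN] := hw (e / A) (divr_gt0 e0 A0).
  exists N0 => N /HN [h1 h2 h3].
  pose La := v N ^+ 2 / 4.
  have La0 : 0 <= La by rewrite divr_ge0 ?sqr_ge0.
  have k0 : 0 <= e / A by rewrite divr_ge0 ?ltW.
  have := @quad_form_near R _ _ _ La (2 * (e / A)) a0 a1 _ _ _ _.
  have E1 : 2 * La = v N ^+ 2 / 2 by rewrite /La; field.
  have E2 : 2 * La * (2 * (e / A)) = e / A * v N ^+ 2 by rewrite E1; field; exact: lt0r_neq0.
  rewrite sum_dir_var.
  move=> /(_ (\sum_(0 <= n < N) V00 n w) (\sum_(0 <= n < N) V01 n w) (\sum_(0 <= n < N) V11 n w)).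
  rewrite E2 E1 => /(_ (mulr_ge0 La0 (mulr_ge0 (ler0n _ 2) k0)) h1 h2 h3).
  have -> : v N ^+ 2 / 2 * (a0 ^+ 2 + a1 ^+ 2) = sigma * v N ^+ 2 by rewrite /sigma; field.
  move=> /le_trans; apply.
  have -> : 4 * La * (2 * (e / A)) * (a0 ^+ 2 + a1 ^+ 2) =
     (e * v N ^+ 2) * ((2 * (a0 ^+ 2 + a1 ^+ 2)) / A).
    by rewrite /La; field; exact: lt0r_neq0.
  have A1 : (2 * (a0 ^+ 2 + a1 ^+ 2)) / A <= 1.
    by rewrite ler_pdivrMr // mul1r /A lerDl.
  by apply: ler_piMr => //; rewrite mulr_ge0 ?sqr_ge0 // ltW.
have := scalar_upper_lil hF hv0 hvmono hvoo hcs (hdir a0 a1) K0 yK s0 hs b0 sb.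
by apply: filterS => w [N0 HN]; exists N0 => N /HN; rewrite sum_dir_incr.
Qed.

(** Along a single good sample path, the conditional covariance is asymptotic to
    [v N ^+ 2 / 2], and its increments are at most [c N ^+ 2], negligible with
    respect to [v N.+1 ^+ 2]; so [v] has no large jumps. *)
Lemma scale_jump : exists N0, forall N, (N0 <= N)%N -> v N.+1 <= 2 * v N.
Proof.
have Vc : {ae P, forall w, forall n, V00 n w <= c n ^+ 2}.
  apply: ae_foralln => n; have [ybm bs m0 var] := hdir 1 0 n.
  have := cond_var_le (filtration_meas hF (n:=n.+1)) (bm_filtT hF ybm) bs var
    (bm_cst _ 1) (k := c n) _.
  have y0 w : `|1 * dir_incr Y0 Y1 1 0 n w| <= c n.
    by rewrite /dir_incr mul0r addr0 !mul1r.
  move=> /(_ y0); apply: filterS => w; rewrite /dir_var.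
  by rewrite !expr1n expr0n /= !mul0r mulr0 mul0r !addr0 !mul1r.
have [w [Vw hw]] : exists w, (forall n, V00 n w <= c n ^+ 2) /\ (forall e : R, 0 < e ->
  exists N0, forall N, (N0 <= N)%N -> cov_near e N w).
  apply: contrapT => nex; have : {ae P, forall w, False}.
    by apply: filterS2 Vc hq => w h1 h2; apply: nex; exists w.
  case=> A [mA PA0 sub]; have : A = setT by apply/seteqP; split=> // w _; exact: sub.
  move=> E; rewrite E in PA0; have := @probability_setT _ _ _ P.
  by rewrite PA0 => /(congr1 fine) /= /eqP; rewrite eq_sym oner_eq0.
(* With error [1 / 8] the ratio of consecutive squares is at most [40 / 23]. *)
have e8 : (0 : R) < 1 / 8 by lra.
have [N0 HN0] := hw _ e8; have [N1 HN1] := hcs e8.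
exists (N0 + N1 + 1)%N => N hN.
have n0 : (N0 <= N)%N by move: hN; clear; lia.
have n1 : (N1 <= N.+1)%N by move: hN; clear; lia.
have [h1 _ _] := HN0 N n0; have [h2 _ _] := HN0 N.+1 (leqW n0).
have vN : 0 < v N by apply: hv0; move: hN; clear; lia.
have vN1 : 0 < v N.+1 by exact: hv0.
have cN : c N <= 1 / 8 * v N.+1.
  apply: le_trans (HN1 N.+1 n1 N (ltnSn N)).
  by rewrite ler_peMr ?sqrtLL_ge1 // (le_trans _ (Y0c N point)).
have c2 : c N ^+ 2 <= (1 / 8 * v N.+1) ^+ 2.
  have c0 : 0 <= c N by rewrite (le_trans _ (Y0c N point)).
  by rewrite lerXn2r ?nnegrE ?mulr_ge0 ?(ltW vN1).
have := h1; have := h2; rewrite big_nat_recr //= !ler_norml => /andP[a1 _] /andP[_ a2].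
rewrite -(@ler_pXn2r _ 2%N) ?nnegrE ?mulr_ge0 ?(ltW vN) ?(ltW vN1) // exprMn.
rewrite exprMn in c2; move: a1 a2 c2 (Vw N) (sqr_ge0 (v N)) (sqr_ge0 (v N.+1)).
move: (\sum_(_ <= _ < _) _) (V00 N w) (c N ^+ 2) (v N ^+ 2) (v N.+1 ^+ 2) => s V cc a b.
lra.
Qed.

Section Lower.
Variables (x0 x1 eta : R).
Hypotheses (eta0 : 0 < eta) (eta1 : eta <= 1)
  (xeta : x0 ^+ 2 + x1 ^+ 2 + 2 * eta <= 1).

Let delta := eta / 32.
Let k := delta ^+ 2.
(* With this ratio the scale below a block is at most [k / 4] times the scale
   at its top. *)
Let rho := 8 / k.
Let deltaE : eta = 32 * delta. Proof. by rewrite /delta; field. Qed.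
Let delta0 : 0 < delta. Proof. by rewrite divr_gt0. Qed.
Let delta1 : delta <= 1 / 32. Proof. by move: eta1; rewrite deltaE; lra. Qed.
Let k0 : 0 < k. Proof. by rewrite exprn_gt0. Qed.
Let kd : k <= delta / 32.
Proof.
rewrite /k expr2 ler_wpM2l //; [exact: ltW|by move: delta1; lra].
Qed.
Let keta : k / 2 <= eta. Proof. by rewrite deltaE; move: kd delta0 k0; lra. Qed.
Let rhok : rho * k = 8. Proof. by rewrite /rho divfK // gt_eqF. Qed.
Let rho1 : 1 < rho.
Proof. by rewrite /rho ltr_pdivlMr //; move: kd delta1; lra. Qed.
Let rho0 : 0 < rho. Proof. by rewrite (lt_trans _ rho1). Qed.

Let G := grid hvoo rho.
Let tilt_size i := 2 * r (G i.+1) / v (G i.+1).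
Let La i := r (G i.+1) ^+ 2.

Lemma grid_top : exists i0, forall i, (i0 <= i)%N -> v (G i) <= 2 * rho ^+ i.
Proof.
have [N0 HN0] := scale_jump.
have G0 i : (0 < G i)%N by exact: grid_gt0.
have Gv i : rho ^+ i <= v (G i) by exact: grid_ge.
have [i0 Hi0] := ge_grid_large hvmono rho1 (N0 + 2) G0 Gv.
exists i0 => i /Hi0 h.
have h1 : (N0 <= (G i).-1)%N by move: (G i) h => g; clear; lia.
have h2 : (0 < (G i).-1)%N by move: (G i) h => g; clear; lia.
have h3 : ((G i).-1 < G i)%N by rewrite prednK ?G0.
have := HN0 _ h1; rewrite prednK ?G0 // => /le_trans; apply.
by rewrite ler_pM2l // ltW // grid_lt.
Qed.

(** By [scale_jump], [v] grows at most geometrically along the grid, so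
    [L (v ^+ 2)] grows at most linearly. *)
Lemma hit_rate : exists C i0, 0 < C /\ forall i, (i0 <= i)%N ->
  C * i.+1%:R^-1 <= expR (- La i) / 2.
Proof.
have [i0 Hi0] := grid_top.
have l0 : 0 <= ln rho by rewrite ln_ge0 // ltW.
have l4 : 0 <= ln (4 : R) by rewrite ln_ge0 // ler1n.
pose B := expR 1 + 1 + ln 4 + 2 * ln rho : R.
have B0 : 0 < B by rewrite /B; have := expR_gt0 (1 : R); move: l0 l4; lra.
exists (2 * B)^-1, i0; split; first by rewrite invr_gt0 mulr_gt0.
move=> i hi.
have i1 : 1 <= i.+1%:R :> R by rewrite ler1n.
have vG := Hi0 i.+1 (leqW hi).
have v0 : 0 < v (G i.+1) by apply: hv0; exact: grid_gt0.
have LB : Num.max (expR 1) (L (v (G i.+1) ^+ 2)) <= B * i.+1%:R.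
  have Bi : B <= B * i.+1%:R by rewrite ler_peMr // ltW.
  rewrite ge_max; apply/andP; split.
    by apply: le_trans Bi; rewrite /B; move: l0 l4; lra.
  have e1 : 1 <= 4 * rho ^+ i.+1 ^+ 2.
    have : 1 <= rho ^+ i.+1 ^+ 2 by rewrite !exprn_ege1 // ltW.
    by lra.
  have -> : B * i.+1%:R = (expR 1 + 1 + ln 4) * i.+1%:R + 2 * ln rho * i.+1%:R.
    by rewrite /B; ring.
  apply: (@le_trans _ _ (L ((4 * rho ^+ i.+1 ^+ 2) * 1))).
    apply: L_mono; rewrite mulr1.
    have -> : 4 * rho ^+ i.+1 ^+ 2 = (2 * rho ^+ i.+1) ^+ 2 by ring.
    by rewrite lerXn2r ?nnegrE ?mulr_ge0 ?exprn_ge0 ?(ltW v0) ?(ltW rho0).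
  apply: le_trans (L_mul 1 e1) _.
  have -> : L (1 : R) = 1.
    rewrite /L (max_idPl _) ?expRK //.
    by have := expR_ge1Dx (1 : R); lra.
  rewrite lnM ?posrE ?exprn_gt0 // !lnXn ?exprn_gt0 //.
  have : expR 1 + 1 + ln 4 <= (expR 1 + 1 + ln 4) * i.+1%:R :> R.
    by apply: ler_peMr => //; rewrite !addr_ge0 // expR_ge0.
  have := expR_gt0 (1 : R).
  rewrite -[ln rho *+ _]mulr_natr -[_ *+ 2]mulr_natr.
  move: (expR 1) (ln 4) (ln rho) (i.+1%:R) => e f g h h1 h2; lra.
rewrite /La sqrtLL2 {1}/L expRN lnK ?posrE ?maxe_gt0 //.
rewrite -!invfM lef_pV2 ?posrE ?mulr_gt0 ?maxe_gt0 ?ltr0n //.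
by rewrite [leLHS]mulrC -[leRHS]mulrA ler_pM2l.
Qed.

Lemma blocks_hit_infinitely_often :
  {ae P, forall w, forall K, exists2 i, (K <= i)%N &
     hit Y0 Y1 V00 V01 V11 (G i) (G i.+1) (tilt_size i) (La i) x0 x1 eta delta w}.
Proof.
have [C [i0 [C0 HC]]] := hit_rate.
have G0 i : (0 < G i)%N by exact: grid_gt0.
have Gv i : rho ^+ i <= v (G i) by exact: grid_ge.
have Gm i : (G i <= G i.+1)%N by exact: grid_mono.
have k80 : 0 < k / 8 by rewrite divr_gt0.
have [N1 HN1] := hcs k80.
have [i1 Hi1] := ge_grid_large hvmono rho1 N1 G0 Gv.
have [N2 HN2] := v_large hvoo (expR (expR (18 / (delta * eta)))).
have [i2 Hi2] := ge_grid_large hvmono rho1 N2 G0 Gv.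
apply: (infinitely_many_hits hF (n := G) (p := fun i => C * i.+1%:R^-1)
  (k0 := (i0 + i1 + i2)%N)) => //.
- by move=> i; exact: (mbool_hit hF hdir).
- move=> i hi H bH H0.
  have hi0 : (i0 <= i)%N by move: hi; clear; lia.
  have hi1 : (i1 <= i.+1)%N by move: hi; clear; lia.
  have hi2 : (i2 <= i.+1)%N by move: hi; clear; lia.
  have vG : 0 < v (G i.+1) by exact: hv0.
  have rG := sqrtLL_gt0 v (G i.+1).
  apply: (@le_trans _ _ (expR (- La i) / 2 * Expect P H)).
    by rewrite ler_wpM2r ?HC // Expect_ge0.
  apply: (hit_prob hF hdir Y0c Y1c) => //.
  + by rewrite /tilt_size divr_gt0 // mulr_gt0.
  + by rewrite /La exprn_gt0.
  + move=> n nG; have h := HN1 _ (Hi1 _ hi1) n nG.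
    have -> : tilt_size i * (4 * c n) = 8 / v (G i.+1) * (c n * r (G i.+1)).
      by rewrite /tilt_size; field; exact: lt0r_neq0.
    apply: (@le_trans _ _ (8 / v (G i.+1) * (k / 8 * v (G i.+1)))).
      by rewrite ler_wpM2l // divr_ge0 // ltW.
    by rewrite le_eqVlt; apply/orP; left; apply/eqP; rewrite /k; field; exact: lt0r_neq0.
  + have de : 0 < delta * eta by rewrite mulr_gt0.
    rewrite mulrC -ler_pdivrMr // /La sqrtLL2.
    have hv := HN2 _ (Hi2 _ hi2).
    have z : 0 < expR (expR (18 / (delta * eta))) by exact: expR_gt0.
    apply: (@le_trans _ _ (L (L (expR (expR (18 / (delta * eta))))))).
      apply: le_trans (ln_le_L (lt_le_trans ltr01 (L_ge1 _))).
      rewrite -[leLHS]expRK ler_ln ?posrE ?expR_gt0 ?(lt_le_trans ltr01 (L_ge1 _)) //.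
      by apply: le_trans (ln_le_L z); rewrite expRK.
    do 2 apply: L_mono; rewrite (le_trans (ltW hv)) // expr2 ler_peMr ?(ltW vG) //.
    by rewrite (le_trans _ (ltW hv)) // -{1}expR0 ler_expR expR_ge0.
- move=> j M; have [J HJ] := harmonic_tail j (M / C).
  by exists J; rewrite -mulr_sumr -ler_pdivrMl // mulrC.
Qed.

(** Close to the limit covariance no tail exceeds the level, so nothing is
    stopped and [stopped_sum] is the plain block sum. *)
Lemma running_regular m N l La' w : (m <= N)%N -> 0 <= La' ->
  (forall n, 0 <= dir_var V00 V01 V11 x0 x1 n w) ->
  `|l ^+ 2 * \sum_(m <= n < N) V00 n w - 2 * La'| <= 2 * La' * (k / 2) ->
  `|l ^+ 2 * \sum_(m <= n < N) V11 n w - 2 * La'| <= 2 * La' * (k / 2) ->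
  `|l ^+ 2 * \sum_(m <= n < N) V01 n w| <= 2 * La' * (k / 2) ->
  forall n, (m <= n <= N)%N -> running V00 V01 V11 N l La' x0 x1 delta n w.
Proof.
move=> mN La0 pos h0 h1 h01 n /andP[mn nN].
have k2 : 0 <= La' * (k / 2) by rewrite mulr_ge0 // divr_ge0 // ltW.
have := quad_form_near x0 x1 k2 h0 h1 h01.
set X := x0 ^+ 2 + x1 ^+ 2; rewrite ler_norml => /andP[_ h].
have xv i : target_var V00 V01 V11 l x0 x1 i w = l ^+ 2 * dir_var V00 V01 V11 x0 x1 i w.
  by rewrite /target_var /dir_var; ring.
apply/allP => j; rewrite mem_index_iota ltnS => /andP[nj jN].
rewrite /tail_sum; apply: (@le_trans _ _ (\sum_(m <= i < N) target_var V00 V01 V11 l x0 x1 i w)).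
  rewrite [leRHS](@big_cat_nat _ _ _ j m N) //=; last exact: leq_trans nj.
  by rewrite lerDr sumr_ge0 // => i _; rewrite xv mulr_ge0 ?sqr_ge0.
have -> : \sum_(m <= i < N) target_var V00 V01 V11 l x0 x1 i w =
   quad_form (l ^+ 2 * \sum_(m <= n < N) V00 n w) (l ^+ 2 * \sum_(m <= n < N) V01 n w)
   (l ^+ 2 * \sum_(m <= n < N) V11 n w) x0 x1.
  by under eq_bigr do rewrite xv; rewrite -mulr_sumr sum_dir_var /quad_form; ring.
rewrite -lerBrDr in h; apply: le_trans h _; rewrite -/X -/k.
by rewrite le_eqVlt; apply/orP; left; apply/eqP; field.
Qed.

Lemma block_cov_scale (rN vN vm A B s : R) : 0 < vN -> 0 <= vm ->
  vm ^+ 2 <= k / 16 * vN ^+ 2 -> 0 <= s <= 1 ->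
  `|A - s * (vN ^+ 2 / 2)| <= k / 16 * vN ^+ 2 ->
  `|B - s * (vm ^+ 2 / 2)| <= k / 16 * vm ^+ 2 ->
  `|(2 * rN / vN) ^+ 2 * (A - B) - s * (2 * rN ^+ 2)| <= 2 * rN ^+ 2 * (k / 2).
Proof.
move=> vN0 vm0 vmk /andP[s0 s1] hA hB.
have -> : (2 * rN / vN) ^+ 2 * (A - B) - s * (2 * rN ^+ 2) =
   (4 * rN ^+ 2 / vN ^+ 2) * (A - B - s * (vN ^+ 2 / 2)).
  by field; exact: lt0r_neq0.
have f0 : 0 <= 4 * rN ^+ 2 / vN ^+ 2 by rewrite divr_ge0 ?sqr_ge0 // mulr_ge0 ?sqr_ge0.
have -> : 2 * rN ^+ 2 * (k / 2) = (4 * rN ^+ 2 / vN ^+ 2) * (k / 4 * vN ^+ 2).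
  by field; exact: lt0r_neq0.
rewrite normrM ger0_norm // ler_wpM2l //.
have vm20 : 0 <= vm ^+ 2 by exact: sqr_ge0.
have vN20 : 0 <= vN ^+ 2 by exact: sqr_ge0.
have k1 : k <= 1 by move: kd delta1; lra.
have sv : 0 <= s * (vm ^+ 2 / 2) <= vm ^+ 2 / 2.
  by rewrite mulr_ge0 ?divr_ge0 //= ler_piMl // divr_ge0.
have kv : k / 16 * vm ^+ 2 <= vm ^+ 2 / 2.
  have : k * vm ^+ 2 <= 1 * vm ^+ 2 by rewrite ler_wpM2r.
  by move: vm20; lra.
move: hA hB sv; rewrite !ler_norml => /andP[a1 a2] /andP[b1 b2] /andP[c1 c2].
move: (s * (vN ^+ 2 / 2)) (s * (vm ^+ 2 / 2)) a1 a2 b1 b2 c1 c2 kv vmk.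
move: (vN ^+ 2) (vm ^+ 2) vm20 vN20 => a b b0 a0 p q a1 a2 b1 b2 c1 c2 kv vmk.
have ka : 0 <= k * a by rewrite mulr_ge0 // ltW.
by apply/andP; split; lra.
Qed.

Lemma near_scale (l rN vN S t : R) : 0 < vN -> 0 < rN -> l = 2 * rN / vN ->
  `|l * S - 2 * rN ^+ 2 * t| <= 2 * rN ^+ 2 * eta ->
  `|S - t * (vN * rN)| <= eta * (vN * rN).
Proof.
move=> v0 r0 ->.
have -> : 2 * rN / vN * S - 2 * rN ^+ 2 * t = (2 * rN / vN) * (S - t * (vN * rN)).
  by field; exact: lt0r_neq0.
have f0 : 0 < 2 * rN / vN by rewrite divr_gt0 // mulr_gt0.
have -> : 2 * rN ^+ 2 * eta = (2 * rN / vN) * (eta * (vN * rN)).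
  by field; exact: lt0r_neq0.
by rewrite normrM (gtr0_norm f0) ler_pM2l.
Qed.

(** On a block with the right covariance a hit means that the block sum is close
    to the target. The sum before the block is at most twice its own scale, which
    is negligible because the ratio [rho] of the grid is large. *)
Lemma near_target_infinitely_often : {ae P, forall w, forall K, exists2 N, (K <= N)%N &
  `|\sum_(0 <= n < N) Y0 n w - x0 * (v N * r N)| <= 2 * eta * (v N * r N) /\
  `|\sum_(0 <= n < N) Y1 n w - x1 * (v N * r N)| <= 2 * eta * (v N * r N)}.
Proof.
have two : (0 : R) < 2 by [].
have up a0 a1 : a0 ^+ 2 + a1 ^+ 2 = 1 -> {ae P, forall w, exists N0, forall N, (N0 <= N)%N ->
    a0 * \sum_(0 <= n < N) Y0 n w + a1 * \sum_(0 <= n < N) Y1 n w <= 2 * (v N * r N)}.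
  by move=> a1E; apply: direction_upper_lil => //; rewrite a1E; lra.
have pos := scalar_rmd_var_ge0 hF (hdir x0 x1).
have U1 := up 1 0 ltac:(ring); have U2 := up (-1) 0 ltac:(ring).
have U3 := up 0 1 ltac:(ring); have U4 := up 0 (-1) ltac:(ring).
apply: filterS2 (filterI blocks_hit_infinitely_often (filterI pos hq))
  (filterI (filterI U1 U2) (filterI U3 U4)).
move=> w [hits [posw hw]] [[[N1 H1] [N2 H2]] [[N3 H3] [N4 H4]]] K.
have k16 : 0 < k / 16 by rewrite divr_gt0.
have [N5 H5] := hw _ k16.
have [i0 Hi0] := grid_top.
have G0 i : (0 < G i)%N by exact: grid_gt0.
have Gv i : rho ^+ i <= v (G i) by exact: grid_ge.
have [i1 Hi1] := ge_grid_large hvmono rho1 (N1 + N2 + N3 + N4 + N5 + K) G0 Gv.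
have [i ii hi] := hits (i0 + i1)%N.
have ii0 : (i0 <= i)%N by move: ii; clear; lia.
have big : (N1 + N2 + N3 + N4 + N5 + K <= G i)%N by apply: Hi1; move: ii; clear; lia.
have mN : (G i <= G i.+1)%N by exact: grid_mono.
set m := G i in big mN; set N := G i.+1 in mN.
have [b1 [b2 [b3 [b4 [b5 b6]]]]] : (N1 <= m)%N /\ (N2 <= m)%N /\ (N3 <= m)%N /\
   (N4 <= m)%N /\ (N5 <= m)%N /\ (K <= m)%N by move: big; clear; lia.
exists N; first exact: leq_trans mN.
have vm : 0 < v m by apply: hv0; exact: G0.
have vN : 0 < v N by apply: hv0; exact: G0.
have rm := sqrtLL_gt0 v m; have rN := sqrtLL_gt0 v N.
have rmN : r m <= r N by apply: sqrtLL_mono => //; exact: G0.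
have ratio : v m <= k / 4 * v N.
  apply: (@le_trans _ _ (k / 4 * rho ^+ i.+1)); last by rewrite ler_pM2l // divr_gt0.
  rewrite exprS mulrA (_ : k / 4 * rho = 2) ?Hi0 //.
  by rewrite mulrAC (mulrC k) rhok; lra.
have k1 : k <= 1 by move: kd delta1; lra.
have vm2 : v m ^+ 2 <= k / 16 * v N ^+ 2.
  apply: (@le_trans _ _ ((k / 4 * v N) ^+ 2)).
    by rewrite lerXn2r ?nnegrE ?(ltW vm) // mulr_ge0 ?divr_ge0 // ltW.
  have -> : (k / 4 * v N) ^+ 2 = k * (k / 16 * v N ^+ 2) by field.
  by rewrite ler_piMl // mulr_ge0 ?sqr_ge0 // ltW.
have [m0 m1 m01] := H5 m b5; have [n0 n1 n01] := H5 N (leq_trans b5 mN).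
pose l := 2 * r N / v N.
have La0 : 0 <= r N ^+ 2 by exact: sqr_ge0.
have ones : (0 : R) <= (1 : R) <= (1 : R) by rewrite ler01 lexx.
have zero : (0 : R) <= (0 : R) <= (1 : R) by rewrite lexx ler01.
have c0 : `|l ^+ 2 * \sum_(m <= n < N) V00 n w - 2 * r N ^+ 2| <= 2 * r N ^+ 2 * (k / 2).
  rewrite sum_tail // -[X in _ - X]mul1r.
  by apply: (block_cov_scale _ vN (ltW vm)) => //; rewrite mul1r.
have c1 : `|l ^+ 2 * \sum_(m <= n < N) V11 n w - 2 * r N ^+ 2| <= 2 * r N ^+ 2 * (k / 2).
  rewrite sum_tail // -[X in _ - X]mul1r.
  by apply: (block_cov_scale _ vN (ltW vm)) => //; rewrite mul1r.
have c01 : `|l ^+ 2 * \sum_(m <= n < N) V01 n w| <= 2 * r N ^+ 2 * (k / 2).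
  rewrite sum_tail // -[X in `|X|]subr0 -[X in _ - X](mul0r (2 * r N ^+ 2)).
  by apply: (block_cov_scale _ vN (ltW vm)) => //; rewrite mul0r subr0.
have ch := running_regular mN La0 posw c0 c1 c01.
have st (a : R) (f : nat -> T -> R) : stopped_sum V00 V01 V11 m N l (r N ^+ 2) x0 x1 delta a f w =
    a * \sum_(m <= n < N) f n w.
  rewrite /stopped_sum mulr_sumr; apply: eq_big_nat => n /andP[mn nN].
  by rewrite ch ?mul1r // mn ltnW.
have rk : 2 * r N ^+ 2 * (k / 2) <= 2 * r N ^+ 2 * k.
  by apply: ler_wpM2l; [rewrite mulr_ge0 ?sqr_ge0|move: k0; lra].
have reg : cov_regular V00 V01 V11 m N l (r N ^+ 2) x0 x1 delta w.
  by rewrite /cov_regular !st !(le_trans _ rk).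
move: hi; rewrite /hit /tilt_size /La -/m -/N -/l reg orbF /on_target !st => /andP[nr0 nr1].
have s0 := near_scale vN rN (erefl l) nr0; have s1 := near_scale vN rN (erefl l) nr1.
have vr : v m * r m <= k / 4 * (v N * r N).
  rewrite mulrA; apply: ler_pM => //; exact: ltW.
have ve : 2 * (v m * r m) <= eta * (v N * r N).
  apply: (@le_trans _ _ (2 * (k / 4 * (v N * r N)))); first by rewrite ler_pM2l.
  have -> : 2 * (k / 4 * (v N * r N)) = k / 2 * (v N * r N) by field.
  by rewrite ler_wpM2r // mulr_ge0 // ltW.
have := H1 m b1; have := H2 m b2; have := H3 m b3; have := H4 m b4.
rewrite !mul0r !add0r !addr0 !mulN1r !mul1r => u4 u3 u2 u1.
rewrite sum_tail // in s0; rewrite sum_tail // in s1.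
by split; [exact: block_to_sum s0 u1 u2 ve|exact: block_to_sum s1 u3 u4 ve].
Qed.

End Lower.
End Planar.

(** * Cluster sets in the plane *)

Section ClusterSet.
Context (R : realType).

Lemma enorm_sqr (x : 'cV[R]_2) : (enorm x <= 1) = (x 0 0 ^+ 2 + x 1 0 ^+ 2 <= 1).
Proof.
rewrite /enorm big_ord_recl big_ord1.
rewrite (_ : lift ord0 ord0 = 1 :> 'I_2); last exact: val_inj.
have s0 : 0 <= x 0 0 ^+ 2 + x 1 0 ^+ 2 by rewrite addr_ge0 ?sqr_ge0.
by rewrite -{1}(sqrtr1 R) ler_sqrt.
Qed.

Lemma Cl_of_frequently (u : nat -> 'cV[R]_2) (z : 'cV[R]_2) :
  (forall e, 0 < e -> forall K, exists2 N, (K <= N)%N &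
     `|u N 0 0 - z 0 0| <= e /\ `|u N 1 0 - z 1 0| <= e) -> Cl u z.
Proof.
move=> H; have /choice[f Hf] : forall jK : nat * nat, exists N, (jK.2 <= N)%N /\
    (`|u N 0 0 - z 0 0| <= jK.1.+1%:R^-1 /\ `|u N 1 0 - z 1 0| <= jK.1.+1%:R^-1).
  by move=> [j K]; have [|N KN h] := H j.+1%:R^-1 _ K; [rewrite invr_gt0|exists N].
pose phi := fix phi j := if j is i.+1 then f (j, (phi i).+1) else f (0%N, 1%N).
have step j : (phi j < phi j.+1)%N by have [] := Hf (j.+1, (phi j).+1).
exists phi; split.
- by apply: homo_ltn => // y x t; exact: ltn_trans.
- by case=> [|j]; [have [] := Hf (0%N, 1%N)|exact: leq_ltn_trans (step j)].
- apply/cvg_ballP => e e0; exists (Num.truncn e^-1).+1 => // j /= ej.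
  have je : j.+1%:R^-1 < e.
    rewrite -[e]invrK ltf_pV2 ?posrE ?invr_gt0 ?ltr0n //.
    by rewrite (lt_le_trans (truncnS_gt _)) // ler_nat ltnW.
  have [h0 h1] : `|u (phi j) 0 0 - z 0 0| <= j.+1%:R^-1 /\
                 `|u (phi j) 1 0 - z 1 0| <= j.+1%:R^-1.
    by case: j {ej je} => [|j]; [have [] := Hf (0%N, 1%N)|have [] := Hf (j.+1, (phi j).+1)].
  split=> // a b; rewrite (ord1 b) -ball_normE /=.
  have [->|->] : a = 0 \/ a = 1.
    by case: a => -[|[|//]] i; [left|right]; exact: val_inj.
  + by rewrite distrC (le_lt_trans h0).
  + by rewrite distrC (le_lt_trans h1).
Qed.

(** For [z] outside the disc, take [(p, q)] rational close to [z]: twice its inner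
    product with [z] is the sum of the squared norms minus the squared distance,
    which exceeds twice the norm of [(p, q)]. *)
Lemma rational_supporting (z0 z1 : R) :
  (forall p q b : rat, 0 < b -> p ^+ 2 + q ^+ 2 < b ^+ 2 ->
     ratr p * z0 + ratr q * z1 <= ratr b) -> z0 ^+ 2 + z1 ^+ 2 <= 1.
Proof.
move=> H; rewrite leNgt; apply/negP => Z1.
set Z := z0 ^+ 2 + z1 ^+ 2 in Z1.
pose e := Num.min 1 ((Z - 1) / 4).
have e0 : 0 < e by rewrite lt_min ltr01 divr_gt0 // subr_gt0.
have e1 : e <= 1 by rewrite ge_min lexx.
have eZ : e <= (Z - 1) / 4 by rewrite ge_min lexx orbT.
have on_target z : exists p : rat, `|ratr p - z| < e.
  have [p] := @rat_in_itvoo R (z - e) (z + e) (ltac:(lra)).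
  by rewrite in_itv /= => pz; exists p; rewrite ltr_distl.
have [p pz] := on_target z0; have [q qz] := on_target z1.
have sq (x : R) : `|x| < e -> x ^+ 2 <= e.
  move=> xe; rewrite -real_normK ?num_real // expr2.
  have : `|x| * `|x| <= e * 1 by apply: ler_pM => //; [exact: ltW|rewrite (le_trans (ltW xe))].
  by rewrite mulr1.
have pe := sq _ pz; have qe := sq _ qz.
set P := ratr p in pz pe *; set Q := ratr q in qz qe *.
have n0 : 0 <= P ^+ 2 + Q ^+ 2 by rewrite addr_ge0 ?sqr_ge0.
pose t := Num.sqrt (P ^+ 2 + Q ^+ 2).
have t2 : t ^+ 2 = P ^+ 2 + Q ^+ 2 by rewrite sqr_sqrtr.
have tlt : t < P * z0 + Q * z1.
  have -> : P * z0 + Q * z1 = (t ^+ 2 + Z - (P - z0) ^+ 2 - (Q - z1) ^+ 2) / 2.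
    by rewrite t2 /Z; field.
  have -> : t = (t ^+ 2 + 1 - (t - 1) ^+ 2) / 2 by field.
  have : 0 <= (t - 1) ^+ 2 by exact: sqr_ge0.
  move: pe qe; rewrite (_ : (_ / 2) ^+ 2 = t ^+ 2); last by congr (_ ^+ 2); field.
  move: ((t - 1) ^+ 2) ((P - z0) ^+ 2) ((Q - z1) ^+ 2) (t ^+ 2) => A B C D.
  by move: eZ e0; lra.
have [b] := @rat_in_itvoo R _ _ tlt; rewrite in_itv /= => /andP[tb bP].
have b0 : 0 < (ratr b : R) by rewrite (le_lt_trans (sqrtr_ge0 _) tb).
have := H p q b; rewrite -/P -/Q leNgt bP => /(_ _ _)/negP; apply => //.
- by rewrite -(ltr_rat R) rmorph0.
- rewrite -(ltr_rat R) rmorphD !rmorphXn /= -/P -/Q -t2.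
  by rewrite ltrXn2r ?nnegrE ?sqrtr_ge0 // ltW.
Qed.

(** Shrinking [z] by the factor [1 - t] leaves room inside the disc both for a
    rational approximation and for [2 * h]. *)
Lemma rational_approx (z0 z1 e : R) : z0 ^+ 2 + z1 ^+ 2 <= 1 -> 0 < e ->
  exists x0 x1 h : rat, [/\ 0 < h, h <= 1, x0 ^+ 2 + x1 ^+ 2 + 2 * h <= 1,
    `|ratr x0 - z0| + 2 * ratr h <= e & `|ratr x1 - z1| + 2 * ratr h <= e].
Proof.
move=> z1' e0; pose t := Num.min (1 / 2) (e / 2).
have t0 : 0 < t by rewrite lt_min !divr_gt0.
have t1 : t <= 1 / 2 by rewrite ge_min lexx.
have te : t <= e / 2 by rewrite ge_min lexx orbT.
have bnd (x y : R) : x ^+ 2 + y ^+ 2 <= 1 -> `|x| <= 1.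
  move=> h; rewrite -(@expr_le1 _ 2) // real_normK ?num_real //.
  by have := sqr_ge0 y; move: h; lra.
have b0 := bnd _ _ z1'; have b1 : `|z1| <= 1 by apply: (@bnd z1 z0); rewrite addrC.
have appr z : `|z| <= 1 -> exists x : rat, [/\ `|ratr x - z| <= t + t / 12 &
    ratr x ^+ 2 <= (1 - t) * z ^+ 2 + t / 4].
  rewrite ler_norml => /andP[za zb].
  have [x] := @rat_in_itvoo R ((1 - t) * z - t / 12) ((1 - t) * z + t / 12) (ltac:(lra)).
  rewrite in_itv /= => /andP[xa xb]; exists x.
  set X := ratr x in xa xb *.
  have tz1 : t * z <= t * 1 by rewrite ler_pM2l.
  have tz2 : t * -1 <= t * z by rewrite ler_pM2l.
  split; first by rewrite ler_norml; apply/andP; split; lra.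
  pose y := X - (1 - t) * z.
  have ya : - (t / 12) <= y by rewrite /y; lra.
  have yb : y <= t / 12 by rewrite /y; lra.
  have -> : X ^+ 2 = (1 - t) ^+ 2 * z ^+ 2 + 2 * ((1 - t) * z) * y + y ^+ 2.
    by rewrite /y; ring.
  have y2 : y ^+ 2 <= t / 12 * (t / 12).
    have yn : `|y| <= t / 12 by rewrite ler_norml ya yb.
    by rewrite -real_normK ?num_real // expr2; apply: ler_pM.
  have t12 : t / 12 * (t / 12) <= t / 12 * 1 by rewrite ler_pM2l ?divr_gt0 //; lra.
  have h1 : (1 - t) ^+ 2 * z ^+ 2 <= (1 - t) * z ^+ 2.
    by rewrite ler_wpM2r ?sqr_ge0 // expr2 ler_piMl //; lra.
  have h2 : 2 * ((1 - t) * z) * y <= 2 * (t / 12).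
    rewrite -mulrA ler_pM2l // (le_trans (ler_norm _)) // normrM -[leRHS]mul1r.
    apply: ler_pM => //; last by rewrite ler_norml ya yb.
    rewrite normrM ger0_norm; last by lra.
    rewrite -[leRHS]mul1r; apply: ler_pM => //; try lra.
    by rewrite ler_norml; apply/andP; split; lra.
  by move: y2 t12 h1 h2; lra.
have [x0 [d0 s0]] := appr _ b0; have [x1 [d1 s1]] := appr _ b1.
have [h] := @rat_in_itvoo R 0 (t / 4) (ltac:(by rewrite divr_gt0)).
rewrite in_itv /= => /andP[h0 ht].
exists x0, x1, h; split.
- by rewrite -(ltr_rat R) rmorph0.
- by rewrite -(ler_rat R) rmorph1; lra.
- rewrite -(ler_rat R) !rmorphD rmorphM !rmorphXn !rmorph1 /=.
  have : (1 - t) * (z0 ^+ 2 + z1 ^+ 2) <= (1 - t) * 1 by rewrite ler_wpM2l //; lra.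
  move: s0 s1 ht; rewrite (rmorph_nat _ 2); lra.
- by move: d0 ht; lra.
- by move: d1 ht; lra.
Qed.

Lemma Cl_disc (u : nat -> 'cV[R]_2) :
  (forall p q b : rat, 0 < b -> p ^+ 2 + q ^+ 2 < b ^+ 2 ->
     exists N0, forall N, (N0 <= N)%N ->
     ratr p * u N 0 0 + ratr q * u N 1 0 <= ratr b) ->
  (forall x0 x1 h : rat, 0 < h -> h <= 1 -> x0 ^+ 2 + x1 ^+ 2 + 2 * h <= 1 ->
     forall K, exists2 N, (K <= N)%N &
     `|u N 0 0 - ratr x0| <= 2 * ratr h /\ `|u N 1 0 - ratr x1| <= 2 * ratr h) ->
  Cl u = [set x | enorm x <= 1].
Proof.
move=> upper lower; apply/seteqP; split=> z /=; rewrite enorm_sqr.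
- move=> [phi [phi_incr _ cv]]; apply: rational_supporting => p q b b0 pqb.
  have [N0 HN] := upper p q b b0 pqb.
  have phik j : (j <= phi j)%N.
    by elim: j => // j IH; apply: leq_ltn_trans IH _; exact: phi_incr.
  have cvi i : u (phi j) i 0 @[j --> \oo] --> z i 0.
    by apply: (cvg_comp _ (fun x : 'cV[R]_2 => x i 0) cv); exact: coord_continuous.
  have cv2 : ratr p * u (phi j) 0 0 + ratr q * u (phi j) 1 0 @[j --> \oo]
      --> ratr p * z 0 0 + ratr q * z 1 0.
    by apply: cvgD; apply: cvgM => //; exact: cvg_cst.
  apply: (cvgr_to_le cv2).
  by exists N0 => // j /= jN; apply: HN; rewrite (leq_trans jN).
- move=> z1; apply: Cl_of_frequently => e e0 K.
  have [x0 [x1 [h [h0 h1 xh d0 d1]]]] := rational_approx z1 e0.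
  have [N KN [e0' e1']] := lower x0 x1 h h0 h1 xh K.
  exists N => //; split.
  + apply: le_trans d0; rewrite [leRHS]addrC; apply: le_trans (lerD e0' (lexx _)).
    by rewrite -[u N 0 0 - z 0 0](subrKA (ratr x0)) ler_normD.
  + apply: le_trans d1; rewrite [leRHS]addrC; apply: le_trans (lerD e1' (lexx _)).
    by rewrite -[u N 1 0 - z 1 0](subrKA (ratr x1)) ler_normD.
Qed.

End ClusterSet.

(** * Truncation and conclusion *)

Lemma ae_forall_count (d : measure_display) (T : measurableType d) (R : realType)
    (P : probability T R) (I : countType) (Q : I -> T -> Prop) :
  (forall i, {ae P, forall w, Q i w}) -> {ae P, forall w, forall i, Q i w}.
Proof.
move=> H; have Hn n : {ae P, forall w,
    (if unpickle n is Some i then Q i w else True : Prop)}.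
  by case: unpickle => [i|]; [exact: H|exact: aeW].
apply: filterS (ae_foralln Hn) => w Hw i.
by have := Hw (pickle i); rewrite pickleK.
Qed.

Section Reduction.
Context (d : measure_display) (T : measurableType d) (R : realType).
Variables (P : probability T R) (F : nat -> set (set T)).
Variables (Y : nat -> T -> 'cV[R]_2) (V : nat -> T -> 'M[R]_2) (c : nat -> R).
Hypotheses (hF : decreasing_filtration F)
    (hY : reverse_martingale_difference P F Y)
    (hV : forall n, is_cond_exp_mx P (F n.+1)
                      (fun w => Y n w *m (Y n w)^T) (V n))
    (hc0 : forall n, 0 <= c n)
    (hc : forall n, \forall w \ae P, enorm (Y n w) <= c n).

Definition yclip i n w : R := clip (c n) (Y n w i 0).
Definition vclip i j n w : R := clip (c n ^+ 2) (V n w i j).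

Lemma coord_le_enorm (x : 'cV[R]_2) i : `|x i 0| <= enorm x.
Proof.
rewrite /enorm -sqrtr_sqr ler_wsqrtr // (bigD1 i) //= lerDl.
by apply: sumr_ge0 => j _; exact: sqr_ge0.
Qed.

Lemma bm_yclip i n : bounded_mfun (F n) (yclip i n).
Proof.
apply: bm_clip => //; have [mY _] := hY n.
exact: (measurable_wrt_comp mY (@coord_continuous R 2 1 i 0)).
Qed.

Lemma yclip_le i n w : `|yclip i n w| <= c n.
Proof. exact: clip_bound. Qed.

Lemma yclip_ae i : {ae P, forall w, forall n, Y n w i 0 = yclip i n w}.
Proof.
apply: ae_foralln => n; apply: filterS (hc n) => w h.
by rewrite /yclip clip_id // (le_trans (coord_le_enorm _ _)).
Qed.

Lemma bm_yclipT i n : bounded_mfun measurable (yclip i n).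
Proof. exact: (bm_filtT hF (bm_yclip i n)). Qed.

Lemma yclip_ae1 i n : {ae P, forall w, Y n w i 0 = yclip i n w}.
Proof. by apply: filterS (yclip_ae i) => w. Qed.

Lemma mean_yclip i n U : bounded_mfun (F n.+1) U -> Expect P (fun w => U w * yclip i n w) = 0.
Proof.
move=> bU; have [_ /(_ i 0) ce] := hY n.
have [_ /(_ U bU) ->] := cond_exp_bounded_version (filtration_sigma hF n.+1)
  (filtration_meas hF (n:=n.+1)) (is_cond_expW ce) (bm_yclipT i n) (yclip_ae1 i n)
  (yclip_le i n).
have -> : (fun w => U w * clip (c n) ((0 : 'M[R]_(2, 1)) i 0)) = (fun=> 0).
  by apply/funext => w; rewrite mxE clip_id ?normr0 // mulr0.
exact: Expect_cst.
Qed.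

Lemma cov_clip i j n : [/\ bounded_mfun (F n.+1) (vclip i j n),
  {ae P, forall w, V n w i j = vclip i j n w} &
  forall U, bounded_mfun (F n.+1) U -> Expect P (fun w => U w * (yclip i n w * yclip j n w)) =
    Expect P (fun w => U w * vclip i j n w)].
Proof.
have ce : cond_exp P (F n.+1) (fun w => Y n w i 0 * Y n w j 0) (fun w => V n w i j).
  have := is_cond_expW (hV n i j).
  by under [X in cond_exp _ _ X]eq_fun do rewrite mxE big_ord1 mxE.
have [_ _ mV _] := ce.
have [] := @cond_exp_bounded_version _ _ _ _ _ (filtration_sigma hF n.+1)
  (filtration_meas hF (n:=n.+1)) (c n ^+ 2) _ (fun w => yclip i n w * yclip j n w) _ ce.
- by apply: bmM; exact: bm_yclipT.
- by apply: filterS2 (yclip_ae1 i n) (yclip_ae1 j n) => w -> ->.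
- by move=> w; rewrite normrM expr2; apply: ler_pM => //; exact: yclip_le.
- by move=> h1 h2; split=> //; apply: bm_clip => //; exact: sqr_ge0.
Qed.

(** The two off-diagonal entries are versions of the same conditional expectation
    but may differ on a null set; the variance of a linear combination involves
    their sum. *)
Definition v01clip n w : R := vclip 0 1 n w + vclip 1 0 n w.

Lemma direction_rmd (a0 a1 : R) :
  scalar_rmd P F (dir_incr (yclip 0) (yclip 1) a0 a1)
    (dir_var (vclip 0 0) v01clip (vclip 1 1) a0 a1).
Proof.
move=> n; have bY i := bm_yclip i n; have bYT i := bm_yclipT i n.
have [b00 _ e00] := cov_clip 0 0 n; have [b01 _ e01] := cov_clip 0 1 n.
have [b10 _ e10] := cov_clip 1 0 n; have [b11 _ e11] := cov_clip 1 1 n.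
have bVT (f : T -> R) : bounded_mfun (F n.+1) f -> bounded_mfun measurable f.
  by move=> h; exact: (bm_filtT hF h).
have t00 := bVT _ b00; have t01 := bVT _ b01; have t10 := bVT _ b10; have t11 := bVT _ b11.
have y0 := bY 0; have y1 := bY 1; have yt0 := bYT 0; have yt1 := bYT 1.
split.
- by rewrite /dir_incr; bm_tac.
- by rewrite /dir_var /v01clip; bm_tac.
- move=> U bU; have bUT := bVT _ bU.
  have -> : (fun w => U w * dir_incr (yclip 0) (yclip 1) a0 a1 n w) =
      (fun w => a0 * (U w * yclip 0 n w) + a1 * (U w * yclip 1 n w)).
    by apply/funext => w; rewrite /dir_incr; ring.
  by rewrite ExpectD ?ExpectZ ?mean_yclip ?mulr0 ?addr0 //; bm_tac.
- move=> U bU; have bUT := bVT _ bU.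
  have -> : (fun w => U w * dir_incr (yclip 0) (yclip 1) a0 a1 n w ^+ 2) =
      (fun w => (a0 ^+ 2 * (U w * (yclip 0 n w * yclip 0 n w)) +
        a0 * a1 * (U w * (yclip 0 n w * yclip 1 n w))) +
        (a0 * a1 * (U w * (yclip 1 n w * yclip 0 n w)) +
        a1 ^+ 2 * (U w * (yclip 1 n w * yclip 1 n w)))).
    by apply/funext => w; rewrite /dir_incr; ring.
  have -> : (fun w => U w * dir_var (vclip 0 0) v01clip (vclip 1 1) a0 a1 n w) =
      (fun w => (a0 ^+ 2 * (U w * vclip 0 0 n w) + a0 * a1 * (U w * vclip 0 1 n w)) +
        (a0 * a1 * (U w * vclip 1 0 n w) + a1 ^+ 2 * (U w * vclip 1 1 n w))).
    by apply/funext => w; rewrite /dir_var /v01clip; ring.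
  rewrite !ExpectD; try by bm_tac.
  by rewrite !ExpectZ ?e00 ?e01 ?e10 ?e11 //; bm_tac.
Qed.

End Reduction.

Theorem theorem2p2 (d : measure_display) (T : measurableType d)
    (R : realType) (P : probability T R)
    (F : nat -> set (set T)) (Y : nat -> T -> 'cV[R]_2)
    (V : nat -> T -> 'M[R]_2) (c v : nat -> R)
    (hF : decreasing_filtration F)
    (hY : reverse_martingale_difference P F Y)
    (hV : forall n, is_cond_exp_mx P (F n.+1)
                      (fun w => Y n w *m (Y n w)^T) (V n))
    (hc0 : forall n, 0 <= c n)
    (hc : forall n, \forall w \ae P, enorm (Y n w) <= c n)
    (hv0 : forall N, (1 <= N)%N -> 0 < v N)
    (hvmono : forall M N, (1 <= M)%N -> (M <= N)%N -> v M <= v N)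
    (hvoo : v N @[N --> \oo] --> +oo) :
  let M := fun (N : nat) (w : T) => \sum_(0 <= n < N) Y n w in
  let Q := fun (N : nat) (w : T) => \sum_(0 <= n < N) V n w in
  let cstar := fun N : nat => \big[Num.max/0]_(0 <= n < N) c n in
  (\forall w \ae P,
     (v N ^+ 2)^-1 *: Q N w @[N --> \oo] --> ((2^-1)%:M : 'M[R]_2)) ->
  cstar N * Num.sqrt (L (L (v N ^+ 2))) / v N @[N --> \oo] --> (0 : R) ->
  \forall w \ae P,
    Cl (fun N => (v N * Num.sqrt (L (L (v N ^+ 2))))^-1 *: M N w)
    = [set x : 'cV[R]_2 | enorm x <= 1].
Proof.
move=> M Q cstar HQ Hc.
have hcs (e : R) : 0 < e -> exists N0, forall N, (N0 <= N)%N ->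
    forall n, (n < N)%N -> c n * sqrtLL v N <= e * v N.
  move=> e0; have /cvgrPdist_le/(_ e e0)[N0 _ H] := Hc.
  exists N0 => N /H /= h n nN.
  have vN : 0 < v N by apply: hv0; exact: leq_ltn_trans nN.
  have cn : c n <= cstar N.
    by apply: le_bigmax_seq => //; rewrite mem_index_iota.
  apply: (@le_trans _ _ (cstar N * sqrtLL v N)).
    by rewrite ler_wpM2r // ltW // sqrtLL_gt0.
  rewrite -ler_pdivrMr //; move: h; rewrite sub0r normrN.
  exact: le_trans (ler_norm _).
have entry : {ae P, forall w, forall i j (e : R), 0 < e -> exists N0, forall N,
    (N0 <= N)%N -> `|\sum_(0 <= n < N) V n w i j - (i == j)%:R * (v N ^+ 2 / 2)|
                    <= e * v N ^+ 2}.
  apply: filterS HQ => w cv i j e e0.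
  have cvi : ((v N ^+ 2)^-1 *: Q N w) i j @[N --> \oo] --> ((2^-1)%:M : 'M[R]_2) i j.
    by apply: (cvg_comp _ (fun x : 'M[R]_2 => x i j) cv); exact: coord_continuous.
  have /cvgrPdist_le/(_ e e0)[N0 _ H] := cvi.
  exists (maxn N0 1) => N; rewrite geq_max => /andP[N0N N1].
  have v2 : 0 < v N ^+ 2 by rewrite exprn_gt0 // hv0.
  have := H N N0N; rewrite /= !mxE summxE distrC => h.
  rewrite -ler_pdivrMr // -[X in _ / X](gtr0_norm v2) -normf_div mulrBl.
  apply: le_trans h; rewrite le_eqVlt; apply/orP; left; apply/eqP; congr (`| _ |).
  rewrite -[2^-1 *+ _]mulr_natl; move: (\sum_(0 <= n < N) V n w i j) (i == j)%:R => S t.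
  by field; rewrite gt_eqF // hv0.
pose y i := yclip Y c i; pose s i j := vclip V c i j.
pose s01 := v01clip V c.
have eqV i j : {ae P, forall w, forall n, V n w i j = s i j n w}.
  by apply: ae_foralln => n; have [] := cov_clip hF hY hV hc0 hc i j n.
have hq : {ae P, forall w, forall e : R, 0 < e ->
    exists N0, forall N, (N0 <= N)%N -> cov_near (s 0 0) s01 (s 1 1) v e N w}.
  apply: filterS2 (filterI entry (filterI (eqV 0 0) (eqV 0 1)))
    (filterI (eqV 1 0) (eqV 1 1)) => w [ent [e00 e01]] [e10 e11] e e0.
  have e2 : 0 < e / 2 by rewrite divr_gt0.
  have [N0 H0] := ent 0 0 _ e0; have [N1 H1] := ent 1 1 _ e0.
  have [N2 H2] := ent 0 1 _ e2; have [N3 H3] := ent 1 0 _ e2.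
  exists (N0 + N1 + N2 + N3)%N => N hN.
  have n0 : (N0 <= N)%N by move: hN; clear; lia.
  have n1 : (N1 <= N)%N by move: hN; clear; lia.
  have n2 : (N2 <= N)%N by move: hN; clear; lia.
  have n3 : (N3 <= N)%N by move: hN; clear; lia.
  move: (H0 N n0) (H1 N n1) (H2 N n2) (H3 N n3); rewrite !eqxx.
  rewrite (_ : (0 == 1 :> 'I_2) = false) // (_ : (1 == 0 :> 'I_2) = false) //.
  rewrite !mul1r !mul0r !subr0 => h0 h1 h2 h3; split.
  - by under eq_bigr do rewrite -e00.
  - by under eq_bigr do rewrite -e11.
  - under eq_bigr do rewrite /s01 /v01clip -/(s 0 1 _ _) -/(s 1 0 _ _) -e01 -e10.
    rewrite big_split /=; apply: le_trans (ler_normD _ _) _.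
    by apply: le_trans (lerD h2 h3) _; rewrite -mulrDl -splitr.
have dir := direction_rmd hF hY hV hc0 hc.
have yc i n w : `|y i n w| <= c n by exact: yclip_le.
have up : {ae P, forall w, forall a : rat * rat * rat, 0 < a.2 ->
    a.1.1 ^+ 2 + a.1.2 ^+ 2 < a.2 ^+ 2 -> exists N0, forall N, (N0 <= N)%N ->
    ratr a.1.1 * \sum_(0 <= n < N) y 0 n w + ratr a.1.2 * \sum_(0 <= n < N) y 1 n w
      <= ratr a.2 * (v N * sqrtLL v N)}.
  apply: ae_forall_count => -[[p q] b] /=.
  have [b0|b0] := boolP (0 < b); last exact: aeW.
  have [pqb|pqb] := boolP (p ^+ 2 + q ^+ 2 < b ^+ 2); last exact: aeW.
  have b0' : 0 < (ratr b : R) by rewrite -(rmorph0 ratr) ltr_rat.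
  have pqb' : (ratr p : R) ^+ 2 + ratr q ^+ 2 < ratr b ^+ 2.
    by rewrite -!rmorphXn -rmorphD ltr_rat.
  apply: filterS (direction_upper_lil hF dir (yc 0) (yc 1) hv0 hvmono hvoo hcs hq b0' pqb').
  by move=> w h _ _.
have low : {ae P, forall w, forall a : rat * rat * rat, 0 < a.2 -> a.2 <= 1 ->
    a.1.1 ^+ 2 + a.1.2 ^+ 2 + 2 * a.2 <= 1 -> forall K, exists2 N, (K <= N)%N &
    `|\sum_(0 <= n < N) y 0 n w - ratr a.1.1 * (v N * sqrtLL v N)|
      <= 2 * ratr a.2 * (v N * sqrtLL v N) /\
    `|\sum_(0 <= n < N) y 1 n w - ratr a.1.2 * (v N * sqrtLL v N)|
      <= 2 * ratr a.2 * (v N * sqrtLL v N)}.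
  apply: ae_forall_count => -[[x0 x1] h] /=.
  have [h0|h0] := boolP (0 < h); last exact: aeW.
  have [h1|h1] := boolP (h <= 1); last exact: aeW.
  have [xh|xh] := boolP (x0 ^+ 2 + x1 ^+ 2 + 2 * h <= 1); last exact: aeW.
  have h0' : 0 < (ratr h : R) by rewrite -(rmorph0 ratr) ltr_rat.
  have h1' : (ratr h : R) <= 1 by rewrite -(rmorph1 ratr) ler_rat.
  have xh' : (ratr x0 : R) ^+ 2 + ratr x1 ^+ 2 + 2 * ratr h <= 1.
    have := xh; rewrite -(ler_rat R) !rmorphD !rmorphXn rmorphM rmorph1 /=.
    by rewrite (rmorph_nat _ 2).
  apply: filterS (near_target_infinitely_often hF dir (yc 0) (yc 1)
    hv0 hvmono hvoo hcs hq h0' h1' xh').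
  by move=> w hw _ _ _.
apply: filterS2 (filterI up low) (filterI (yclip_ae hc 0) (yclip_ae hc 1)).
move=> w [upw loww] [y0 y1].
have uE N i : ((v N * Num.sqrt (L (L (v N ^+ 2))))^-1 *: M N w) i 0 =
    (v N * sqrtLL v N)^-1 * \sum_(0 <= n < N) y i n w.
  rewrite mxE summxE; congr (_ * _); apply: eq_bigr => n _.
  have [->|->] : i = 0 \/ i = 1; [|exact: y0|exact: y1].
  by case: i => -[|[|//]] hi; [left|right]; exact: val_inj.
have a0 N : (1 <= N)%N -> 0 < v N * sqrtLL v N by move=> N1; rewrite mulr_gt0 ?hv0 ?sqrtLL_gt0.
apply: Cl_disc => [p q b b0 pqb|x0 x1 h h0 h1 xh K].
- have [N0 H] := upw (p, q, b) b0 pqb; exists (maxn N0 1) => N.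
  rewrite geq_max => /andP[N0N /a0 aN]; rewrite !uE.
  rewrite mulrCA [X in _ + X]mulrCA -mulrDr ler_pdivrMl // [leRHS]mulrC.
  exact: H.
- have [N] := loww (x0, x1, h) h0 h1 xh (maxn K 1).
  rewrite geq_max => /andP[KN /a0 aN] [l0 l1]; exists N => //; rewrite !uE /=.
  have sc (S x e : R) : `|S - x * (v N * sqrtLL v N)| <= e * (v N * sqrtLL v N) ->
      `|(v N * sqrtLL v N)^-1 * S - x| <= e.
    move=> hS; rewrite -(ler_pM2r aN) -[X in _ * X <= _](gtr0_norm aN) -normrM mulrBl.
    by rewrite mulrAC mulVf ?mul1r // gt_eqF.
  by split; exact: sc.
Qed.
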